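(* Let $\mathcal F=\{F_i\}_{i\in I}$, $I=I_v\sqcup I_e$, be a factorization inverse system over a field $F$ such that the base change functor $\beta:\mathrm{Vect}(F)\to\mathrm{PP}(\mathcal F)$ is an equivalence of categories, and fix for each $k\in I_e$ an ordering $(l,r,k)$ of the two indices $l,r\in I_v$ dominating $k$; let $S_I$ be the set of these triples. Let $G$ be a linear algebraic group over $F$. Then there is a map of pointed sets $\delta:\prod_{k\in I_e}G(F_k)\to H^1(F,G)$ such that the sequence of pointed sets $$1\to G(F)\to\prod_{i\in I_v}G(F_i)\to\prod_{k\in I_e}G(F_k)\xrightarrow{\delta}H^1(F,G)\to\prod_{i\in I_v}H^1(F_i,G)\rightrightarrows\prod_{k\in I_e}H^1(F_k,G)$$ is exact, where the first two maps are the diagonal map and $(g_i)\mapsto(g_r^{-1}g_l)_k$ for $(l,r,k)\in S_I$, the next map is restriction, the last two maps are induced by the inclusions $F_l\hookrightarrow F_k$ and $F_r\hookrightarrow F_k$ respectively, and exactness at $\prod_{i\in I_v}H^1(F_i,G)$ means that the image of $H^1(F,G)$ is exactly the set of elements on which the two last maps agree. Moreover, two elements $(g_k),(\tilde g_k)\in\prod_{k\in I_e}G(F_k)$ have the same image under $\delta$ if and only if there are $(g_i)\in\prod_{i\in I_v}G(F_i)$ such that $g_k=g_r^{-1}\tilde g_kg_l$ for all $(l,r,k)\in S_I$.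
   Context: A factorization inverse system over $F$ is a finite inverse system of fields and inclusions $F_i$ ($i\in I$) whose inverse limit in the category of rings is $F$, such that $I=I_v\sqcup I_e$ and for each $k\in I_e$ there are exactly two indices in $I_v$ whose fields include into $F_k$, with no other relations. $\mathrm{PP}(\mathcal F)$ is the category of vector space patching problems: systems of finite dimensional $F_i$-vector spaces $V_i$ with $F_j$-isomorphisms $V_i\otimes_{F_i}F_j\to V_j$ whenever $F_i\hookrightarrow F_j$ is in the system; $\beta$ is base change. A linear algebraic group is a smooth affine group scheme of finite type; $H^1$ is Galois cohomology (a pointed set), and exactness means kernel equals image. *)

(* Defs.v *)
(* Plain MathComp, with mathcomp.classical.boolp for classical logic and
   extensionality, and multinomials for polynomial rings in n variables.      *)
From HB Require Import structures.
From mathcomp Require Import all_boot all_order all_algebra all_field.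
From mathcomp Require Import boolp mpoly.
Set Implicit Arguments.
Unset Strict Implicit.
Unset Printing Implicit Defensive.
Import GRing.Theory passmx.
Local Open Scope ring_scope.
Local Open Scope quotient_scope.

(* -------------------------------------------------------------------------- *)
(* Categories and equivalences                                                *)

Record category := Category {
  obj :> Type;
  hom : obj -> obj -> Type;
  idm : forall X, hom X X;
  comp : forall X Y Z, hom Y Z -> hom X Y -> hom X Z;
  comp1m : forall X Y (f : hom X Y), comp (idm Y) f = f;
  compm1 : forall X Y (f : hom X Y), comp f (idm X) = f;
  compmA : forall X Y Z W (f : hom Z W) (g : hom Y Z) (h : hom X Y),
    comp f (comp g h) = comp (comp f g) h
}.
Arguments hom {c}.
Arguments idm {c}.
Arguments comp {c X Y Z}.

Record functor (C D : category) := Functor {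
  fobj :> C -> D;
  fmap : forall X Y : C, hom X Y -> hom (fobj X) (fobj Y);
  fmap1 : forall X : C, fmap (idm X) = idm (fobj X);
  fmapM : forall (X Y Z : C) (f : hom Y Z) (g : hom X Y),
    fmap (comp f g) = comp (fmap f) (fmap g)
}.
Arguments fmap {C D} _ {X Y}.

Program Definition functor_id (C : category) : functor C C :=
  @Functor C C id (fun _ _ f => f) _ _.

Program Definition functor_comp (C D E : category)
    (H : functor D E) (K : functor C D) : functor C E :=
  @Functor C E (fun X => H (K X)) (fun _ _ f => fmap H (fmap K f)) _ _.
Next Obligation. by intros; rewrite !fmap1. Qed.
Next Obligation. by intros; rewrite !fmapM. Qed.

Record nat_iso (C D : category) (H K : functor C D) := NatIso {
  nat_to : forall X, hom (H X) (K X);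
  nat_from : forall X, hom (K X) (H X);
  nat_toK : forall X, comp (nat_from X) (nat_to X) = idm (H X);
  nat_fromK : forall X, comp (nat_to X) (nat_from X) = idm (K X);
  nat_natural : forall X Y (f : hom X Y),
    comp (nat_to Y) (fmap H f) = comp (fmap K f) (nat_to X)
}.

Definition is_equivalence (C D : category) (H : functor C D) : Prop :=
  exists K : functor D C,
    inhabited (nat_iso (functor_comp K H) (functor_id C)) /\
    inhabited (nat_iso (functor_comp H K) (functor_id D)).

(* -------------------------------------------------------------------------- *)
(* Finite-dimensional vector spaces and extension of scalars                  *)

Section Vect.
Variable F : fieldType.

Fact lfun_comp1l (U V : vectType F) (f : 'Hom(U, V)) : (\1 \o f)%VF = f.
Proof. exact: comp_lfun1l. Qed.
Fact lfun_comp1r (U V : vectType F) (f : 'Hom(U, V)) : (f \o \1)%VF = f.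
Proof. exact: comp_lfun1r. Qed.

Definition Vect : category :=
  @Category (vectType F) (fun U V => 'Hom(U, V)) (fun U => \1%VF)
    (fun U V W f g => (f \o g)%VF) lfun_comp1l lfun_comp1r
    (fun U V W X f g h => comp_lfunA f g h).

End Vect.

(* The tensor product K (x)_F V along phi : F -> K: the K-space of row vectors
   on the basis 1 (x) e_j, where (e_j) is the library's basis of V.  Below,
   [ext_elt phi v] is 1 (x) v, and the pair (ext phi V, ext_elt phi) has the
   universal property of extension of scalars: see [ext_elt_semilinear],
   [ext_liftE] and [ext_hom_eq].                                              *)
Definition ext (F K : fieldType) (phi : {rmorphism F -> K}) (V : vectType F) :
  vectType K := 'rV[K]_(\dim {: V}).

Section ExtensionOfScalars.
Variables (F K : fieldType) (phi : {rmorphism F -> K}).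
Local Notation ext := (ext phi).

Definition semilinear_along (V : vectType F) (W : vectType K) (f : V -> W) :=
  forall (a : F) (u v : V), f (a *: u + v) = phi a *: f u + f v.

Definition ext_elt (V : vectType F) (v : V) : ext V :=
  map_mx phi (rVof (vbasis {: V}) v).

Definition ext_lift_fun (V : vectType F) (W : vectType K) (f : V -> W) :
  ext V -> W :=
  fun x : 'rV_(\dim {: V}) => \sum_j x 0 j *: f (vbasis {: V})`_j.

Lemma ext_lift_fun_linear (V : vectType F) (W : vectType K) (f : V -> W) :
  linear (@ext_lift_fun V W f).
Proof.
move=> a x y; rewrite /ext_lift_fun scaler_sumr -big_split /=.
by apply: eq_bigr => j _; rewrite !mxE scalerDl scalerA.
Qed.

HB.instance Definition _ (V : vectType F) (W : vectType K) (f : V -> W) :=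
  GRing.isSemilinear.Build K (ext V) W _ (@ext_lift_fun V W f)
    (GRing.semilinear_linear (@ext_lift_fun_linear V W f)).

Definition ext_lift (V : vectType F) (W : vectType K) (f : V -> W) :
  'Hom(ext V, W) := linfun (ext_lift_fun f).

(* K (x) f; see [ext_mapE].                                                   *)
Definition ext_map (U V : vectType F) (f : 'Hom(U, V)) :
  'Hom(ext U, ext V) :=
  linfun (mulmxr (map_mx phi (mxof (vbasis {: U}) (vbasis {: V}) f))).

Lemma ext_mapmx (U V : vectType F) (f : 'Hom(U, V)) (x : ext U) :
  ext_map f x = x *m map_mx phi (mxof (vbasis {: U}) (vbasis {: V}) f).
Proof. by rewrite lfunE. Qed.

Lemma ext_elt_semilinear V : semilinear_along (@ext_elt V).
Proof.
by move=> a u v; rewrite /ext_elt linearP /= map_mxD map_mxZ.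
Qed.

Lemma ext_elt_basis (V : vectType F) (j : 'I_(\dim {: V})) :
  ext_elt (vbasis {: V})`_j = delta_mx 0 j.
Proof.
by rewrite /ext_elt rVofE ?vbasisP // map_delta_mx.
Qed.

Lemma semilinear_sum (V : vectType F) (W : vectType K) (f : V -> W) :
  semilinear_along f -> forall n (a : 'I_n -> F) (v : 'I_n -> V),
  f (\sum_i a i *: v i) = \sum_i phi (a i) *: f (v i).
Proof.
move=> fP; have f0 : f 0 = 0.
  have := fP 1 0 0; rewrite rmorph1 !scale1r addr0 => f00.
  by apply: (addrI (f 0)); rewrite -f00 addr0.
elim=> [|n IHn] a v; first by rewrite !big_ord0.
by rewrite !big_ord_recl fP IHn.
Qed.

Lemma ext_liftE (V : vectType F) (W : vectType K) (f : V -> W) (v : V) :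
  semilinear_along f -> ext_lift f (ext_elt v) = f v.
Proof.
move=> fP; rewrite lfunE /= /ext_lift_fun.
rewrite [in RHS](coord_vbasis (memvf v)) semilinear_sum //.
by apply: eq_bigr => j _; rewrite !mxE.
Qed.

Lemma ext_hom_eq (V : vectType F) (W : vectType K) (f g : 'Hom(ext V, W)) :
  (forall v, f (ext_elt v) = g (ext_elt v)) -> f = g.
Proof.
move=> fg; apply/lfunP => /= x; rewrite [x](matrix_sum_delta x).
rewrite !linear_sum; apply: eq_bigr => i _; rewrite !linear_sum.
apply: eq_bigr => j _; rewrite !linearZ /= (ord1 i) -ext_elt_basis.
by rewrite fg.
Qed.

Lemma ext_mapE (U V : vectType F) (f : 'Hom(U, V)) (u : U) :
  ext_map f (ext_elt u) = ext_elt (f u).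
Proof.
by rewrite ext_mapmx /ext_elt -map_mxM -rVof_app ?vbasisP.
Qed.

Lemma ext_map1 (V : vectType F) : ext_map (\1%VF : 'Hom(V, V)) = \1%VF.
Proof.
apply: ext_hom_eq => v; rewrite [RHS]id_lfunE.
by rewrite [LHS](ext_mapE (\1%VF : 'Hom(V, V)) v) id_lfunE.
Qed.

Lemma ext_mapM (U V W : vectType F) (f : 'Hom(V, W)) (g : 'Hom(U, V)) :
  ext_map (f \o g)%VF = (ext_map f \o ext_map g)%VF.
Proof.
apply: ext_hom_eq => v; rewrite [RHS]comp_lfunE (ext_mapE g v) (ext_mapE f).
by rewrite [LHS](ext_mapE (f \o g)%VF v) comp_lfunE.
Qed.

End ExtensionOfScalars.

(* The isomorphism L (x)_K (K (x)_F V) -> L (x)_F V,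
   b (x) (a (x) v) |-> b j(a) (x) v; it is L-linear and is therefore given by
   the semilinear map a (x) v |-> j(a) (x) v on K (x)_F V.                    *)
Section ExtensionTwice.
Variables (F K L : fieldType).
Variables (phi : {rmorphism F -> K}) (psi : {rmorphism F -> L}).
Variable (j : {rmorphism K -> L}).
Hypothesis jphi : forall c, j (phi c) = psi c.
Variable V : vectType F.

Definition ext_ext_fun : ext phi V -> ext psi V :=
  fun x : 'rV_(\dim {: V}) => map_mx j x.

Definition ext_ext : 'Hom(ext j (ext phi V), ext psi V) :=
  ext_lift j ext_ext_fun.

Lemma ext_ext_fun_semilinear : semilinear_along j ext_ext_fun.
Proof. by move=> a u v; rewrite /ext_ext_fun map_mxD map_mxZ. Qed.

Lemma ext_extE (x : ext phi V) :
  ext_ext (ext_elt j x) = map_mx j (x : 'rV_(\dim {: V})).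
Proof. by rewrite ext_liftE //; exact: ext_ext_fun_semilinear. Qed.

Lemma ext_ext_elt (v : V) : ext_ext (ext_elt j (ext_elt phi v)) = ext_elt psi v.
Proof.
rewrite ext_extE /ext_elt -map_mx_comp.
by apply: eq_map_mx => c /=; rewrite jphi.
Qed.

Lemma ext_ext_bij : bijective ext_ext.
Proof.
pose h : 'Hom(ext psi V, ext j (ext phi V)) := ext_lift psi
  (fun v => ext_elt j (ext_elt phi v)).
have hP : semilinear_along psi (fun v : V => ext_elt j (ext_elt phi v)).
  by move=> a u v; rewrite (ext_elt_semilinear phi) (ext_elt_semilinear j) jphi.
have hE v : h (ext_elt psi v) = ext_elt j (ext_elt phi v) by rewrite ext_liftE.
exists h; last first.
  suff e : (ext_ext \o h)%VF = \1%VF by move=> y; rewrite -comp_lfunE e id_lfunE.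
  by apply: ext_hom_eq => v; rewrite comp_lfunE hE ext_ext_elt id_lfunE.
suff e : (h \o ext_ext)%VF = \1%VF by move=> x; rewrite -comp_lfunE e id_lfunE.
apply: ext_hom_eq => x; rewrite comp_lfunE id_lfunE ext_extE.
have -> : map_mx j (x : 'rV_(\dim {: V})) =
    \sum_i j ((x : 'rV_(\dim {: V})) 0 i) *: ext_elt psi (vbasis {: V})`_i.
  rewrite [LHS]row_sum_delta; apply: eq_bigr => i _.
  by rewrite ext_elt_basis mxE.
rewrite linear_sum /=; under eq_bigr do rewrite linearZ /= hE ext_elt_basis.
rewrite -(semilinear_sum (@ext_elt_semilinear _ _ j _)).
by rewrite -row_sum_delta.
Qed.

End ExtensionTwice.

(* -------------------------------------------------------------------------- *)
(* Factorization inverse systems and vector space patching problems           *)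

(* The index set is I = vert + edge; [ends k] is the set of the two indices in
   I_v whose fields include into F_k.  A cone over the system with vertex F is
   a limit in the category of rings iff the induced map from F to the ring of
   compatible families is bijective, which is [fs_limit].                     *)
Record factorization_system (F : fieldType) := FactorizationSystem {
  vert : finType;
  edge : finType;
  fld_v : vert -> fieldType;
  fld_e : edge -> fieldType;
  ends : edge -> {set vert};
  card_ends : forall k, #|ends k| = 2%N;
  incl : forall i k, i \in ends k -> {rmorphism fld_v i -> fld_e k};
  cone_v : forall i, {rmorphism F -> fld_v i};
  cone_e : forall k, {rmorphism F -> fld_e k};
  cone_incl : forall i k (ik : i \in ends k) c,
    incl ik (cone_v i c) = cone_e k c;
  fs_limit : forall (a : forall i, fld_v i) (b : forall k, fld_e k),
    (forall i k (ik : i \in ends k), incl ik (a i) = b k) ->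
    exists! c : F, (forall i, cone_v i c = a i) /\ (forall k, cone_e k c = b k)
}.
Arguments vert {F}.
Arguments edge {F}.
Arguments fld_v {F} _.
Arguments fld_e {F} _.
Arguments ends {F} _ _.
Arguments incl {F f i k}.
Arguments cone_v {F} _ _.
Arguments cone_e {F} _ _.

(* An ordering (l, r, k), for every k in I_e, of the two elements of ends k.  *)
Record edge_ordering (F : fieldType) (S : factorization_system F) :=
  EdgeOrdering {
  left_end : edge S -> vert S;
  right_end : edge S -> vert S;
  left_in : forall k, left_end k \in ends S k;
  right_in : forall k, right_end k \in ends S k;
  left_neq_right : forall k, left_end k != right_end k
}.

Section Patching.
Variables (F : fieldType) (S : factorization_system F).

Record pp_problem := PPProblem {
  pp_v : forall i, vectType (fld_v S i);
  pp_e : forall k, vectType (fld_e S k);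
  pp_glue : forall i k (ik : i \in ends S k),
    'Hom(ext (incl ik) (pp_v i), pp_e k);
  pp_glue_bij : forall i k (ik : i \in ends S k), bijective (pp_glue ik)
}.

Record pp_hom (P Q : pp_problem) := PPHom {
  pp_hom_v : forall i, 'Hom(pp_v P i, pp_v Q i);
  pp_hom_e : forall k, 'Hom(pp_e P k, pp_e Q k);
  pp_hom_glue : forall i k (ik : i \in ends S k),
    (pp_glue Q ik \o ext_map (incl ik) (pp_hom_v i))%VF
      = (pp_hom_e k \o pp_glue P ik)%VF
}.

Lemma pp_hom_eq (P Q : pp_problem) (f g : pp_hom P Q) :
  (forall i, pp_hom_v f i = pp_hom_v g i) ->
  (forall k, pp_hom_e f k = pp_hom_e g k) -> f = g.
Proof.
case: f g => [fv fe fP] [gv ge gP] /= ev ee.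
have {}ev := functional_extensionality_dep ev.
have {}ee := functional_extensionality_dep ee; subst gv ge.
by rewrite (Prop_irrelevance fP gP).
Qed.

Program Definition pp_id (P : pp_problem) : pp_hom P P :=
  @PPHom P P (fun i => \1%VF) (fun k => \1%VF) _.
Next Obligation.
by intros; rewrite ext_map1 comp_lfun1l comp_lfun1r.
Qed.

Program Definition pp_comp (P Q T : pp_problem) (f : pp_hom Q T)
    (g : pp_hom P Q) : pp_hom P T :=
  @PPHom P T (fun i => (pp_hom_v f i \o pp_hom_v g i)%VF)
    (fun k => (pp_hom_e f k \o pp_hom_e g k)%VF) _.
Next Obligation.
intros; rewrite ext_mapM comp_lfunA pp_hom_glue -comp_lfunA pp_hom_glue.
by rewrite comp_lfunA.
Qed.

Program Definition PP : category :=
  @Category pp_problem pp_hom pp_id pp_comp _ _ _.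
Next Obligation.
by intros; apply: pp_hom_eq => ?; rewrite /= comp_lfun1l.
Qed.
Next Obligation.
by intros; apply: pp_hom_eq => ?; rewrite /= comp_lfun1r.
Qed.
Next Obligation.
by intros; apply: pp_hom_eq => ?; rewrite /= comp_lfunA.
Qed.

Definition base_change_obj (V : vectType F) : pp_problem :=
  @PPProblem (fun i => ext (cone_v S i) V) (fun k => ext (cone_e S k) V)
    (fun i k ik => ext_ext (cone_v S i) (cone_e S k) (incl ik) V)
    (fun i k ik => ext_ext_bij (cone_incl ik) V).

Program Definition base_change_map (V W : vectType F) (f : 'Hom(V, W)) :
    pp_hom (base_change_obj V) (base_change_obj W) :=
  @PPHom (base_change_obj V) (base_change_obj W)
    (fun i => ext_map (cone_v S i) f) (fun k => ext_map (cone_e S k) f) _.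
Next Obligation.
intros; apply: ext_hom_eq => x; rewrite /= !comp_lfunE.
rewrite (ext_mapE (incl ik)) !ext_extE !ext_mapmx map_mxM -map_mx_comp.
by congr (_ *m _); apply: eq_map_mx => c /=; rewrite cone_incl.
Qed.

Program Definition base_change : functor (Vect F) PP :=
  @Functor (Vect F) PP base_change_obj base_change_map _ _.
Next Obligation.
by intros; apply: pp_hom_eq => ?; rewrite /= ext_map1.
Qed.
Next Obligation.
by intros; apply: pp_hom_eq => ?; rewrite /= ext_mapM.
Qed.

End Patching.

(* -------------------------------------------------------------------------- *)
(* Affine group schemes, as representable group-valued functors               *)

(* Commutative F-algebras, given by their structure map.                      *)
Record calg (F : fieldType) := CAlg {
  calg_ring :> comPzRingType;
  calg_str : {rmorphism F -> calg_ring}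
}.
Arguments calg_str {F}.

Record alghom (F : fieldType) (A B : calg F) := AlgHom {
  alghom_fun :> {rmorphism A -> B};
  alghom_str : forall c : F, alghom_fun (calg_str A c) = calg_str B c
}.

Section AlgHom.
Variable F : fieldType.

Lemma rmorphism_eq (R T : pzSemiRingType) (f g : {rmorphism R -> T}) :
  f =1 g -> f = g.
Proof.
case: f g => [f cf] [g cg] /= /funext efg; subst g; congr GRing.RMorphism.Pack.
case: cf cg => [[a] [b]] [[a'] [b']].
by rewrite (Prop_irrelevance a a') (Prop_irrelevance b b').
Qed.

Lemma alghom_eq (A B : calg F) (f g : alghom A B) : f =1 g -> f = g.
Proof.
case: f g => [f pf] [g pg] /= /rmorphism_eq efg; subst g.
by rewrite (Prop_irrelevance pf pg).
Qed.

Program Definition alghom_comp (A B C : calg F) (g : alghom B C)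
    (f : alghom A B) : alghom A C :=
  @AlgHom F A C (g \o f) _.
Next Obligation. by intros; rewrite /= !alghom_str. Qed.

End AlgHom.

(* The functor R |-> Hom(coord, R) on commutative F-algebras with a group
   structure natural in R; naturality of [gone] and [ginv] follows.           *)
Record group_scheme (F : fieldType) := GroupScheme {
  coord : calg F;
  gmul : forall R, alghom coord R -> alghom coord R -> alghom coord R;
  gone : forall R, alghom coord R;
  ginv : forall R, alghom coord R -> alghom coord R;
  gmulA : forall R (x y z : alghom coord R),
    gmul x (gmul y z) = gmul (gmul x y) z;
  gmul1g : forall R (x : alghom coord R), gmul (gone R) x = x;
  gmulVg : forall R (x : alghom coord R), gmul (ginv x) x = gone R;
  gmul_natural : forall R T (h : alghom R T) (x y : alghom coord R),
    alghom_comp h (gmul x y) = gmul (alghom_comp h x) (alghom_comp h y)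
}.

Notation points G R := (alghom (coord G) R).
Arguments gmul {F g R}.
Arguments gone {F g R}.
Arguments ginv {F g R}.

Definition finite_type (F : fieldType) (G : group_scheme F) : Prop :=
  exists (n : nat) (p : {rmorphism {mpoly F[n]} -> coord G}),
    (forall c : F, p c%:MP = calg_str (coord G) c) /\
    (forall a, exists q, p q = a).

(* Infinitesimal lifting along surjections with square-zero kernel: together
   with finite type, this is smoothness over F (EGA IV 17.3.1).               *)
Definition formally_smooth (F : fieldType) (G : group_scheme F) : Prop :=
  forall (R T : calg F) (h : alghom R T),
    (forall y : T, exists x : R, h x = y) ->
    (forall x x' : R, h x = 0 -> h x' = 0 -> x * x' = 0) ->
    forall y : points G T, exists x : points G R, alghom_comp h x = y.

Record linear_algebraic_group (F : fieldType) := LinearAlgebraicGroup {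
  lag :> group_scheme F;
  lag_finite_type : finite_type lag;
  lag_smooth : formally_smooth lag
}.

Section GroupSchemeTheory.
Variables (F : fieldType) (G : group_scheme F).
Implicit Types R T : calg F.

Lemma gmulKg R (x y : points G R) : gmul (ginv x) (gmul x y) = y.
Proof. by rewrite gmulA gmulVg gmul1g. Qed.

Lemma gmulgI R (x y z : points G R) : gmul x y = gmul x z -> y = z.
Proof. by move=> e; rewrite -(gmulKg x y) e gmulKg. Qed.

Lemma gmulg1 R (x : points G R) : gmul x gone = x.
Proof. by apply: (@gmulgI _ (ginv x)); rewrite gmulKg gmulVg. Qed.

Lemma gmulgV R (x : points G R) : gmul x (ginv x) = gone.
Proof. by apply: (@gmulgI _ (ginv x)); rewrite gmulKg gmulg1. Qed.

Lemma ginvK R (x : points G R) : ginv (ginv x) = x.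
Proof. by apply: (@gmulgI _ (ginv x)); rewrite gmulgV gmulVg. Qed.

Lemma ginvM R (x y : points G R) : ginv (gmul x y) = gmul (ginv y) (ginv x).
Proof.
apply: (@gmulgI _ (gmul x y)); rewrite gmulgV -gmulA [gmul y _]gmulA.
by rewrite gmulgV gmul1g gmulgV.
Qed.

Lemma gone_natural R T (h : alghom R T) :
  alghom_comp h gone = gone :> points G T.
Proof.
by apply: (@gmulgI _ (alghom_comp h gone)); rewrite -gmul_natural gmul1g gmulg1.
Qed.

Lemma ginv_natural R T (h : alghom R T) (x : points G R) :
  alghom_comp h (ginv x) = ginv (alghom_comp h x).
Proof.
apply: (@gmulgI _ (alghom_comp h x)).
by rewrite -gmul_natural !gmulgV gone_natural.
Qed.

End GroupSchemeTheory.

(* -------------------------------------------------------------------------- *)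
(* Separable closures and absolute Galois groups                              *)

Record separable_closure (K : fieldType) := SeparableClosure {
  sep_field :> fieldType;
  sep_incl : {rmorphism K -> sep_field};
  sep_algebraic : forall x : sep_field, exists p : {poly K},
    separable_poly p /\ root (map_poly sep_incl p) x;
  sep_closed : forall p : {poly sep_field},
    separable_poly p -> (1 < size p)%N -> exists x, root p x
}.
Arguments sep_incl {K}.

Record galois_aut (K : fieldType) (S : separable_closure K) := GaloisAut {
  gal_fun :> {rmorphism S -> S};
  gal_bij : bijective gal_fun;
  gal_fix : forall c, gal_fun (sep_incl S c) = sep_incl S c
}.

Record sep_embedding (K L : fieldType) (j : {rmorphism K -> L})
    (S : separable_closure K) (T : separable_closure L) := SepEmbedding {
  emb_fun :> {rmorphism S -> T};
  emb_str : forall c, emb_fun (sep_incl S c) = sep_incl T (j c)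
}.

Section GaloisGroup.
Variables (K : fieldType) (S : separable_closure K).

Lemma galois_aut_eq (s t : galois_aut S) : s =1 t -> s = t.
Proof.
case: s t => [s sb sf] [t tb tf] /= /rmorphism_eq e; subst t.
by rewrite (Prop_irrelevance sb tb) (Prop_irrelevance sf tf).
Qed.

Program Definition gal_mul (s t : galois_aut S) : galois_aut S :=
  @GaloisAut K S (s \o t) _ _.
Next Obligation. by intros; apply: bij_comp; exact: gal_bij. Qed.
Next Obligation. by intros; rewrite /= !gal_fix. Qed.

Lemma gal_inv_exists (s : galois_aut S) :
  exists t : galois_aut S, cancel s t /\ cancel t s.
Proof.
have [g sK gK] := gal_bij s.
have ga : zmod_morphism g by move=> x y; apply: (can_inj sK); rewrite rmorphB !gK.
have gm : monoid_morphism g.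
  by split=> [|x y]; apply: (can_inj sK); rewrite ?rmorph1 ?rmorphM !gK ?rmorph1.
pose gA := GRing.isZmodMorphism.Build S S g ga.
pose gM := GRing.isMonoidMorphism.Build S S g gm.
pose gR : {rmorphism S -> S} := HB.pack g gA gM.
have gb : bijective gR by exists s.
have gf c : gR (sep_incl S c) = sep_incl S c.
  by apply: (can_inj sK); rewrite gal_fix gK.
by exists (GaloisAut gb gf).
Qed.

Lemma sep_split (p : {poly S}) : separable_poly p ->
  exists rs : seq S, p = lead_coef p *: \prod_(z <- rs) ('X - z%:P).
Proof.
have [n] := ubnP (size p); elim: n p => // n IHn p /ltnSE lepn sp.
have [p1|p1] := leqP (size p) 1.
  exists [::]; rewrite big_nil alg_polyC {1}(size1_polyC p1).
  by rewrite lead_coefE; case: (size p) p1 => [|[]].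
have [x /factor_theorem [q pE]] := sep_closed sp p1.
have sq : separable_poly q by move: sp; rewrite pE separable_mul => /and3P[].
have q0 : q != 0 by apply: contraTneq p1 => q0; rewrite pE q0 mul0r size_poly0.
have [|rs qE] := IHn q _ sq.
  by move: lepn; rewrite pE size_Mmonic ?monicXsubC // size_XsubC addn2.
exists (x :: rs); rewrite big_cons mulrC scalerAl.
by rewrite pE lead_coef_Mmonic ?monicXsubC // {1}qE.
Qed.

End GaloisGroup.

Section Restriction.
Variables (K L : fieldType) (j : {rmorphism K -> L}).
Variables (S : separable_closure K) (T : separable_closure L).
Variable e : sep_embedding j S T.

Lemma emb_stable (s : galois_aut T) (x : S) : exists y : S, e y = s (e x).
Proof.
have [p [sp rp]] := sep_algebraic x.
have [|rs pE] := @sep_split _ S (map_poly (sep_incl S) p).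
  by rewrite separable_map.
have ppE : map_poly e (map_poly (sep_incl S) p) = map_poly (sep_incl T \o j) p.
  by rewrite -map_poly_comp; apply: eq_map_poly => c /=; rewrite emb_str.
have : root (map_poly (sep_incl T \o j) p) (s (e x)).
  have : root (map_poly s (map_poly e (map_poly (sep_incl S) p))) (s (e x)).
    by rewrite !fmorph_root.
  rewrite ppE -map_poly_comp.
  by rewrite (eq_map_poly (g := sep_incl T \o j)) // => c /=; rewrite gal_fix.
have p0 : lead_coef (map_poly (sep_incl S) p) != 0.
  by rewrite lead_coef_eq0 map_poly_eq0 separable_poly_neq0.
rewrite -ppE pE linearZ /= rootZ ?fmorph_eq0 // rmorph_prod /=.
under eq_bigr do rewrite rmorphB /= map_polyX map_polyC /=.
rewrite -(big_map e xpredT (fun z => 'X - z%:P)) root_prod_XsubC.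
by case/mapP=> y _ ->; exists y.
Qed.

(* The restriction map of absolute Galois groups defined by e.                *)
Lemma gal_res_exists (s : galois_aut T) :
  exists t : galois_aut S, forall x, e (t x) = s (e x).
Proof.
have [f fE] := choice (emb_stable s).
have [s' [sK s'K]] := gal_inv_exists s.
have [g gE] := choice (emb_stable s').
have eI : injective e by exact: fmorph_inj.
have fa : zmod_morphism f by move=> x y; apply: eI; rewrite rmorphB !fE !rmorphB.
have fm : monoid_morphism f.
  by split=> [|x y]; apply: eI; rewrite ?rmorphM !fE ?rmorph1 ?rmorphM.
pose fA := GRing.isZmodMorphism.Build S S f fa.
pose fM := GRing.isMonoidMorphism.Build S S f fm.
pose fR : {rmorphism S -> S} := HB.pack f fA fM.
have fb : bijective fR.
  by exists g => x; apply: eI; rewrite !(fE, gE) ?sK ?s'K.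
have ff c : fR (sep_incl S c) = sep_incl S c.
  by apply: eI; rewrite fE emb_str gal_fix.
by exists (GaloisAut fb ff).
Qed.

Definition gal_res (s : galois_aut T) : galois_aut S :=
  projT1 (cid (gal_res_exists s)).

Lemma gal_resE s x : e (gal_res s x) = s (e x).
Proof. by rewrite /gal_res; case: cid. Qed.

Lemma gal_resM s t : gal_res (gal_mul s t) = gal_mul (gal_res s) (gal_res t).
Proof.
by apply: galois_aut_eq => x; apply: (fmorph_inj e); rewrite /= !gal_resE.
Qed.

End Restriction.

(* -------------------------------------------------------------------------- *)
(* Galois cohomology H^1(K, G), for G over F and a field extension phi : F -> K,
   computed with a separable closure S of K                                   *)

Section H1.
Variables (F : fieldType) (G : group_scheme F).
Variables (K : fieldType) (phi : {rmorphism F -> K}) (S : separable_closure K).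

(* G(K) is [points G (CAlg phi)] and G(K^sep) is [points G sep_calg].          *)
Definition sep_calg : calg F := CAlg (sep_incl S \o phi).

Program Definition gal_alghom (s : galois_aut S) : alghom sep_calg sep_calg :=
  @AlgHom F sep_calg sep_calg s _.
Next Obligation. by intros; rewrite /= gal_fix. Qed.

Definition gal_act (s : galois_aut S) (x : points G sep_calg) :
  points G sep_calg := alghom_comp (gal_alghom s) x.

(* Continuity for the Krull topology on the Galois group, in which the
   automorphisms agreeing with s on a finite set of elements of K^sep form a
   basis of neighbourhoods of s, and the discrete topology on G(K^sep).       *)
Definition krull_continuous (T : Type) (c : galois_aut S -> T) : Prop :=
  forall s : galois_aut S, exists l : seq S, forall t : galois_aut S,
    {in l, forall x, t x = s x} -> c t = c s.

Record cocycle := Cocycle {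
  coc_fun :> galois_aut S -> points G sep_calg;
  coc_mul : forall s t,
    coc_fun (gal_mul s t) = gmul (coc_fun s) (gal_act s (coc_fun t));
  coc_cont : krull_continuous coc_fun
}.

HB.instance Definition _ := gen_eqMixin cocycle.
HB.instance Definition _ := gen_choiceMixin cocycle.

Lemma cocycle_eq (c d : cocycle) : (forall s, c s = d s) -> c = d.
Proof.
case: c d => [c cm cc] [d dm dc] /= /funext e; subst d.
by rewrite (Prop_irrelevance cm dm) (Prop_irrelevance cc dc).
Qed.

Lemma gal_actM s (x y : points G sep_calg) :
  gal_act s (gmul x y) = gmul (gal_act s x) (gal_act s y).
Proof. exact: gmul_natural. Qed.

Lemma gal_act1 s : gal_act s gone = gone.
Proof. exact: gone_natural. Qed.

Lemma gal_actV s (x : points G sep_calg) :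
  gal_act s (ginv x) = ginv (gal_act s x).
Proof. exact: ginv_natural. Qed.

Program Definition trivial_cocycle : cocycle := @Cocycle (fun _ => gone) _ _.
Next Obligation. by intros; rewrite gal_act1 gmul1g. Qed.
Next Obligation. by move=> s; exists [::]. Qed.

Definition cohomologous (c d : cocycle) : Prop :=
  exists a : points G sep_calg,
    forall s, d s = gmul (ginv a) (gmul (c s) (gal_act s a)).

Definition cohom_rel : rel cocycle := fun c d => `[< cohomologous c d >].

Lemma cohom_rel_refl : reflexive cohom_rel.
Proof.
move=> c; apply/asboolP; exists gone => s.
by rewrite gal_act1 gmulg1 -{1}(gmul1g (c s)) -{1}(gmulVg gone) gmulg1.
Qed.

Lemma cohom_rel_sym : ssrbool.symmetric cohom_rel.
Proof.
suff H c d : cohomologous c d -> cohomologous d c.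
  by move=> c d; apply/asboolP/asboolP; exact: H.
case=> a dE; exists (ginv a) => s.
by rewrite dE ginvK gal_actV -!gmulA gmulgV gmulg1 gmulA gmulgV gmul1g.
Qed.

Lemma cohom_rel_trans : transitive cohom_rel.
Proof.
move=> d c u /asboolP[a dE] /asboolP[b uE]; apply/asboolP.
by exists (gmul a b) => s; rewrite uE dE gal_actM ginvM !gmulA.
Qed.

Canonical cohom_equiv : equiv_rel cocycle :=
  EquivRel cohom_rel cohom_rel_refl cohom_rel_sym cohom_rel_trans.

Definition H1 : Type := {eq_quot cohom_equiv}.

Definition H1_class (c : cocycle) : H1 := \pi_({eq_quot cohom_equiv}) c.
Definition H1_repr (x : H1) : cocycle := repr (x : {eq_quot cohom_equiv}).
Definition H1_point : H1 := H1_class trivial_cocycle.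

Lemma H1_eqP (c d : cocycle) : H1_class c = H1_class d <-> cohomologous c d.
Proof.
split=> [/eqquotP/asboolP //|cd]; apply/eqquotP; exact/asboolP.
Qed.

Lemma H1_reprK (x : H1) : H1_class (H1_repr x) = x.
Proof. exact: reprK. Qed.

End H1.

(* The map H^1(K, G) -> H^1(L, G) induced by j : K -> L (over F), computed with
   an embedding e of separable closures.                                      *)
Section H1Map.
Variables (F : fieldType) (G : group_scheme F) (K L : fieldType).
Variables (phi : {rmorphism F -> K}) (psi : {rmorphism F -> L}).
Variables (j : {rmorphism K -> L}) (jphi : forall c, j (phi c) = psi c).
Variables (S : separable_closure K) (T : separable_closure L).
Variable e : sep_embedding j S T.

Program Definition emb_alghom : alghom (sep_calg phi S) (sep_calg psi T) :=
  @AlgHom F (sep_calg phi S) (sep_calg psi T) e _.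
Next Obligation. by intros; rewrite /= emb_str jphi. Qed.

Lemma gal_act_emb (s : galois_aut T) (x : points G (sep_calg phi S)) :
  alghom_comp emb_alghom (gal_act (gal_res e s) x)
    = gal_act s (alghom_comp emb_alghom x).
Proof. by apply: alghom_eq => a /=; rewrite gal_resE. Qed.

Lemma cocycle_map_cont (c : cocycle G phi S) :
  krull_continuous (fun s => alghom_comp emb_alghom (c (gal_res e s))).
Proof.
move=> s; have [l lP] := coc_cont c (gal_res e s).
exists (map e l) => t tP; congr alghom_comp; apply: lP => x xl.
by apply: (fmorph_inj e); rewrite !gal_resE tP ?map_f.
Qed.

Program Definition cocycle_map (c : cocycle G phi S) : cocycle G psi T :=
  @Cocycle F G L psi T
    (fun s => alghom_comp emb_alghom (c (gal_res e s))) _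
    (cocycle_map_cont c).
Next Obligation.
by intros; rewrite gal_resM coc_mul gmul_natural gal_act_emb.
Qed.
Definition H1_map (x : H1 G phi S) : H1 G psi T :=
  H1_class (cocycle_map (H1_repr x)).

Lemma H1_mapE c : H1_map (H1_class c) = H1_class (cocycle_map c).
Proof.
apply/H1_eqP; have /H1_eqP[a aE] := H1_reprK (H1_class c).
exists (alghom_comp emb_alghom a) => s /=.
by rewrite aE !gmul_natural ginv_natural gal_act_emb.
Qed.

Lemma H1_map_point : H1_map (H1_point G phi S) = H1_point G psi T.
Proof.
rewrite H1_mapE; congr H1_class; apply: cocycle_eq => s /=.
exact: gone_natural.
Qed.

End H1Map.

(* -------------------------------------------------------------------------- *)
(* Exactness                                                                  *)

(* A --f--> B --g--> (C, c0): the kernel of g is the image of f.              *)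
Definition exact (A B C : Type) (f : A -> B) (g : B -> C) (c0 : C) : Prop :=
  forall b, g b = c0 <-> exists a, f a = b.

(* A --f--> B ==g,h==> C: the image of f is the equalizer of g and h.         *)
Definition exact_pair (A B C : Type) (f : A -> B) (g h : B -> C) : Prop :=
  forall b, g b = h b <-> exists a, f a = b.

(* -------------------------------------------------------------------------- *)
(* The maps of the exact sequence                                             *)

Section PointsMap.
Variables (F : fieldType) (G : group_scheme F) (K L : fieldType).
Variables (phi : {rmorphism F -> K}) (psi : {rmorphism F -> L}).
Variables (j : {rmorphism K -> L}) (jphi : forall c, j (phi c) = psi c).

Definition fld_alghom : alghom (CAlg phi) (CAlg psi) :=
  @AlgHom F (CAlg phi) (CAlg psi) j jphi.

Definition points_map : points G (CAlg phi) -> points G (CAlg psi) :=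
  alghom_comp fld_alghom.

End PointsMap.

(* A separable closure of each of the fields F, F_i, and for each inclusion used
   to restrict cohomology classes an embedding of separable closures over it.
   No compatibility between the embeddings is required, because the maps they
   induce on H^1 do not depend on them.                                       *)
Record closure_system (F : fieldType) (S : factorization_system F) :=
  ClosureSystem {
  sep_base : separable_closure F;
  sep_v : forall i, separable_closure (fld_v S i);
  sep_e : forall k, separable_closure (fld_e S k);
  emb_cone : forall i, sep_embedding (cone_v S i) sep_base (sep_v i);
  emb_incl : forall i k (ik : i \in ends S k),
    sep_embedding (incl ik) (sep_v i) (sep_e k)
}.
Arguments sep_v {F S}.
Arguments sep_e {F S}.
Arguments emb_cone {F S}.
Arguments emb_incl {F S} _ {i k}.

Section SequenceMaps.
Variables (F : fieldType) (S : factorization_system F) (o : edge_ordering S).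
Variables (G : group_scheme F) (C : closure_system S).

Definition G_base : Type := points G (CAlg (idfun : {rmorphism F -> F})).
Definition G_v : Type := forall i, points G (CAlg (cone_v S i)).
Definition G_e : Type := forall k, points G (CAlg (cone_e S k)).
Definition H1_base : Type := H1 G idfun (sep_base C).
Definition H1_v : Type := forall i, H1 G (cone_v S i) (sep_v C i).
Definition H1_e : Type := forall k, H1 G (cone_e S k) (sep_e C k).

Definition G_v1 : G_v := fun i => gone.
Definition G_e1 : G_e := fun k => gone.
Definition H1_base_point : H1_base := H1_point G idfun (sep_base C).
Definition H1_v_point : H1_v := fun i => H1_point G (cone_v S i) (sep_v C i).

Definition G_diag : G_base -> G_v :=
  fun g i => points_map (phi := idfun) (j := cone_v S i) (fun=> erefl) g.

Definition G_left (g : G_v) : G_e :=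
  fun k => points_map (cone_incl (left_in o k)) (g (left_end o k)).

Definition G_right (g : G_v) : G_e :=
  fun k => points_map (cone_incl (right_in o k)) (g (right_end o k)).

Definition G_quot (g : G_v) : G_e :=
  fun k => gmul (ginv (G_right g k)) (G_left g k).

Definition H1_res : H1_base -> H1_v :=
  fun x i => H1_map (phi := idfun) (fun=> erefl) (emb_cone C i) x.

Definition H1_left (x : H1_v) : H1_e :=
  fun k => H1_map (cone_incl (left_in o k)) (emb_incl C (left_in o k))
    (x (left_end o k)).

Definition H1_right (x : H1_v) : H1_e :=
  fun k => H1_map (cone_incl (right_in o k)) (emb_incl C (right_in o k))
    (x (right_end o k)).

End SequenceMaps.
Arguments G_v1 {F} S G.
Arguments G_e1 {F} S G.
Arguments G_diag {F} S G g.
Arguments G_left {F S} o G g.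
Arguments G_right {F S} o G g.
Arguments G_quot {F S} o G g.
Arguments H1_res {F S} G C x.
Arguments H1_left {F S} o G C x.
Arguments H1_right {F S} o G C x.

(* Main.v *)
(* Let rho : G -> GL_n be a closed embedding.  By Hilbert 90, a class in H^1(K, G)
   is a double coset rho(G(K^sep)) p GL_n(K), where p s(p)^-1 lies in rho(G(K^sep))
   for every s in the Galois group.  Since vector spaces can be patched, every
   (g_k) can be written as rho(g_k) = p_r p_l^-1 with p_i in GL_n(F_i).  The
   equations of the closed cosets rho(G) p_i, put in a normal form that commutes
   with field homomorphisms and depends only on the coset, are Galois invariant
   and agree over the F_k, so they have coefficients in F.  They define a torsor
   under G over F; it is smooth and has a point over F_i^sep, hence it has a point
   p over F^sep, and delta(g_k) is the class of p.  The same argument, applied to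
   p_i in GL_n(F_i^sep), gives exactness at the product of the H^1(F_i, G).

   The point over F^sep is found by specializing a curve.  If the gradients at the
   given point x0 have rank r, smoothness gives a formal curve through x0 with
   N - r free coordinates x0_j + t V_j, V generic.  The polynomials vanishing on it
   form a prime ideal.  In the fraction field, the r bound coordinates are separable
   algebraic over the free ones: otherwise a nonzero derivation killing the free
   ones would contradict the invertibility of the Jacobian.  The free coordinates
   are algebraically independent; give them general values in F^sep, then
   specialize the bound ones in turn.                                           *)

Require Import Defs.
From HB Require Import structures.
From mathcomp Require Import all_boot all_order all_algebra all_field.
From mathcomp Require Import boolp classical_sets mpoly ring_quotient fraction generic_quotient ring.
Set Implicit Arguments.
Unset Strict Implicit.
Unset Printing Implicit Defensive.
Import GRing.Theory Defs.
Local Open Scope ring_scope.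
Local Open Scope quotient_scope.

(** * Separable specializations and derivations *)

(** The given point of the torsor lives over some [F_i^sep], which may be transcendental over [F];
    Galois descent cannot reach such a point, so it has to be replaced by a specialization.
    Dimension theory and Noetherian arguments are avoided. The ideal of rho(G) is handled one degree
    at a time, which is possible because right translation by a matrix does not raise degrees.
    Subfields of [L] are represented by rings [A] with a map to [L], and division is replaced by
    pseudo-division: every denominator then stays visible as an element of [A] that a specialization
    must not kill. The embeddings of separable closures need not commute. Two composites from
    [F^sep] to [F_k^sep] differ by an automorphism of [F^sep], and for the matrices that represent
    classes this only changes the representative of a coset of rho(G). The map delta is chosen from
    a relation; that the relation is single valued is the case of equal arguments of the description
    of the fibres. *)

Section SimpleExtension.
Variables (A : comNzRingType) (L : fieldType) (f : {rmorphism A -> L}) (z : L).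

Definition evalx : {rmorphism {poly A} -> L} := horner_eval z \o map_poly f.

Lemma evalxE P : evalx P = (map_poly f P).[z]. Proof. by []. Qed.

Lemma evalxC c : evalx c%:P = f c.
Proof. by rewrite evalxE map_polyC hornerC. Qed.

Lemma evalxX : evalx 'X = z.
Proof. by rewrite evalxE map_polyX hornerX. Qed.

Lemma evalxZ c P : evalx (c *: P) = f c * evalx P.
Proof. by rewrite -mul_polyC rmorphM evalxC. Qed.

(** As [f] need not be injective, the leading coefficient of [P] may die in [L]. Truncating at the
    degree of the image restores a leading coefficient by which one can pseudo-divide. *)
Lemma strip_poly (P : {poly A}) : exists Q : {poly A},
  map_poly f Q = map_poly f P /\ size Q = size (map_poly f P).
Proof.
exists (take_poly (size (map_poly f P)) P).
have e : map_poly f (take_poly (size (map_poly f P)) P) = map_poly f P.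
  apply/polyP => i; rewrite !coef_map coef_take_poly /=.
  case: ltnP => // le_i; rewrite raddf0.
  by rewrite -coef_map nth_default.
split=> //; apply/eqP; rewrite eqn_leq size_take_poly /=.
by rewrite -{1}e size_poly.
Qed.

Lemma lead_strip (P : {poly A}) : size P = size (map_poly f P) ->
  map_poly f P != 0 -> f (lead_coef P) != 0.
Proof.
move=> e; rewrite -lead_coef_eq0 !lead_coefE -e coef_map /= => h; exact: h.
Qed.

Definition sep_over := exists P : {poly A}, evalx P = 0 /\ evalx P^`() != 0.

Section Minimal.
Variable P : {poly A}.
Hypothesis P0 : evalx P = 0.
Hypothesis Pf : f (lead_coef P) != 0.
Hypothesis Pmin : forall Q, evalx Q = 0 -> map_poly f Q != 0 ->
  (size P <= size (map_poly f Q))%N.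

Lemma min_neq0 : P != 0.
Proof. by apply: contraNneq Pf => ->; rewrite lead_coef0 rmorph0. Qed.

Lemma min_size : (1 < size P)%N.
Proof.
rewrite ltnNge; apply/negP => P1; move: P0 Pf.
by rewrite (size1_polyC P1) evalxC lead_coefC => ->; rewrite eqxx.
Qed.

(** The pseudo-remainder vanishes at [z] and is shorter than [P], so minimality forces its image in
    [L[X]] to be zero. *)
Lemma min_div Q : evalx Q = 0 -> exists k S R,
  [/\ lead_coef P ^+ k *: Q = S * P + R & map_poly f R = 0].
Proof.
move=> Q0; exists (Pdiv.Ring.rscalp Q P), (Pdiv.Ring.rdivp Q P), (Pdiv.Ring.rmodp Q P).
have e := Pdiv.ComRing.rdivp_eq P Q; split=> //.
apply/eqP; apply: contraTT isT => R0.
have := Pmin _ R0; rewrite leqNgt => /(_ _)/negP[].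
  by move/(congr1 evalx): e; rewrite evalxZ rmorphD rmorphM Q0 P0 !mulr0 add0r.
apply: leq_ltn_trans (Pdiv.Ring.ltn_rmodpN0 Q min_neq0); exact: size_poly.
Qed.

(** Inversion in the field generated by [z], with the denominator [b] kept in [A]. It is Euclid's
    algorithm on [P] and [W], as an induction on the size of [W]. *)
Lemma min_inv W : evalx W != 0 -> exists U b, f b != 0 /\ evalx (U * W) = f b.
Proof.
have [n] := ubnP (size W); elim: n W => // n IHn W0 /ltnSE leW W0z.
have [W [eW sW]] := strip_poly W0.
have Wz : evalx W = evalx W0 by rewrite !evalxE eW.
have {IHn} IHn (V : {poly A}) : (size V < size W)%N -> evalx V != 0 ->
    exists U b, f b != 0 /\ evalx (U * V) = f b.
  move=> ltV; apply: IHn; apply: leq_trans ltV (leq_trans _ leW).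
  by rewrite sW size_poly.
suff [U [b [bf Ub]]] : exists U b, f b != 0 /\ evalx (U * W) = f b.
  by exists U, b; rewrite rmorphM -Wz -rmorphM.
move: W0z; rewrite -Wz => {leW}{}Wz; rewrite -eW in sW; move: {W0 eW} Wz sW => Wz sW.
have Wf0 : map_poly f W != 0.
  by apply: contraNneq Wz => W0; rewrite evalxE W0 horner0.
have W0 : W != 0 by apply: contraNneq Wf0 => ->; rewrite rmorph0.
have Wl := lead_strip sW Wf0.
have [leP|ltP] := leqP (size P) (size W).
  have e := Pdiv.ComRing.rdivp_eq P W.
  have lt := Pdiv.Ring.ltn_rmodpN0 W min_neq0.
  set k := Pdiv.Ring.rscalp W P in e; set R := Pdiv.Ring.rmodp W P in e lt.
  have RW : evalx R = f (lead_coef P ^+ k) * evalx W.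
    by rewrite -evalxZ e rmorphD rmorphM P0 mulr0 add0r.
  have [||U [b [bf Ub]]] := IHn R.
  - exact: leq_trans lt leP.
  - by rewrite RW mulf_neq0 // rmorphXn expf_neq0.
  exists (lead_coef P ^+ k *: U), b; split=> //.
  by rewrite -Ub -scalerAl evalxZ !rmorphM RW mulrCA.
have [W1|W1] := leqP (size W) 1.
  exists 1, (lead_coef W); rewrite mul1r; split=> //.
  by rewrite {1}(size1_polyC W1) evalxC lead_coefE; case: (size W) W1 => [|[]].
have e := Pdiv.ComRing.rdivp_eq W P.
have lt := Pdiv.Ring.ltn_rmodpN0 P W0.
set k := Pdiv.Ring.rscalp P W in e; set R := Pdiv.Ring.rmodp P W in e lt.
set S := Pdiv.Ring.rdivp P W in e.
have RW : evalx R = - (evalx S * evalx W).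
  move/(congr1 evalx): e; rewrite evalxZ P0 mulr0 rmorphD rmorphM => /esym/eqP.
  by rewrite addrC addr_eq0 => /eqP.
have [R0|R0] := eqVneq (evalx R) 0; last first.
  have [U [b [bf Ub]]] := IHn R lt R0.
  exists (- (U * S)), b; split=> //.
  by rewrite -Ub mulNr rmorphN !rmorphM RW mulrN mulrA.
have S0 : evalx S = 0.
  by apply/eqP; have /eqP := RW; rewrite R0 eq_sym oppr_eq0 mulf_eq0 (negbTE Wz) orbF.
(* If the remainder dies at [z], so does the quotient [S]. This contradicts minimality: [S] is
   shorter than [P], because [W] is not constant. *)
suff [] : ~ (size P <= size (map_poly f S))%N.
  apply: Pmin => //; apply/eqP => Sf0.
  have : map_poly f (lead_coef W ^+ k *: P) = map_poly f R.
    by rewrite e rmorphD rmorphM /= Sf0 mul0r add0r.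
  move/polyP/(_ (size P).-1); rewrite !coef_map /= coefZ -lead_coefE => /eqP.
  rewrite nth_default ?rmorph0 ?rmorphM ?mulf_eq0 ?(negbTE Pf) ?orbF; last first.
    by rewrite -ltnS prednK ?(ltn_trans lt ltP) // (ltn_trans _ min_size).
  by rewrite rmorphXn expf_eq0 (negbTE Wl) andbF.
apply/negP; rewrite -ltnNge.
have PfE : map_poly f (lead_coef W ^+ k *: P) = map_poly f S * map_poly f W + map_poly f R.
  by rewrite e rmorphD rmorphM.
have [Sf0|Sf0] := eqVneq (map_poly f S) 0.
  by rewrite Sf0 size_poly0 (ltn_trans _ min_size).
have sR : (size (map_poly f R) < size (map_poly f S * map_poly f W)%R)%N.
  rewrite size_mul // -sW (leq_ltn_trans (size_poly _ _)) //.
  apply: leq_trans lt _; rewrite -subn1 -addnBAC ?leq_addl //.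
  by rewrite lt0n size_poly_eq0.
have : (size (map_poly f S * map_poly f W)%R <= size P)%N.
  rewrite -(size_polyDl sR) -PfE; apply: leq_trans (size_poly _ _) _.
  exact: size_scale_leq.
rewrite size_mul // -sW; apply: leq_trans.
case: (size W) W1 => [|[|m]] //= _; rewrite addnS /= addnS ltnS; exact: leq_addr.
Qed.

End Minimal.

(** A shortest relation [P] divides the given separable relation [P0] up to a constant and a
    polynomial with zero image. If [P'] vanished at [z], then [P0'] would vanish there too. *)
Lemma sep_min : sep_over -> exists P : {poly A},
  [/\ evalx P = 0, f (lead_coef P) != 0, evalx P^`() != 0 &
   forall Q, evalx Q = 0 -> map_poly f Q != 0 -> (size P <= size (map_poly f Q))%N].
Proof.
case=> P0 [P0z dP0z].
pose good n := `[< exists Q, [/\ evalx Q = 0, map_poly f Q != 0 &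
  size (map_poly f Q) = n] >].
have gex : exists n, good n.
  exists (size (map_poly f P0)); apply/asboolP; exists P0; split=> //.
  by apply: contraNneq dP0z => e; rewrite evalxE -deriv_map e deriv0 horner0.
have [n /asboolP[Q [Qz Q0 Qn]] nmin] := ex_minnP gex.
have [P [eP sP]] := strip_poly Q.
have Pz : evalx P = 0 by rewrite evalxE eP.
have Pf : f (lead_coef P) != 0 by apply: lead_strip; rewrite eP.
have Pmin R : evalx R = 0 -> map_poly f R != 0 -> (size P <= size (map_poly f R))%N.
  by move=> Rz R0; rewrite sP Qn; apply: nmin; apply/asboolP; exists R.
exists P; split=> //.
have [k [S [R [e R0]]]] := min_div Pz Pf Pmin P0z.
apply: contraNneq dP0z => dPz.
have : f (lead_coef P ^+ k) * evalx P0^`() = 0.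
  rewrite -evalxZ -derivZ e derivD derivM rmorphD rmorphD !rmorphM Pz dPz !mulr0.
  by rewrite !add0r evalxE -deriv_map R0 deriv0 horner0.
by move/eqP; rewrite mulf_eq0 rmorphXn expf_eq0 (negbTE Pf) andbF.
Qed.

(** Inverting [V * P'] at [z] gives a Bezout identity with constant [b]. After specialization it
    says that the image of [P] is separable and that [V] has no zero at its roots; any root [w] is
    then a legitimate image of [z]. *)
Lemma sep_specialize V : sep_over -> evalx V != 0 ->
  exists2 u, f u != 0 & forall (O : fieldType) (phi : {rmorphism A -> O}),
    (forall p : {poly O}, separable_poly p -> (1 < size p)%N -> exists x, root p x) ->
    (forall a, f a = 0 -> phi a = 0) -> phi u != 0 ->
    exists w : O, (forall Q, evalx Q = 0 -> (map_poly phi Q).[w] = 0) /\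
      (map_poly phi V).[w] != 0.
Proof.
move=> /sep_min[P [Pz Pf dPz Pmin]] Vz.
have [|U [b [bf Ub]]] := min_inv Pz Pf Pmin (W := V * P^`()).
  by rewrite rmorphM mulf_neq0.
(* The first factor keeps the degree of [P] and makes pseudo-division by [P] usable after
   specialization; the second keeps the Bezout constant nonzero. *)
exists (lead_coef P * b); first by rewrite rmorphM mulf_neq0.
move=> O phi clO kerO; rewrite rmorphM mulf_eq0 negb_or => /andP[aO bO].
have sPO : size (map_poly phi P) = size P by rewrite size_map_poly_id0.
have kerP R : map_poly f R = 0 -> map_poly phi R = 0.
  move=> R0; apply/polyP => i; rewrite coef_map coef0 /= kerO //.
  by rewrite -coef_map R0 coef0.
have [|k [S [R [e R0]]]] := min_div Pz Pf Pmin (Q := U * (V * P^`()) - b%:P).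
  by rewrite rmorphB Ub evalxC subrr.
have eO : (phi (lead_coef P) ^+ k) *:
    (map_poly phi U * (map_poly phi V * (map_poly phi P)^`()) - (phi b)%:P) =
    map_poly phi S * map_poly phi P.
  move/(congr1 (map_poly phi)): e.
  rewrite rmorphD /= (kerP R) // addr0 rmorphM /= => <-.
  by rewrite map_polyZ rmorphXn rmorphB !rmorphM /= -deriv_map map_polyC.
have [||w rw] := clO (map_poly phi P).
- rewrite unlock; apply/Bezout_coprimepP.
  exists (- map_poly phi S, phi (lead_coef P) ^+ k *: (map_poly phi U * map_poly phi V)) => /=.
  rewrite mulNr -eO -scalerAl -mulrA scalerBr opprB subrK.
  rewrite -mul_polyC -polyCM polyC_eqp1 //.
  by rewrite mulf_neq0 ?expf_neq0.
- by rewrite sPO (min_size Pz Pf).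
exists w; split=> [Q Qz|].
  have [k' [S' [R' [e' R'0]]]] := min_div Pz Pf Pmin Qz.
  move/(congr1 (fun q => (map_poly phi q).[w])): e'.
  rewrite rmorphD /= (kerP R') // addr0 rmorphM /= map_polyZ /=.
  rewrite hornerZ hornerM (eqP rw) mulr0 rmorphXn => /eqP.
  by rewrite mulf_eq0 expf_eq0 (negbTE aO) andbF => /eqP.
move/(congr1 (horner^~ w)): eO; rewrite hornerM (eqP rw) mulr0 hornerZ.
move/eqP; rewrite mulf_eq0 expf_eq0 (negbTE aO) andbF /= hornerD hornerN hornerC.
rewrite !hornerM => e0.
by apply: contraTneq e0 => ->; rewrite mul0r mulr0 add0r oppr_eq0.
Qed.

End SimpleExtension.

(** The last condition makes [d] factor through the image of [f], so that it is a derivation of the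
    subring [f(A)] with values in [L]. *)
Definition der_along (A : comNzRingType) (L : fieldType) (f : {rmorphism A -> L})
    (d : A -> L) : Prop :=
  [/\ forall a b, d (a + b) = d a + d b,
      forall a b, d (a * b) = f a * d b + f b * d a &
      forall a, f a = 0 -> d a = 0].

Section ExtendDerivation.
Variables (A : comNzRingType) (L : fieldType) (f : {rmorphism A -> L}) (z : L).

(** Nonseparability says exactly that d/dz is well defined on [f(A)[z]]; transcendental and
    inseparable [z] are covered together. *)
Lemma deriv_der_along : ~ sep_over f z -> der_along (evalx f z) (fun P => evalx f z P^`()).
Proof.
move=> nsep; split=> [P Q|P Q|P P0]; first by rewrite derivD rmorphD.
  by rewrite derivM rmorphD !rmorphM addrC; congr (_ + _); rewrite mulrC.
by apply/eqP; apply: contra_notT nsep => dP; exists P.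
Qed.

Variable d : A -> L.
Hypothesis dP : der_along f d.

Lemma der_along0 : d 0 = 0.
Proof. by case: dP => _ _ h; apply: h; rewrite rmorph0. Qed.

Definition dcoef (P : {poly A}) := (map_poly d P).[z].

Lemma dcoefD P Q : dcoef (P + Q) = dcoef P + dcoef Q.
Proof.
rewrite /dcoef -hornerD; congr horner; apply/polyP => i.
rewrite coefD !coef_map_id0 ?der_along0 // coefD.
by case: dP => h _ _; exact: h.
Qed.

Lemma dcoef0 : dcoef 0 = 0.
Proof. by rewrite /dcoef map_poly0 horner0. Qed.

Lemma dcoefC c : dcoef c%:P = d c.
Proof.
rewrite /dcoef (_ : map_poly d c%:P = (d c)%:P) ?hornerC //.
apply/polyP => i; rewrite coef_map_id0 ?der_along0 // !coefC.
by case: eqP => // _; rewrite der_along0.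
Qed.

Lemma dcoefMX P : dcoef (P * 'X) = dcoef P * z.
Proof.
rewrite /dcoef -hornerMX; congr horner; apply/polyP => i.
by rewrite coefMX !coef_map_id0 ?der_along0 // coefMX; case: eqP => // _; rewrite der_along0.
Qed.

Lemma dcoefZ c P : dcoef (c *: P) = f c * dcoef P + evalx f z P * d c.
Proof.
rewrite /dcoef evalxE [_ * d c]mulrC -!hornerZ -hornerD; congr horner; apply/polyP => i.
rewrite coefD !coefZ [in LHS]coef_map_id0 ?der_along0 // coefZ coef_map_id0 ?der_along0 // coef_map.
by case: dP => _ -> _; rewrite [d c * _]mulrC.
Qed.

Lemma dcoefM P Q : dcoef (P * Q) = evalx f z P * dcoef Q + evalx f z Q * dcoef P.
Proof.
elim/poly_ind: P => [|P c IHP].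
  by rewrite mul0r dcoef0 rmorph0 mul0r mulr0 addr0.
rewrite mulrDl mul_polyC -mulrA [_ * Q]mulrC mulrA !dcoefD dcoefZ !dcoefMX IHP.
rewrite dcoefC rmorphD !rmorphM evalxC evalxX.
set a := evalx f z P; set b := evalx f z Q; set u := dcoef P; set v := dcoef Q.
rewrite !mulrDl !mulrDr -!addrA [a * v * z]mulrAC; congr (_ + _).
by rewrite !addrA -[b * u * z]mulrA [b * (u * z) + _]addrC.
Qed.

Lemma sep_extend_der : sep_over f z -> exists d' : {poly A} -> L,
  der_along (evalx f z) d' /\ forall a, d' a%:P = d a.
Proof.
move=> /sep_min[P [Pz Pf dPz Pmin]].
(* Implicit differentiation of [P(z) = 0] forces this value for the derivative of [z]; [dcoef]
   differentiates the coefficients only. *)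
pose w := - dcoef P / evalx f z P^`().
pose d' Q := dcoef Q + evalx f z Q^`() * w.
have d'D Q R : d' (Q + R) = d' Q + d' R.
  by rewrite /d' dcoefD derivD rmorphD mulrDl addrACA.
have d'M Q R : d' (Q * R) = evalx f z Q * d' R + evalx f z R * d' Q.
  rewrite /d' dcoefM derivM rmorphD !rmorphM mulrDl !mulrDr -!addrA; congr (_ + _).
  rewrite [in RHS]addrCA; congr (_ + _); rewrite addrC -!mulrA; congr (_ + _).
  by rewrite mulrCA.
have d'P : d' P = 0.
  by rewrite /d' /w mulrCA divff // mulr1 subrr.
have d'C a : d' a%:P = d a by rewrite /d' dcoefC derivC rmorph0 mul0r addr0.
exists d'; split=> //; split=> // Q Qz.
have [k [S [R [e R0]]]] := min_div Pz Pf Pmin Qz.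
have d'R : d' R = 0.
  rewrite /d' [evalx _ _ _]evalxE -deriv_map R0 deriv0 horner0 mul0r addr0.
  rewrite /dcoef (_ : map_poly d R = 0) ?horner0 //.
  apply/polyP => i; rewrite coef_map_id0 ?der_along0 // coef0.
  by case: dP => _ _ -> //; rewrite -coef_map R0 coef0.
move/(congr1 d'): e; rewrite d'D d'M d'P d'R Pz mulr0 mul0r !addr0.
rewrite -mul_polyC d'M Qz mul0r addr0 evalxC rmorphXn => /eqP.
by rewrite mulf_eq0 expf_eq0 (negbTE Pf) andbF => /eqP.
Qed.

End ExtendDerivation.

Definition sep_closed_field (O : fieldType) : Prop :=
  forall p : {poly O}, separable_poly p -> (1 < size p)%N -> exists x, root p x.

(** An extension property in the style of Chevalley: outside the zeros of one element [u],
    homomorphisms to separably closed fields extend from [A] to [D] without killing [v]. In this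
    form it composes along towers. *)
Definition specializes (A D : comNzRingType) (L : fieldType)
    (f : {rmorphism A -> L}) (kap : {rmorphism A -> D}) (g : {rmorphism D -> L}) :=
  forall v, g v != 0 -> exists2 u, f u != 0 &
    forall (O : fieldType) (phi : {rmorphism A -> O}), sep_closed_field O ->
      (forall a, f a = 0 -> phi a = 0) -> phi u != 0 ->
      exists psi : {rmorphism D -> O}, [/\ forall a, psi (kap a) = phi a,
        forall x, g x = 0 -> psi x = 0 & psi v != 0].

Definition der_extends (A D : comNzRingType) (L : fieldType)
    (f : {rmorphism A -> L}) (kap : {rmorphism A -> D}) (g : {rmorphism D -> L}) :=
  forall d, der_along f d -> exists d', der_along g d' /\ forall a, d' (kap a) = d a.

(* Read from the last element of zs: either every z is separable algebraic over
   its predecessors, or d/dz for the last z that is not gives a derivation.     *)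
Lemma sep_tower (L : fieldType) (zs : seq L) (A : comNzRingType)
    (f : {rmorphism A -> L}) :
  exists (D : comNzRingType) (kap : {rmorphism A -> D}) (g : {rmorphism D -> L})
    (ds : seq D),
  [/\ forall a, g (kap a) = f a, map g ds = zs &
     specializes f kap g /\ der_extends f kap g \/
     exists d, [/\ der_along g d, forall a, d (kap a) = 0 & has (fun x => d x != 0) ds]].
Proof.
elim: zs A f => [|z zs IHzs] A f.
  exists A, (idfun : {rmorphism A -> A}), f, [::]; split=> //; left; split.
    by move=> v fv; exists v => // O phi _ kphi phiv; exists phi.
  by move=> d dP; exists d.
have [D [kap [g [ds [gkap gds alt]]]]] := IHzs _ (evalx f z).
exists D, (kap \o polyC : {rmorphism A -> D}), g, (kap 'X :: ds); split.
- by move=> a; rewrite /= gkap evalxC.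
- by rewrite /= gkap evalxX gds.
case: alt => [[spec ext]|[d [dP dk hd]]]; last first.
  by right; exists d; split=> // [a|]; rewrite /= ?dk ?hd ?orbT.
have [sepz|nsepz] := pselect (sep_over f z); last first.
  right; have [d [dP dk]] := ext _ (deriv_der_along nsepz).
  exists d; split=> // [a|]; first by rewrite /= dk derivC rmorph0.
  by rewrite /= dk derivX rmorph1 oner_neq0.
left; split=> [v gv|d dP].
  have [u1 u1P h1] := spec v gv.
  have [u uP h] := sep_specialize sepz u1P.
  exists u => // O phi clO kphi phiu.
  have [w [kw u1w]] := h O phi clO kphi phiu.
  have [psi [psik kpsi psiv]] := h1 O (evalx phi w) clO kw u1w.
  by exists psi; split=> // a; rewrite /= psik evalxC.
have [d1 [d1P d1C]] := sep_extend_der dP sepz.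
have [d2 [d2P d2k]] := ext _ d1P.
by exists d2; split=> // a; rewrite /= d2k d1C.
Qed.

(** * Quotient rings and residue fields of prime ideals *)

Record proper_ideal_prop (A : comNzRingType) (P : A -> Prop) : Prop := ProperIdealProp {
  ideal0 : P 0;
  ideal1 : ~ P 1;
  idealD : forall a b, P a -> P b -> P (a + b);
  idealM : forall a b, P b -> P (a * b)
}.

Section IdealPred.
Variables (A : comNzRingType) (P : A -> Prop) (PI : proper_ideal_prop P).

(** The proof is an argument so that the ideal structure can be attached as an instance. *)
Definition ideal_pred of proper_ideal_prop P : {pred A} := fun a => `[< P a >].
Local Notation I := (ideal_pred PI).

Lemma ideal_predP : idealr_closed I.
Proof.
split=> [||a u v]; rewrite ?unfold_in.
- exact/asboolP/(ideal0 PI).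
- by apply/asboolP/(ideal1 PI).
- move=> /asboolP uP /asboolP vP; apply/asboolP.
  by apply: (idealD PI) => //; apply: (idealM PI).
Qed.

HB.instance Definition _ := isIdealr.Build A I ideal_predP.
End IdealPred.

Lemma quotient_exists (A : comNzRingType) (P : A -> Prop) : proper_ideal_prop P ->
  exists (Q : comNzRingType) (q : {rmorphism A -> Q}),
    (forall y, exists a, q a = y) /\ (forall a, q a = 0 <-> P a).
Proof.
move=> PI; exists {ideal_quot (ideal_pred PI)}.
exists (\pi_({ideal_quot (ideal_pred PI)}) : {rmorphism _ -> _}); split=> [y|a].
  by exists (repr y); exact: reprK.
have e := Quotient.idealrBE (ideal_pred PI) a 0.
rewrite subr0 in e; split=> [a0|Pa].
  have : a \in ideal_pred PI.
    by rewrite e; apply/eqP; rewrite a0; apply/esym/rmorph0.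
  by move/asboolP.
have /eqP a0 : a == 0 %[mod {ideal_quot (ideal_pred PI)}].
  by rewrite -e; apply/asboolP.
by apply: (etrans a0); apply: rmorph0.
Qed.

Lemma quotient_lift (A Q R : pzRingType) (q : {rmorphism A -> Q}) (f : {rmorphism A -> R}) :
  (forall y, exists a, q a = y) -> (forall a, q a = 0 -> f a = 0) ->
  exists g : {rmorphism Q -> R}, forall a, g (q a) = f a.
Proof.
move=> surj ker; have [r rK] := choice surj.
have fq a b : q a = q b -> f a = f b.
  move=> e; apply/eqP; rewrite -subr_eq0 -rmorphB; apply/eqP/ker.
  by rewrite rmorphB e subrr.
pose g y := f (r y).
have gE a : g (q a) = f a by apply: fq; rewrite rK.
have ga : zmod_morphism g.
  by move=> x y; rewrite -(rK x) -(rK y) -rmorphB !gE rmorphB.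
have gm : monoid_morphism g.
  split=> [|x y]; first by rewrite -(rmorph1 q) gE rmorph1.
  by rewrite -(rK x) -(rK y) -rmorphM !gE rmorphM.
pose gA := GRing.isZmodMorphism.Build Q R g ga.
pose gM := GRing.isMonoidMorphism.Build Q R g gm.
by exists (HB.pack g gA gM : {rmorphism Q -> R}).
Qed.

Lemma prime_ideal_field (A : comNzRingType) (P : A -> Prop) :
  proper_ideal_prop P -> (forall a b, P (a * b) -> P a \/ P b) ->
  exists (L : fieldType) (f : {rmorphism A -> L}), forall a, f a = 0 <-> P a.
Proof.
move=> PI Pp; have [Q [q [qs qk]]] := quotient_exists PI.
pose U : {pred Q} := fun x => `[< exists y, y * x = 1 >].
(* An [idomainType] carries an inverse on its units, so one is chosen before the fraction field is
   formed. *)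
have [inv invP] : {inv : Q -> Q & forall x,
    (x \in U -> inv x * x = 1) /\ (x \notin U -> inv x = x)}.
  apply: (@choice Q Q (fun x y => (x \in U -> y * x = 1) /\ (x \notin U -> y = x))) => x.
  have [/asboolP[y yx]|nU] := boolP (x \in U).
    by exists y.
  by exists x.
have iV : {in U, left_inverse 1 inv *%R} by move=> x xU; case: (invP x) => ->.
have iU x y : y * x = 1 -> U x by move=> yx; apply/asboolP; exists y.
have iO : {in [predC U], inv =1 id} by move=> x xU; case: (invP x) => _ ->.
pose uA := GRing.ComNzRing_hasMulInverse.Build Q iV iU iO.
pose UQ : comUnitRingType := HB.pack (GRing.ComNzRing.sort Q) uA.
have iQ (x y : UQ) : x * y = 0 -> (x == 0) || (y == 0).
  have [a <-] := qs x; have [b <-] := qs y => ab0.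
  have /qk/Pp[/qk->|/qk->] : q (a * b) = 0 by rewrite rmorphM.
    by rewrite eqxx.
  by rewrite eqxx orbT.
pose DQ : idomainType := HB.pack (GRing.ComNzRing.sort Q) uA (GRing.ComUnitRing_isIntegral.Build UQ iQ).
pose i : {rmorphism DQ -> {fraction DQ}} := @tofrac DQ.
exists {fraction DQ}, (i \o (q : {rmorphism A -> DQ}) : {rmorphism A -> {fraction DQ}}) => a.
rewrite /= -qk; split=> [/eqP|->]; last exact: rmorph0.
by rewrite tofrac_eq0 => /eqP.
Qed.

(** * Evaluation, Taylor expansion and derivations of polynomials in several variables *)

Section MpolyTools.
Variables (N : nat) (F : comNzRingType).
Implicit Types p : {mpoly F[N]}.

Lemma mpoly_ring_ind (P : {mpoly F[N]} -> Prop) :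
  (forall c, P c%:MP) -> (forall i, P 'X_i) ->
  (forall p q, P p -> P q -> P (p + q)) -> (forall p q, P p -> P q -> P (p * q)) ->
  forall p, P p.
Proof.
move=> PC PX PD PM p; have P1 : P 1 by rewrite -mpolyC1.
have PE q k : P q -> P (q ^+ k).
  by move=> Pq; elim: k => [|k IHk]; rewrite ?expr0 // exprS; apply: PM.
rewrite [p]mpolyE; apply: (big_ind P); [by rewrite -mpolyC0 | exact: PD | move=> m _].
rewrite -mul_mpolyC; apply: (PM) => //; rewrite mpolyXE_id.
by apply: (big_ind P) => [//||i _]; [exact: PM | exact: PE].
Qed.

Lemma mpoly_rmorph_eq (R : nzRingType) (f g : {rmorphism {mpoly F[N]} -> R}) :
  (forall c, f c%:MP = g c%:MP) -> (forall i, f 'X_i = g 'X_i) -> f =1 g.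
Proof.
move=> eC eX; elim/mpoly_ring_ind => // p q ep eq.
  by rewrite !rmorphD ep eq.
by rewrite !rmorphM ep eq.
Qed.

Lemma mderivXi (i j : 'I_N) : ('X_i : {mpoly F[N]})^`M(j) = (i == j)%:R.
Proof.
rewrite mderivX mnm1E; case: eqP => [->|_]; last by rewrite scale0r.
by rewrite scale1r -[X in (X - _)%MM]add0m addmK mpolyX0.
Qed.

Lemma rmorph_mmap (R R' : comNzRingType) (s : {rmorphism F -> R}) (q : 'I_N -> R)
    (g : {rmorphism R -> R'}) p :
  g (mmap s q p) = mmap (g \o s) (g \o q) p.
Proof.
apply: (@mpoly_rmorph_eq _ (g \o mmap s q) (mmap (g \o s) (g \o q))) => [c|i] /=.
  by rewrite !mmapC.
by rewrite !mmapX !mmap1U.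
Qed.

Lemma rmorph_mmapE (R : comNzRingType) (g : {rmorphism {mpoly F[N]} -> R}) p :
  g p = mmap (g \o @mpolyC N F) (fun i => g 'X_i) p.
Proof.
apply: (mpoly_rmorph_eq (g := mmap (g \o @mpolyC N F) (fun i => g 'X_i))) => [c|i] /=.
  by rewrite mmapC.
by rewrite mmapX mmap1U.
Qed.

Lemma eq_mmap (R : comNzRingType) (s s' : F -> R) (q q' : 'I_N -> R) :
  s =1 s' -> q =1 q' -> mmap s q =1 mmap s' q'.
Proof.
move=> es eq p; rewrite /mmap; apply: eq_bigr => m _; rewrite es; congr (_ * _).
by apply: eq_bigr => i _; rewrite eq.
Qed.

Lemma mmap_id p : mmap (@mpolyC N F) (fun i => 'X_i) p = p.
Proof. by rewrite [RHS](rmorph_mmapE (idfun : {rmorphism {mpoly F[N]} -> {mpoly F[N]}})). Qed.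

Lemma mmap_taylor (R : comNzRingType) (s : {rmorphism F -> R}) (q w : 'I_N -> R) (e : R) p :
  exists r, mmap s (fun i => q i + e * w i) p =
    mmap s q p + e * (\sum_j mmap s q p^`M(j) * w j) + e ^+ 2 * r.
Proof.
elim/mpoly_ring_ind: p => [c|i|p1 p2 [r1 E1] [r2 E2]|p1 p2 [r1 E1] [r2 E2]].
- exists 0; rewrite !mmapC big1 ?mulr0 ?addr0 // => j _.
  by rewrite mderivC rmorph0 mul0r.
- exists 0; rewrite !mmapX !mmap1U mulr0 addr0 (bigD1 i) //= big1 ?addr0.
    by rewrite mderivXi eqxx rmorph1 mul1r.
  by move=> j ji; rewrite mderivXi eq_sym (negbTE ji) rmorph0 mul0r.
- exists (r1 + r2); rewrite rmorphD /= E1 E2 rmorphD /=.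
  under [in RHS]eq_bigr do rewrite mderivD rmorphD mulrDl.
  rewrite big_split /=; ring.
set d1 := \sum_j mmap s q p1^`M(j) * w j in E1.
set d2 := \sum_j mmap s q p2^`M(j) * w j in E2.
have -> : \sum_j mmap s q (p1 * p2)^`M(j) * w j = d1 * mmap s q p2 + mmap s q p1 * d2.
  rewrite mulr_suml mulr_sumr -big_split; apply: eq_bigr => j _ /=.
  rewrite mderivM rmorphD !rmorphM mulrDl mulrA; congr (_ + _).
  by rewrite mulrAC.
rewrite rmorphM /= E1 E2 rmorphM; set a := mmap s q p1; set b := mmap s q p2.
exists (d1 * d2 + a * r2 + r1 * b + e * (d1 * r2 + r1 * d2) + e ^+ 2 * (r1 * r2)).
ring.
Qed.

Lemma der_mmap (D : comNzRingType) (L : fieldType) (g : {rmorphism D -> L}) (d : D -> L)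
    (s : {rmorphism F -> D}) (q : 'I_N -> D) p :
  der_along g d -> (forall c, d (s c) = 0) ->
  d (mmap s q p) = \sum_j g (mmap s q p^`M(j)) * d (q j).
Proof.
move=> [dD dM d0] ds; elim/mpoly_ring_ind: p => [c|i|p1 p2 E1 E2|p1 p2 E1 E2].
- rewrite mmapC ds big1 // => j _.
  by rewrite mderivC !rmorph0 mul0r.
- rewrite mmapX mmap1U (bigD1 i) //= big1 ?addr0.
    by rewrite mderivXi eqxx !rmorph1 mul1r.
  by move=> j ji; rewrite mderivXi eq_sym (negbTE ji) !rmorph0 mul0r.
- rewrite rmorphD /= dD E1 E2 -big_split; apply: eq_bigr => j _ /=.
  by rewrite mderivD !rmorphD mulrDl.
rewrite rmorphM /= dM E1 E2 !mulr_sumr -big_split; apply: eq_bigr => j _ /=.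
rewrite mderivM rmorphD !rmorphM rmorphD !rmorphM /= mulrDl addrC !mulrA; congr (_ + _).
by rewrite [g _ * g _]mulrC.
Qed.

End MpolyTools.

Lemma map_mpoly_eq0 (N : nat) (F K : fieldType) (s : {rmorphism F -> K}) (p : {mpoly F[N]}) :
  mmap (@mpolyC N K \o s) (fun i => 'X_i) p = 0 -> p = 0.
Proof.
move=> e; apply/mpolyP => m; rewrite mcoeff0; apply: (fmorph_inj s).
by rewrite rmorph0 -mcoeff_map_mpoly /map_mpoly e mcoeff0.
Qed.

(** [U] need not be a subspace: a free family of largest size inside [U] spans all of [U]. This
    serves for gradients, for twisted Galois invariants and for equations of bounded degree. *)
Lemma row_family_basis (K : fieldType) (N : nat) (U : 'rV[K]_N -> Prop) :
  exists (r : nat) (M : 'M[K]_(r, N)),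
    [/\ forall i, U (row i M), row_free M & forall u, U u -> (u <= M)%MS].
Proof.
pose good r := `[< exists M : 'M[K]_(r, N), (forall i, U (row i M)) /\ row_free M >].
have g0 : exists r, good r.
  exists 0%N; apply/asboolP; exists 0; split=> [[]//|].
  by rewrite /row_free mxrank0.
have gN r : good r -> (r <= N)%N.
  by move=> /asboolP[M [_ /eqP <-]]; exact: rank_leq_col.
have [r /asboolP[M [MU Mf]] rmax] := ex_maxnP g0 gN.
exists r, M; split=> // u Uu; apply: contraTT isT => nuM.
suff /rmax : good (1 + r)%N by rewrite ltnn.
apply/asboolP; exists (col_mx u M); split=> [i|].
  case: (split_ordP i) => j ->.
    by rewrite rowKu (_ : row j u = u) //; apply/rowP => k; rewrite mxE ord1.
  by rewrite rowKd.
have ltM : (M < u + M)%MS by rewrite /ltmx addsmxSr addsmx_sub (negbTE nuM).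
have := rank_ltmx ltM; rewrite (eqP Mf) addsmxE => lt.
by rewrite /row_free eqn_leq rank_leq_row.
Qed.

(** * Smooth sets of zeros have separable points *)

Section TruncatedPolynomials.
Variable E : idomainType.
Implicit Types p q : {poly E}.

(** Congruences modulo powers of ['X] stand in for power series: the formal curve is a coherent
    sequence of polynomials, the n-th one read modulo ['X^(n+1)]. *)
Definition Xdvd k p := exists b, p = b * 'X^k.

Lemma Xdvd0 k : Xdvd k 0.
Proof. by exists 0; rewrite mul0r. Qed.

Lemma XdvdD k p q : Xdvd k p -> Xdvd k q -> Xdvd k (p + q).
Proof. by move=> [a ->] [b ->]; exists (a + b); rewrite mulrDl. Qed.

Lemma XdvdM k p q : Xdvd k q -> Xdvd k (p * q).
Proof. by move=> [b ->]; exists (p * b); rewrite mulrA. Qed.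

Lemma XdvdN k p : Xdvd k p -> Xdvd k (- p).
Proof. by move=> [b ->]; exists (- b); rewrite mulNr. Qed.

Lemma XdvdB k p q : Xdvd k p -> Xdvd k q -> Xdvd k (p - q).
Proof. by move=> pk qk; apply: XdvdD => //; apply: XdvdN. Qed.

Lemma Xdvd_cong k p q : Xdvd k (p - q) -> Xdvd k p -> Xdvd k q.
Proof. by move=> pq pk; rewrite -(subKr p q); apply: XdvdB. Qed.

Lemma Xdvd_le k l p : (k <= l)%N -> Xdvd l p -> Xdvd k p.
Proof. by move=> kl [b ->]; exists (b * 'X^(l - k)); rewrite -mulrA -exprD subnK. Qed.

Lemma XdvdP k p : Xdvd k p <-> forall i, (i < k)%N -> p`_i = 0.
Proof.
split=> [[b ->] i ik|h]; first by rewrite coefMXn ik.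
exists (drop_poly k p); rewrite -{1}(poly_take_drop k p) (_ : take_poly k p = 0) ?add0r //.
by apply/polyP => i; rewrite coef_take_poly coef0; case: ltnP => // /h.
Qed.

Lemma Xdvd_all p : (forall k, Xdvd k p) -> p = 0.
Proof. by move=> h; apply/polyP => i; rewrite coef0; apply: (XdvdP i.+1 p).1. Qed.

Lemma Xdvd_ideal k : (0 < k)%N -> proper_ideal_prop (Xdvd k).
Proof.
move=> k0; split; [exact: Xdvd0 | | exact: XdvdD | exact: XdvdM].
by move=> /XdvdP/(_ 0%N k0)/eqP; rewrite coef1 oner_eq0.
Qed.

Lemma NXdvd k p : ~ Xdvd k p -> exists i u,
  [/\ (i < k)%N, p = u * 'X^i & u`_0 != 0].
Proof.
move=> npk; have : exists i, p`_i != 0.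
  by apply: contra_notP npk => h; apply/XdvdP => i _; apply: contra_notP h => pi; exists i; apply/eqP.
move=> ex; case: (ex_minnP ex) => i pi imin; exists i, (drop_poly i p).
have [b e] : Xdvd i p.
  apply/XdvdP => j ji; apply/eqP; apply: contraTT ji => /imin; by rewrite -leqNgt.
split; last by rewrite coef_drop_poly.
  rewrite ltnNge; apply/negP => ki; apply: npk; apply: Xdvd_le ki _; by exists b.
by rewrite e drop_polyMXn_id.
Qed.

End TruncatedPolynomials.

(** The infinitesimal lifting criterion for the zeros of [I] over [K], phrased on tuples of
    coordinates. [I] may be infinite, and no coordinate ring is formed. *)
Definition smooth_zeros (F K : fieldType) (s : {rmorphism F -> K}) (N : nat)
    (I : {mpoly F[N]} -> Prop) :=
  forall (R T : comNzRingType) (sR : {rmorphism K -> R}) (g : {rmorphism R -> T}),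
    (forall y, exists x, g x = y) ->
    (forall x x', g x = 0 -> g x' = 0 -> x * x' = 0) ->
    forall y : 'I_N -> T, (forall h, I h -> mmap (g \o (sR \o s)) y h = 0) ->
    exists x : 'I_N -> R, (forall h, I h -> mmap (sR \o s) x h = 0) /\ g \o x =1 y.

Section FormalCurve.
Variables (F K : fieldType) (s : {rmorphism F -> K}) (N : nat).
Variables (I : {mpoly F[N]} -> Prop) (x0 : 'I_N -> K).
Hypothesis smoothI : smooth_zeros s I.
Hypothesis I0 : forall h, I h -> mmap s x0 h = 0.

Variables (E : idomainType) (c : {rmorphism K -> E}) (V : 'I_N -> E).
Let cE : {rmorphism K -> {poly E}} := polyC \o c.
Local Notation ev y := (mmap (cE \o s) y).

(* f lists the bound coordinates, the others are free.                          *)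
Variables (r : nat) (M : 'M[K]_(r, N)) (f : {ffun 'I_r -> 'I_N}).
Hypothesis fU : colsub f M \in unitmx.
Hypothesis gradI : forall h, I h -> (\row_j mmap s x0 h^`M(j) <= M)%MS.

Definition curve_mod k (y : 'I_N -> {poly E}) :=
  [/\ forall h, I h -> Xdvd k (ev y h),
      forall j, Xdvd 1 (y j - cE (x0 j)) &
      forall j, (forall a, j != f a) -> Xdvd k (y j - (cE (x0 j) + 'X * (V j)%:P))].

Lemma mmap_cong (p : {mpoly F[N]}) k (y z : 'I_N -> {poly E}) :
  (forall j, Xdvd k (y j - z j)) -> Xdvd k (ev y p - ev z p).
Proof.
move=> yz; elim/mpoly_ring_ind: p => [a|i|p q Ep Eq|p q Ep Eq].
- by rewrite !mmapC subrr; exact: Xdvd0.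
- by rewrite !mmapX !mmap1U.
- rewrite !mmapD opprD addrACA; exact: (XdvdD Ep Eq).
rewrite (rmorphM (mmap (cE \o s) y)) (rmorphM (mmap (cE \o s) z)) /=.
move: (ev y p) (ev y q) (ev z p) (ev z q) Ep Eq => a b a' b' Ep Eq.
have -> : a * b - a' * b' = b * (a - a') + a' * (b - b') by ring.
exact: XdvdD (XdvdM _ Ep) (XdvdM _ Eq).
Qed.

Lemma curve_start : curve_mod 1 (fun j => cE (x0 j)).
Proof.
split=> [h Ih|j|j _].
- rewrite -(rmorph_mmap s x0 cE) I0 // rmorph0; exact: Xdvd0.
- by rewrite subrr; exact: Xdvd0.
by rewrite opprD addrA subrr add0r; apply: XdvdN; exists (V j)%:P; rewrite mulrC.
Qed.

(** A tangent vector at [x0] with prescribed free coordinates: the bound columns of [M] are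
    invertible, so changing the bound coordinates of [v] alone brings it into the kernel of [M]. *)
Lemma tangent_exists (v : 'cV[E]_N) : exists w : 'cV[E]_N,
  (forall h, I h -> \sum_j c (mmap s x0 h^`M(j)) * w j 0 = 0) /\
  (forall j, (forall a, j != f a) -> w j 0 = v j 0).
Proof.
pose up m n (B : 'M[K]_(m, n)) : 'M[E]_(m, n) := map_mx c B.
pose Sel : 'M[E]_(N, r) := \matrix_(j, a) (j == f a)%:R.
pose w := v - Sel *m (up _ _ (invmx (colsub f M)) *m (up _ _ M *m v)).
have MSel : up _ _ M *m Sel = up _ _ (colsub f M).
  apply/matrixP => i a; rewrite !mxE (bigD1 (f a)) //= big1 ?addr0.
    by rewrite !mxE eqxx mulr1.
  by move=> j ja; rewrite !mxE (negbTE ja) mulr0.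
have Mw : up _ _ M *m w = 0.
  by rewrite mulmxBr !mulmxA MSel -map_mxM mulmxV // map_mx1 mul1mx subrr.
exists w; split=> [h Ih|j jf].
  have /submxP[D gD] := gradI Ih.
  transitivity ((up _ _ (\row_j mmap s x0 h^`M(j)) *m w) 0 0).
    by rewrite !mxE; apply: eq_bigr => j _; rewrite !mxE.
  by rewrite gD /up map_mxM -mulmxA Mw mulmx0 mxE.
rewrite /w !mxE big1 ?subr0 // => a _.
by rewrite !mxE (negbTE (jf a)) mul0r.
Qed.

(** Smoothness lifts the solution by one order but gives no control of the free coordinates. Their
    error at order [k] is repaired by adding ['X^k] times a tangent vector at [x0], which leaves the
    equations unchanged modulo ['X^(k+1)]. *)
Lemma curve_step k y : (0 < k)%N -> curve_mod k y -> exists y',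
  curve_mod k.+1 y' /\ forall j, Xdvd k (y' j - y j).
Proof.
move=> k0 [yI yx yV].
have [T [qT [qTs qTk]]] := quotient_exists (Xdvd_ideal E k0).
have [R [qR [qRs qRk]]] := quotient_exists (Xdvd_ideal E (ltn0Sn k)).
have [|g gE] := @quotient_lift _ _ _ qR qT qRs.
  by move=> a /qRk ak; apply/qTk; apply: Xdvd_le ak.
have gk x : g x = 0 -> exists2 b, x = qR b & Xdvd k b.
  by have [b <-] := qRs x; rewrite gE => /qTk bk; exists b.
have [|||y1 [y1I y1y]] := smoothI (sR := qR \o cE) (g := g) _ _ (y := qT \o y).
- by move=> u; have [b <-] := qTs u; exists (qR b).
- move=> x x' /gk[b -> [d bE]] /gk[b' -> [d' bE']]; rewrite -rmorphM; apply/qRk.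
  rewrite bE bE' mulrACA -exprD; apply: (@Xdvd_le _ _ (k + k)); last by exists (d * d').
  by rewrite -addn1 leq_add2l.
- move=> h Ih; rewrite -(eq_mmap (s := qT \o (cE \o s)) (q := qT \o y)) //.
    by rewrite -(rmorph_mmap (cE \o s)); apply/qTk/yI.
  by move=> a /=; rewrite gE.
have [z zE] := choice (fun j => qRs (y1 j)).
have zy j : Xdvd k (z j - y j).
  by apply/qTk; rewrite rmorphB -!gE zE; apply/eqP; rewrite subr_eq0 gE; apply/eqP/y1y.
have zI h : I h -> Xdvd k.+1 (ev z h).
  move=> Ih; apply/qRk; rewrite rmorph_mmap -(y1I h Ih).
  by apply: eq_mmap => // j /=; rewrite zE.
(* The coefficient of order [k] by which the lift misses the prescribed line. *)
pose v : 'cV[E]_N := \col_j (cE (x0 j) + 'X * (V j)%:P - z j)`_k.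
have [w [wI wv]] := tangent_exists v.
exists (fun j => z j + 'X^k * (w j 0)%:P); split; last first.
  move=> j; rewrite addrAC; apply: XdvdD => //; exists (w j 0)%:P; exact: mulrC.
have zx j : Xdvd 1 (z j - cE (x0 j)).
  rewrite -(subrK (y j) (z j)) -addrA; apply: XdvdD => //; exact: Xdvd_le k0 _.
split=> [h Ih|j|j jf].
- have [b ->] := mmap_taylor (cE \o s) z (fun j => (w j 0)%:P) 'X^k h.
  apply: XdvdD; last first.
    rewrite -exprM mulrC; apply: (@Xdvd_le _ _ (k * 2)); last by exists b.
    by rewrite muln2 -addnn -addn1 leq_add2l.
  apply: XdvdD; first exact: zI.
  suff [d ->] : Xdvd 1 (\sum_j ev z h^`M(j) * (w j 0)%:P).
    by exists d; rewrite mulrCA -exprD addn1.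
  (* The gradient at [z] agrees modulo ['X] with the one at [x0], to which [w] is tangent. *)
  have <- : \sum_j cE (mmap s x0 h^`M(j)) * (w j 0)%:P +
     \sum_j (ev z h^`M(j) - cE (mmap s x0 h^`M(j))) * (w j 0)%:P =
     \sum_j ev z h^`M(j) * (w j 0)%:P.
    by rewrite -big_split; apply: eq_bigr => j _ /=; rewrite -mulrDl addrC subrK.
  apply: XdvdD.
    under eq_bigr do rewrite /cE /= -polyCM.
    by rewrite -rmorph_sum wI // rmorph0; exact: Xdvd0.
  apply: (big_ind (Xdvd 1)); [exact: Xdvd0 | exact: XdvdD | move=> j _].
  by rewrite mulrC; apply: XdvdM; rewrite rmorph_mmap; apply: mmap_cong.
- rewrite addrAC; apply: XdvdD => //; apply: Xdvd_le k0 _; exists (w j 0)%:P; exact: mulrC.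
have zV : Xdvd k (z j - (cE (x0 j) + 'X * (V j)%:P)).
  by rewrite -(subrK (y j) (z j)) -addrA; apply: XdvdD => //; exact: yV.
apply/XdvdP => i; rewrite ltnS leq_eqVlt => /predU1P[->|ik].
  rewrite addrAC coefD coefMC coefXn eqxx mul1r wv // mxE.
  by rewrite -coefD addrA subrK subrr coef0.
rewrite addrAC coefD coefMC coefXn (ltn_eqF ik) mul0r addr0.
exact: (XdvdP k _).1.
Qed.

End FormalCurve.

Lemma sep_closure_infinite (K : fieldType) (S : separable_closure K) (n : nat) :
  exists rs : seq S, uniq rs /\ (n <= size rs)%N.
Proof.
(* One of [n] and [n + 1] is nonzero in [S]; then ['X^m - 1] is separable and splits into [m]
   distinct factors. *)
have [m nm m0] : exists2 m, (n <= m)%N & m%:R != 0 :> S.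
  have [n0|n0] := eqVneq (n%:R : S) 0; last by exists n.
  by exists n.+1 => //; rewrite -addn1 natrD n0 add0r oner_eq0.
have mgt : (0 < m)%N by rewrite lt0n; apply: contraNneq m0 => ->.
have sepm := cyclotomic.separable_Xn_sub_1 m0.
have [rs E] := sep_split sepm.
move: E; rewrite (eqP (monic_Xn_sub_1 _ mgt)) scale1r => E.
exists rs; rewrite -separable_prod_XsubC -E; split=> //.
apply: leq_trans nm _; rewrite -ltnS -(size_Xn_sub_1 S mgt) E.
by rewrite size_prod_XsubC.
Qed.

Lemma mpoly_nonvanishing (O : idomainType) (N : nat) (p : {mpoly O[N]}) :
  (forall n, exists rs : seq O, uniq rs /\ (n <= size rs)%N) -> p != 0 ->
  exists c : 'I_N -> O, mmap idfun c p != 0.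
Proof.
move=> infO p0.
suff /(_ N (leqnn N))[c cP] : forall k, (k <= N)%N -> exists c : 'I_N -> O,
    mmap (@mpolyC N O) (fun j : 'I_N => if (j < k)%N then (c j)%:MP else 'X_j) p != 0.
  exists c; apply: contraNneq cP => c0; rewrite -mpolyC0 -c0 rmorph_mmap.
  by apply/eqP; apply: eq_mmap => // j; rewrite ltn_ord.
elim=> [_|k IHk kN]; first by exists (fun=> 0); rewrite mmap_id.
have [c] := IHk (ltnW kN).
set pc := mmap _ _ p => pc0.
pose i := Ordinal kN.
(* [T] reads a polynomial as univariate in ['X_i], with coefficients in the remaining variables, so
   that the bound on the number of roots applies. *)
pose T := mmap ((polyC : {rmorphism _ -> {poly {mpoly O[N]}}}) \o @mpolyC N O)
  (fun j => if j == i then 'X else ('X_j)%:P).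
have TE q x : (T q).[x] = mmap (@mpolyC N O) (fun j => if j == i then x else 'X_j) q.
  rewrite -[LHS]/(horner_eval x (T q)) rmorph_mmap; apply: eq_mmap => [a|j] /=.
    by rewrite /horner_eval hornerC.
  by rewrite /horner_eval; case: eqP => _; rewrite ?hornerX ?hornerC.
have Tpc : T pc != 0.
  apply: contraNneq pc0 => T0; have := TE pc 'X_i; rewrite T0 horner0 => ->.
  by rewrite -[X in X == _](mmap_id pc); apply/eqP/eq_mmap => // j; case: eqP => [->|].
have [d dP] : exists d : O, (T pc).[d%:MP] != 0.
  have [rs [rsu rss]] := infO (size (T pc)).
  apply: contrapT => nd; have : (size [seq d%:MP_[N] | d <- rs] < size (T pc))%N.
    apply: max_poly_roots => //; last by rewrite map_inj_uniq //; exact: (can_inj (@mpolyCK _ _)).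
    apply/allP => _ /mapP[d _ ->]; apply/negPn/negP => dr; apply: nd.
    by exists d.
  by rewrite size_map ltnNge rss.
exists (fun j => if j == i then d else c j).
move: dP; rewrite TE; set a := mmap _ _ pc; set b := mmap _ _ p.
suff -> : a = b by [].
rewrite /a /pc rmorph_mmap; apply: eq_mmap => [e|j] /=; first by rewrite mmapC.
rewrite [(j < k.+1)%N]ltnS [(j <= k)%N]leq_eqVlt -[j == k :> nat]/(j == i); case: eqP => [->|ji] /=.
  by rewrite ltnn mmapX mmap1U eqxx.
case: ifP => _; first by rewrite mmapC.
by rewrite mmapX mmap1U; case: eqP.
Qed.

Section SeparablePoint.
Variables (F K : fieldType) (s : {rmorphism F -> K}) (N : nat).
Variables (I : {mpoly F[N]} -> Prop) (x0 : 'I_N -> K).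
Hypothesis smoothI : smooth_zeros s I.
Hypothesis I0 : forall h, I h -> mmap s x0 h = 0.

Lemma gradient_basis : exists (r : nat) (M : 'M[K]_(r, N)) (f : {ffun 'I_r -> 'I_N})
    (hs : 'I_r -> {mpoly F[N]}),
  [/\ injective f, colsub f M \in unitmx,
      forall h, I h -> (\row_j mmap s x0 h^`M(j) <= M)%MS,
      forall i, I (hs i) &
      forall i, row i M = \row_j mmap s x0 (hs i)^`M(j)].
Proof.
pose U (u : 'rV[K]_N) := exists h, I h /\ u = \row_j mmap s x0 h^`M(j).
have [r [M [MU Mf Mmax]]] := row_family_basis U.
have [hs hsP] := choice MU.
have Mt : row_full M^T by rewrite /row_full mxrank_tr.
exists r, M, (fullrankfun Mt), hs; split.
- exact: fullrankfun_inj.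
- by rewrite -unitmx_tr trmx_mxsub; exact: fullrowsub_unit.
- by move=> h Ih; apply: Mmax; exists h.
- by move=> i; case: (hsP i).
by move=> i; case: (hsP i).
Qed.

Section GenericDirection.
Variables (E : idomainType) (c : {rmorphism K -> E}) (V : 'I_N -> E).
Hypothesis Vindep : forall h, mmap (c \o s) (fun j => c (x0 j) + V j) h = 0 -> h = 0.
Let cE : {rmorphism K -> {poly E}} := polyC \o c.
Local Notation ev y := (mmap (cE \o s) y).

Section Curve.
Variables (r : nat) (M : 'M[K]_(r, N)) (f : {ffun 'I_r -> 'I_N}).
Variable hs : 'I_r -> {mpoly F[N]}.
Hypothesis finj : injective f.
Hypothesis fU : colsub f M \in unitmx.
Hypothesis gradI : forall h, I h -> (\row_j mmap s x0 h^`M(j) <= M)%MS.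
Hypothesis hsI : forall i, I (hs i).
Hypothesis hsM : forall i, row i M = \row_j mmap s x0 (hs i)^`M(j).

Local Notation curve := (curve_mod s I x0 c V f).

Lemma curve_exists : exists Y : nat -> 'I_N -> {poly E},
  (forall n, curve n.+1 (Y n)) /\ forall n m j, (n <= m)%N -> Xdvd n.+1 (Y m j - Y n j).
Proof.
(* The hypothesis is placed under the existential so that choice returns a total function, which can
   be iterated. *)
have step n (y : 'I_N -> {poly E}) : exists y', curve n.+1 y ->
    curve n.+2 y' /\ forall j, Xdvd n.+1 (y' j - y j).
  have [yc|nyc] := pselect (curve n.+1 y); last by exists y.
  by have [y' y'P] := curve_step smoothI fU gradI (ltn0Sn n) yc; exists y'.
have [nx nxP] := choice (fun p : nat * ('I_N -> {poly E}) => step p.1 p.2).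
pose Y := fix Y n := if n is m.+1 then nx (m, Y m) else fun j => cE (x0 j).
have YP n : curve n.+1 (Y n).
  elim: n => [|n IHn]; first exact: (curve_start I0).
  by case: (nxP (n, Y n) IHn).
exists Y; split=> // n m j nm; rewrite -(subnKC nm).
elim: (m - n)%N => [|d IHd]; first by rewrite addn0 subrr; exact: Xdvd0.
rewrite addnS -(subrK (Y (n + d)%N j) (Y _ j)) -addrA; apply: XdvdD => //.
apply: (@Xdvd_le _ _ (n + d).+1); first by rewrite ltnS leq_addr.
by case: (nxP ((n + d)%N, Y (n + d)%N) (YP _)) => _; apply.
Qed.

Section Generic.
Variable Y : nat -> 'I_N -> {poly E}.
Hypothesis YP : forall n, curve n.+1 (Y n).
Hypothesis Ycong : forall n m j, (n <= m)%N -> Xdvd n.+1 (Y m j - Y n j).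

(** The kernel of evaluation at the formal curve, that is, of a map from [F[X_1..X_N]] to the power
    series over [E]. *)
Definition vanishing (h : {mpoly F[N]}) := forall n, Xdvd n.+1 (ev (Y n) h).

Lemma vanishing_ideal : proper_ideal_prop vanishing.
Proof.
split=> [n||a b aP bP n|a b bP n].
- by rewrite rmorph0; exact: Xdvd0.
- by move=> /(_ 0%N); rewrite rmorph1; exact: (ideal1 (Xdvd_ideal _ _)).
- by rewrite mmapD; exact: XdvdD.
- by rewrite rmorphM; exact: XdvdM.
Qed.

Lemma vanishing_prime a b : vanishing (a * b) -> vanishing a \/ vanishing b.
Proof.
move=> abP; apply: contrapT => nab.
have [n an] : exists n, ~ Xdvd n.+1 (ev (Y n) a).
  by apply: contra_notP nab => h; left=> n; apply: contra_notP h => ?; exists n.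
have [m bm] : exists m, ~ Xdvd m.+1 (ev (Y m) b).
  by apply: contra_notP nab => h; right=> m; apply: contra_notP h => ?; exists m.
have far h k l : (k <= l)%N -> ~ Xdvd k.+1 (ev (Y k) h) -> ~ Xdvd k.+1 (ev (Y l) h).
  move=> kl; apply: contra_not => lk.
  by apply: (Xdvd_cong _ lk); apply: mmap_cong => j; exact: Ycong.
(* Both orders of vanishing are measured at the common stage [n + m], where the coefficient at
   [i + j <= n + m] is still meaningful; it is the product of two nonzero leading terms. *)
have [i [u [ilt aE u0]]] := NXdvd (far a n (n + m)%N (leq_addr _ _) an).
have [j [w [jlt bE w0]]] := NXdvd (far b m (n + m)%N (leq_addl _ _) bm).
have /XdvdP/(_ (i + j)%N) := abP (n + m)%N.
rewrite rmorphM /= aE bE mulrACA -exprD coefMXn ltnn subnn coef0M => /(_ _)/eqP.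
rewrite mulf_eq0 (negbTE u0) (negbTE w0) => h; move: h => /(_ _)/notF; apply.
by rewrite ltnS leq_add.
Qed.

Lemma vanishing_I h : I h -> vanishing h.
Proof. by move=> Ih n; case: (YP n) => + _ _; apply. Qed.

Definition jacobian := \det (\matrix_(i, a) (hs i)^`M(f a)).

(** The constant term along the curve is the Jacobian at [x0], which is the invertible minor of
    [M]. *)
Lemma jacobian_nonvanishing : ~ vanishing jacobian.
Proof.
move=> /(_ 0%N) J0.
have : Xdvd 1 (ev (fun j => cE (x0 j)) jacobian).
  by apply: (Xdvd_cong _ J0); apply: mmap_cong => j; case: (YP 0) => _ + _; apply.
rewrite -(rmorph_mmap s x0 cE) => /XdvdP/(_ 0%N (ltn0Sn 0))/eqP.
rewrite coefC /= fmorph_eq0 -det_map_mx.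
have -> : map_mx (mmap s x0) (\matrix_(i, a) (hs i)^`M(f a)) = colsub f M.
  apply/matrixP => i a; rewrite !mxE.
  by have /rowP/(_ (f a)) := hsM i; rewrite !mxE => ->.
by apply/negP; rewrite -unitfE -unitmxE.
Qed.

(** Projection onto the polynomials in the free variables, kept as an endomorphism so that no second
    polynomial ring is needed. *)
Definition free_part : {rmorphism {mpoly F[N]} -> {mpoly F[N]}} :=
  mmap (@mpolyC N F) (fun j => if j \in codom f then 0 else 'X_j).

(** The free coordinates equal [x0_j + 'X V_j] to every order, so the evaluation is a genuine
    polynomial in ['X] divisible by all powers of ['X], hence zero. *)
Lemma vanishing_free a : vanishing (free_part a) -> free_part a = 0.
Proof.
move=> van; pose z j := cE (x0 j) + 'X * (V j)%:P.
have evfree y : ev y (free_part a) = ev (fun j => if j \in codom f then 0 else y j) a.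
  rewrite rmorph_mmap; apply: eq_mmap => [e|j] /=; first by rewrite mmapC.
  by case: ifP => _; rewrite ?rmorph0 // mmapX mmap1U.
have z0 : ev z (free_part a) = 0.
  apply: Xdvd_all => k; apply: (@Xdvd_le _ _ k.+1) => //.
  apply: (Xdvd_cong _ (van k)); rewrite !evfree; apply: mmap_cong => j.
  case: ifP => [_|jf]; first by rewrite subrr; exact: Xdvd0.
  case: (YP k) => _ _; apply=> b; apply/eqP => je.
  by move: jf; rewrite je codom_f.
(* At ['X = 1] the line passes through the generic point [x0 + V]. *)
apply: Vindep; have := congr1 (horner_eval 1) z0; rewrite rmorph0 => <-.
rewrite [RHS]rmorph_mmap; apply: eq_mmap => [e|j] /=; rewrite /horner_eval /z ?hornerC //.
by rewrite hornerD hornerM !hornerC hornerX mul1r.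
Qed.

Lemma generic_point (S : separable_closure F) :
  exists q : 'I_N -> S, forall h, I h -> mmap (sep_incl S) q h = 0.
Proof.
have [L [p pP]] := prime_ideal_field vanishing_ideal vanishing_prime.
(* By [vanishing_free] its kernel is that of [free_part], so every assignment of values to the free
   variables respects it. *)
pose fL : {rmorphism {mpoly F[N]} -> L} := p \o free_part.
have [D [kap [g [ds [gkap gds alt]]]]] := sep_tower [seq p 'X_(f a) | a : 'I_r] fL.
have ds_size : size ds = r by rewrite -(size_map g) gds size_map size_enum_ord.
pose q j := if [pick a | f a == j] is Some a then ds`_a else kap 'X_j.
have qf a : q (f a) = ds`_a.
  rewrite /q; case: pickP => [b /eqP/finj -> //|/(_ a)]; by rewrite eqxx.
have qfree j : (forall a, f a != j) -> q j = kap 'X_j.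
  by move=> jf; rewrite /q; case: pickP => [a|//]; rewrite (negbTE (jf a)).
have gq j : g (q j) = p 'X_j.
  have [a /eqP <-|jf] := pickP (fun a => f a == j).
    rewrite qf -(nth_map 0 0) ?ds_size // gds (nth_map a) ?size_enum_ord //.
    by rewrite nth_ord_enum.
  rewrite qfree => [|a]; last by rewrite jf.
  rewrite gkap /= mmapX mmap1U ifN //; apply/codomP => -[a ja].
  by have := jf a; rewrite ja eqxx.
pose sD : {rmorphism F -> D} := kap \o @mpolyC N F.
have gev h : g (mmap sD q h) = p h.
  rewrite rmorph_mmap [RHS]rmorph_mmapE; apply: eq_mmap => // e /=.
  by rewrite gkap /= mmapC.
case: alt => [[spec _]|[d [dP dkap /hasP[x xds dx]]]]; last first.
  exfalso; suff d0 a : d (q (f a)) = 0.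
    move/negP: dx; apply; rewrite -(nth_index 0 xds).
    have lt : (index x ds < r)%N by rewrite -ds_size index_mem.
    by rewrite -(qf (Ordinal lt)) d0.
  pose J := \matrix_(i, a) p (hs i)^`M(f a).
  pose v := \col_a d (q (f a)).
  have JU : J \in unitmx.
    rewrite unitmxE unitfE; apply/eqP => J0; apply: jacobian_nonvanishing.
    apply/pP; rewrite -J0 -det_map_mx; congr (\det _).
    by apply/matrixP => i b; rewrite !mxE.
  (* The chain rule applied to the equations [hs i]: the free coordinates contribute nothing, as [d]
     kills the image of [kap]. *)
  have Jv : J *m v = 0.
    apply/colP => i; rewrite !mxE.
    have : d (mmap sD q (hs i)) = 0.
      case: (dP) => _ _; apply; rewrite gev; apply/pP; exact: vanishing_I.
    rewrite (der_mmap _ _ dP) => [|e]; last by rewrite /= dkap.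
    rewrite (bigID (mem (codom f))) /= [X in _ + X]big1 ?addr0; last first.
      move=> j jf; rewrite qfree ?dkap ?mulr0 // => b; apply: contraNneq jf => <-.
      exact: codom_f.
    rewrite -big_uniq; last by rewrite codomE map_inj_uniq ?enum_uniq.
    rewrite codomE big_map big_enum /= => e0; rewrite -[RHS]e0.
    by apply: eq_bigr => b _; rewrite !mxE gev.
  have : v = 0 by rewrite -(mulKmx JU v) Jv mulmx0.
  by move/colP/(_ a); rewrite !mxE.
(* Nothing has to stay nonzero at the end of the tower; only the condition [u] on the free values
   matters. *)
have [|u fu uP] := spec 1; first by rewrite rmorph1 oner_eq0.
have free0 : free_part u != 0 by apply: contraNneq fu => /= ->; rewrite rmorph0.
have [|b bP] := @mpoly_nonvanishing S N (mmap (@mpolyC N S \o sep_incl S) (fun i => 'X_i) (free_part u)) (sep_closure_infinite S).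
  by apply: contraNneq free0 => /map_mpoly_eq0 ->.
pose phi : {rmorphism {mpoly F[N]} -> S} := mmap (sep_incl S) b \o free_part.
have [||psi [psik kpsi _]] := uP S phi (@sep_closed _ S).
- move=> a /= /pP/vanishing_free ->; exact: rmorph0.
- move: bP; rewrite rmorph_mmap /=; set A := mmap _ _ _; set B := mmap _ _ _.
  suff -> : A = B by [].
  apply: eq_mmap => [e|j] /=; first by rewrite mmapC.
  by rewrite mmapX mmap1U.
exists (psi \o q) => h Ih.
have <- : psi (mmap sD q h) = mmap (sep_incl S) (psi \o q) h.
  rewrite rmorph_mmap; apply: eq_mmap => // e /=.
  by rewrite psik /= !mmapC.
by apply: kpsi; rewrite gev; apply/pP/vanishing_I.
Qed.

End Generic.
End Curve.
End GenericDirection.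

Lemma smooth_zeros_sep_point (S : separable_closure F) :
  exists q : 'I_N -> S, forall h, I h -> mmap (sep_incl S) q h = 0.
Proof.
have [r [M [f [hs [finj fU gradI hsI hsM]]]]] := gradient_basis.
(* [E] is the polynomial ring over [K] and [V] its variables. Translating by [- x0] undoes the
   substitution, which is therefore injective. *)
have Vindep (h : {mpoly F[N]}) :
    mmap (@mpolyC N K \o s) (fun j => (x0 j)%:MP + 'X_j) h = 0 -> h = 0.
  move=> h0; apply: (@map_mpoly_eq0 _ _ _ s).
  have := congr1 (mmap (@mpolyC N K) (fun j => 'X_j - (x0 j)%:MP)) h0.
  rewrite mmap0 => <-; rewrite rmorph_mmap; apply: eq_mmap => [e|j] /=; first by rewrite mmapC.
  by rewrite mmapD mmapC mmapX mmap1U addrC subrK.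
have [Y [YP Ycong]] := curve_exists (@mpolyC N K) (fun j => 'X_j) fU gradI.
exact: (generic_point Vindep finj fU hsI hsM YP Ycong).
Qed.
End SeparablePoint.

(** * Galois theory of separable closures *)

HB.instance Definition _ (K : fieldType) (S : separable_closure K) :=
  gen_eqMixin (galois_aut S).

Section GaloisBasics.
Variables (K : fieldType) (S : separable_closure K).

Lemma conjugates_exist (x : S) : exists (p : {poly K}) (rs : seq S),
  [/\ forall z, root (map_poly (sep_incl S) p) z = (z \in rs),
      p != 0, uniq rs, x \in rs &
      exists2 c, c != 0 & map_poly (sep_incl S) p = c *: \prod_(z <- rs) ('X - z%:P)].
Proof.
have [p [sp rp]] := sep_algebraic x.
have sS : separable_poly (map_poly (sep_incl S) p) by rewrite separable_map.
have [rs pE] := sep_split sS.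
have c0 : lead_coef (map_poly (sep_incl S) p) != 0.
  by rewrite lead_coef_eq0 separable_poly_neq0.
have rE z : root (map_poly (sep_incl S) p) z = (z \in rs).
  by rewrite pE rootZ // root_prod_XsubC.
exists p, rs; split=> //; first exact: separable_poly_neq0 sp.
- rewrite -separable_prod_XsubC; apply: dvdp_separable sS.
  by rewrite pE dvdpZr.
- by rewrite -rE.
by exists (lead_coef (map_poly (sep_incl S) p)).
Qed.

Lemma emb_conjugate (L : fieldType) (e e' : {rmorphism S -> L}) (x : S) :
  (forall c, e (sep_incl S c) = e' (sep_incl S c)) -> exists y, e y = e' x.
Proof.
move=> ee'; have [p [rs [rE _ _ xrs [c c0 pE]]]] := conjugates_exist x.
have : root (map_poly e' (map_poly (sep_incl S) p)) (e' x) by rewrite fmorph_root rE.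
have -> : map_poly e' (map_poly (sep_incl S) p) = map_poly e (map_poly (sep_incl S) p).
  by rewrite -!map_poly_comp; apply: eq_map_poly => a /=; rewrite ee'.
rewrite pE map_polyZ rootZ ?fmorph_eq0 // rmorph_prod /=.
under eq_bigr do rewrite rmorphB /= map_polyX map_polyC /=.
rewrite -(big_map e xpredT (fun z => 'X - z%:P)) root_prod_XsubC.
by case/mapP=> y _ ->; exists y.
Qed.

(** An injective endomorphism over [K] permutes the finite set of roots of each polynomial over [K],
    hence is onto. *)
Lemma endo_aut (e : {rmorphism S -> S}) : (forall c, e (sep_incl S c) = sep_incl S c) ->
  exists t : galois_aut S, forall x, t x = e x.
Proof.
move=> eK; suff eb : bijective e by exists (GaloisAut eb eK).
have eI : injective e by exact: fmorph_inj.
have surj y : exists x, e x = y.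
  have [p [rs [rE _ rsu yrs _]]] := conjugates_exist y.
  have sub : {subset map e rs <= rs}.
    move=> _ /mapP[z zrs ->]; rewrite -rE.
    have : root (map_poly e (map_poly (sep_incl S) p)) (e z) by rewrite fmorph_root rE.
    by rewrite -map_poly_comp (eq_map_poly (g := sep_incl S)).
  have [_ rsE] := uniq_min_size (etrans (map_inj_uniq eI rs) rsu) sub
    (eq_leq (esym (size_map _ _))).
  by move: yrs; rewrite -rsE => /mapP[x _ ->]; exists x.
have [g gK] := choice surj.
by exists g => // x; apply: eI; rewrite gK.
Qed.

Lemma gal_id_exists : exists t : galois_aut S, forall x, t x = x.
Proof. by have [t tE] := endo_aut (e := idfun) (fun=> erefl); exists t. Qed.

(** By normality each [e' x] lies in the image of [e], and [e^-1 e'] is an endomorphism of [S] over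
    [K]. *)
Lemma emb_differ (L : fieldType) (e e' : {rmorphism S -> L}) :
  (forall c, e (sep_incl S c) = e' (sep_incl S c)) ->
  exists t : galois_aut S, forall x, e' x = e (t x).
Proof.
move=> ee'; have [f fE] := choice (fun x => emb_conjugate x ee').
have eI : injective e by exact: fmorph_inj.
have fa : zmod_morphism f by move=> x y; apply: eI; rewrite rmorphB !fE rmorphB.
have fm : monoid_morphism f.
  by split=> [|x y]; apply: eI; rewrite ?rmorphM !fE ?rmorph1 ?rmorphM.
pose fA := GRing.isZmodMorphism.Build S S f fa.
pose fM := GRing.isMonoidMorphism.Build S S f fm.
pose fR : {rmorphism S -> S} := HB.pack f fA fM.
have [|t tE] := @endo_aut fR; first by move=> c; apply: eI; rewrite fE ee'.
by exists t => x; rewrite tE fE.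
Qed.

(** The fixed field of the open subgroup fixing [l]; on it an automorphism is determined by its
    values on [l]. *)
Definition fixed_by_agree (l : seq S) (x : S) :=
  forall t : galois_aut S, {in l, forall y, t y = y} -> t x = x.

Lemma agree_fixed l x (s t : galois_aut S) : fixed_by_agree l x ->
  {in l, forall y, s y = t y} -> s x = t x.
Proof.
move=> xl st; have [t' [tK t'K]] := gal_inv_exists t.
have : gal_mul t' s x = x by apply: xl => y yl; rewrite /= st.
by move=> /= /(congr1 t); rewrite t'K.
Qed.

(** Independence of characters on the fixed field attached to [l]. Subtracting [s0 y] times the
    relation at [x] from the relation at [y x] removes the term of [s0]; [y] in [l] is chosen to
    separate [s] from [s0]. *)
Lemma dedekind (l : seq S) (ss : seq (galois_aut S)) (a : galois_aut S -> S) :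
  uniq [seq map s l | s : galois_aut S <- ss] ->
  (forall x, fixed_by_agree l x -> \sum_(s <- ss) a s * s x = 0) ->
  {in ss, forall s, a s = 0}.
Proof.
elim: ss a => // s0 ss IHss a /= /andP[s0ss ssu] rel.
have a0 : {in ss, forall s, a s = 0}.
  move=> s sss; have [y yl sy] : exists2 y, y \in l & s y != s0 y.
    apply: contrapT => h; move/negP: s0ss; apply; apply/mapP; exists s => //.
    apply/eq_in_map => y yl; apply/eqP; rewrite eq_sym; apply: contra_notT h => sy.
    by exists y.
  suff /(IHss _ ssu)/(_ s sss)/eqP : forall x, fixed_by_agree l x ->
      \sum_(s <- ss) (a s * (s y - s0 y)) * s x = 0.
    by rewrite mulf_eq0 subr_eq0 (negbTE sy) orbF => /eqP.
  move=> x xl.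
  have e1 := rel x xl; have e2 : \sum_(s <- s0 :: ss) a s * s (y * x) = 0.
    by apply: rel => t tl; rewrite rmorphM xl // tl.
  move: e1 e2; rewrite !big_cons rmorphM => /eqP; rewrite addr_eq0 => /eqP e1.
  rewrite mulrCA e1 mulrN addrC => /eqP; rewrite subr_eq0 mulr_sumr => /eqP e2.
  transitivity (\sum_(j <- ss) a j * j (y * x) - \sum_(i <- ss) s0 y * (a i * i x)).
    rewrite -sumrB; apply: eq_bigr => i _.
    by rewrite mulrBr mulrBl rmorphM !mulrA [s0 y * _]mulrC.
  by rewrite e2 subrr.
move=> s; rewrite inE => /orP[/eqP ->|]; last exact: a0.
have := rel 1 (fun t _ => rmorph1 t); rewrite big_cons rmorph1 mulr1 big_seq big1 ?addr0 //.
by move=> t /a0 ->; rewrite mul0r.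
Qed.

Lemma finite_restrictions (l : seq S) : exists ss : seq (galois_aut S),
  uniq [seq map s l | s : galois_aut S <- ss] /\
  forall t : galois_aut S, map t l \in [seq map s l | s : galois_aut S <- ss].
Proof.
have [D DP] : exists D : seq (seq S), forall t : galois_aut S, map t l \in D.
  elim: l => [|x l [D DP]]; first by exists [:: [::]].
  have [p [rs [rE _ _ xrs _]]] := conjugates_exist x.
  exists [seq y :: d | y <- rs, d <- D] => t /=; apply/allpairsP.
  exists (t x, map t l); split=> //=; rewrite -rE.
  have : root (map_poly t (map_poly (sep_incl S) p)) (t x) by rewrite fmorph_root rE.
  by rewrite -map_poly_comp (eq_map_poly (g := sep_incl S)) // => c /=; rewrite gal_fix.
suff [ss [ssu ssD]] : exists ss : seq (galois_aut S),
    uniq [seq map s l | s : galois_aut S <- ss] /\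
    forall t : galois_aut S, map t l \in D -> map t l \in [seq map s l | s : galois_aut S <- ss].
  by exists ss; split=> // t; apply: ssD.
elim: D {DP} => [|d D [ss [ssu ssD]]]; first by exists [::].
have [[t td]|nt] := pselect (exists t : galois_aut S, map t l = d); last first.
  exists ss; split=> // t; rewrite inE => /orP[/eqP td|/ssD //].
  by case: nt; exists t.
have [din|dnin] := boolP (d \in [seq map s l | s : galois_aut S <- ss]).
  by exists ss; split=> // t'; rewrite inE => /orP[/eqP ->|/ssD].
exists (t :: ss); split=> [|t']; first by rewrite /= td dnin.
by rewrite !inE td => /orP[-> //|/ssD ->]; rewrite orbT.
Qed.

End GaloisBasics.

Section HilbertNinety.
Variables (K : fieldType) (S : separable_closure K) (n : nat).
Variable c : galois_aut S -> 'M[S]_n.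
Hypothesis cU : forall s, c s \in unitmx.
Hypothesis cM : forall s t, c (gal_mul s t) = c s *m map_mx s (c t).
Hypothesis cC : krull_continuous c.

(** The averages of [c s * s(v)] are invariant under the twisted action. They span: a linear form
    vanishing on all of them would give a linear relation between distinct restrictions, against
    [dedekind]. *)
Lemma hilbert90 : exists2 p, p \in unitmx & forall s, c s *m map_mx s p = p.
Proof.
have [t1 t1E] := gal_id_exists S.
have c1 : c t1 = 1%:M.
  have := cM t1 t1; have -> : gal_mul t1 t1 = t1 by apply: galois_aut_eq => x /=; rewrite !t1E.
  have -> : map_mx t1 (c t1) = c t1 by apply/matrixP => i j; rewrite mxE t1E.
  by move/(congr1 (mulmx (invmx (c t1)))); rewrite mulVmx // mulmxA mulVmx // mul1mx.
(* Continuity at the identity: [c] is trivial on automorphisms fixing [l], hence [c s] depends only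
   on the restriction of [s] to [l]. *)
have [l lP] := cC t1.
have c_agree (s t : galois_aut S) : {in l, forall y, s y = t y} -> c s = c t.
  move=> st; have [t' [tK t'K]] := gal_inv_exists t.
  have e : s = gal_mul t (gal_mul t' s) by apply: galois_aut_eq => x /=; rewrite t'K.
  rewrite e cM (lP (gal_mul t' s)) ?c1 ?map_mx1 ?mulmx1 // => y yl /=.
  by rewrite st // tK t1E.
have [ss [ssu ssl]] := finite_restrictions l.
pose U (u : 'rV[S]_n) := forall t, c t *m map_mx t u^T = u^T.
pose G (v : 'cV[S]_n) s := c s *m map_mx (s : galois_aut S) v.
have avgU (v : 'cV[S]_n) : (forall i, fixed_by_agree l (v i 0)) -> U (\sum_(s <- ss) G v s)^T.
  move=> vl t; rewrite trmxK.
  have Gagree (s s' : galois_aut S) : map s l = map s' l -> G v s = G v s'.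
    move/eq_in_map => ss'; rewrite /G (c_agree s s' ss'); congr (_ *m _).
    by apply/matrixP => i j; rewrite !mxE (ord1 j); apply: agree_fixed (vl i) _.
  (* The products [gal_mul t s] need not belong to [ss]. Writing the summand as a function of the
     restriction alone allows the sum to be reindexed. *)
  pose G' d := if pselect (exists s : galois_aut S, map s l = d) is left e
    then G v (projT1 (cid e)) else 0.
  have G'E (s : galois_aut S) : G v s = G' (map s l).
    rewrite /G'; case: pselect => [e|[]]; last by exists s.
    by apply: Gagree; case: cid.
  transitivity (\sum_(s <- ss) G v (gal_mul t s)).
    rewrite raddf_sum mulmx_sumr; apply: eq_bigr => s _.
    by rewrite /G /= map_mxM mulmxA -cM -map_mx_comp.
  under eq_bigr do rewrite G'E; under [RHS]eq_bigr do rewrite G'E.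
  rewrite -(big_map (fun s => map (gal_mul t s) l) xpredT G').
  rewrite -(big_map (fun s : galois_aut S => map s l) xpredT G').
  apply/perm_big/uniq_perm => //.
    have -> : [seq map (gal_mul t s) l | s <- ss] = map (map t) [seq map s l | s : galois_aut S <- ss].
      by rewrite -map_comp; apply: eq_map => s /=; rewrite -map_comp.
    by rewrite map_inj_uniq //; apply: inj_map; exact: fmorph_inj.
  have tu : uniq [seq map (gal_mul t s) l | s <- ss].
    have -> : [seq map (gal_mul t s) l | s <- ss] = map (map t) [seq map s l | s : galois_aut S <- ss].
      by rewrite -map_comp; apply: eq_map => s /=; rewrite -map_comp.
    by rewrite map_inj_uniq //; apply: inj_map; exact: fmorph_inj.
  have sub : {subset [seq map (gal_mul t s) l | s <- ss] <=
      [seq map s l | s : galois_aut S <- ss]} by move=> _ /mapP[s _ ->].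
  have [_ e] := uniq_min_size tu sub (eq_leq (etrans (size_map _ _) (esym (size_map _ _)))).
  by move=> d; rewrite e.
have [r [M [MU Mf Mmax]]] := row_family_basis U.
have Mfull : row_full M.
  rewrite -cokermx_eq0; apply/eqP/matrixP => i j; rewrite [RHS]mxE.
  pose lam := (col j (cokermx M))^T.
  suff lam0 : lam = 0 by have /rowP/(_ i) := lam0; rewrite !mxE.
  have lamU u : U u -> lam *m u^T = 0.
    move=> /Mmax/submxP[D ->]; rewrite /lam -trmx_mul colE mulmxA -(mulmxA D).
    by rewrite mulmx_coker mulmx0 mul0mx trmx0.
  have lc : {in ss, forall s, lam *m c s = 0}.
    move=> s sss; apply/rowP => k; rewrite [RHS]mxE.
    apply: (dedekind (a := fun s => (lam *m c s) 0 k) ssu _ sss) => x xl.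
    have /avgU/lamU : forall i, fixed_by_agree l ((x *: delta_mx k 0 : 'cV[S]_n) i 0).
      move=> i'; rewrite !mxE; case: (_ && _) => /=; rewrite ?mulr1 ?mulr0 //.
      by move=> t _; rewrite rmorph0.
    rewrite trmxK mulmx_sumr => /matrixP/(_ 0 0); rewrite summxE mxE => e.
    rewrite -[RHS]e; apply: eq_bigr => s' _.
    rewrite /G mulmxA map_mxZ map_delta_mx -scalemxAr -colE !mxE mulrC; congr (_ * _).
  have := ssl t1 => /mapP[s sss _].
  by rewrite -(mulmxK (cU s) lam) lc // mul0mx.
have rn : r = n by rewrite -(eqP Mf) (eqP Mfull).
subst r; exists M^T; first by rewrite unitmx_tr -row_free_unit.
move=> s; apply/matrixP => i j.
have /matrixP/(_ i 0) := MU j s; rewrite tr_row !mxE => e.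
by rewrite -e; apply: eq_bigr => k _; rewrite !mxE.
Qed.

End HilbertNinety.

(** * Extension of homomorphisms and the fixed field of the Galois group *)

Section SubringType.
Variables (R : comNzRingType) (P : {pred R}) (Pc : subring_closed P).

Definition subring_pred of subring_closed P : {pred R} := P.
HB.instance Definition _ := GRing.isSubringClosed.Build R (subring_pred Pc) Pc.

Definition subring_type := {x : R | x \in subring_pred Pc}.
HB.instance Definition _ := SubChoice.on subring_type.
HB.instance Definition _ := [SubChoice_isSubComNzRing of subring_type by <:].
End SubringType.

Lemma in_asbool (T : Type) (P : T -> Prop) (x : T) :
  reflect (P x) (x \in [pred x | `[< P x >]]).
Proof. exact: asboolP. Qed.

Section FixedField.
Variables (K : fieldType) (S : separable_closure K).

(* The graph of a K-homomorphism from a subring of S to S.                      *)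
Definition partial_hom (R : set (S * S)) :=
  [/\ subring_closed [pred x | `[< R x >]],
      forall c, R (sep_incl S c, sep_incl S c) & forall b, R (0, b) -> b = 0].

(** With [f] and [g] the two projections of the graph, a separable relation of [a] over [f(A)] is
    specialized along [g]. The element [u] that must survive does so because [f] and [g] have the
    same kernel. *)
Lemma partial_hom_extend (R : set (S * S)) (a : S) : partial_hom R ->
  exists R', [/\ partial_hom R', (R `<=` R')%classic & exists b, R' (a, b)].
Proof.
move=> [Rc RK R0].
pose A : comNzRingType := subring_type Rc.
pose f : {rmorphism A -> S} := (fst : {rmorphism (S * S)%type -> S}) \o (val : {rmorphism A -> _}).
pose g : {rmorphism A -> S} := (snd : {rmorphism (S * S)%type -> S}) \o (val : {rmorphism A -> _}).
have inA x : R x -> exists y : A, val y = x.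
  by move=> Rx; have xA : x \in subring_pred Rc by [apply/asboolP]; exists (Sub x xA); rewrite SubK.
have AR (y : A) : R (f y, g y).
  by case: y => -[y1 y2] yP; apply/asboolP; exact: yP.
have kerg y : f y = 0 -> g y = 0 by move=> fy; apply: R0; rewrite -fy; exact: AR.
have [cA cAP] : exists cA : K -> A, forall c, f (cA c) = sep_incl S c /\ g (cA c) = sep_incl S c.
  have [cA cAP] := choice (fun c => inA _ (RK c)).
  by exists cA => c; rewrite /f /g /= cAP.
have cAp (h : {rmorphism A -> S}) (p : {poly K}) : (forall c, h (cA c) = sep_incl S c) ->
    map_poly h (\poly_(i < size p) cA p`_i) = map_poly (sep_incl S) p.
  move=> hc; apply/polyP => i; rewrite !coef_map coef_poly.
  case: ltnP => [_|le]; first exact: hc.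
  by rewrite [in RHS]nth_default //; exact: (etrans (rmorph0 h) (esym (rmorph0 (sep_incl S)))).
(* A nonzero algebraic [f y] is a root of some [q] over [K] with nonzero constant term, obtained by
   dividing out powers of ['X]. Applying [g] to this relation with [g y = 0] would make that term
   vanish. *)
have injg y : g y = 0 -> f y = 0.
  move=> gy; apply/eqP; apply: contraT => fy0.
  have [p [sp rp]] := sep_algebraic (f y).
  have [m [q qP pE]] := multiplicity_XsubC p 0.
  move: qP; rewrite separable_poly_neq0 //= => q0.
  have : (map_poly (sep_incl S) q).[f y] = 0.
    move: rp; rewrite pE rootE rmorphM rmorphXn rmorphB /= map_polyX map_polyC /= rmorph0.
    rewrite subr0 hornerM hornerXn mulf_eq0 expf_eq0 (negbTE fy0) andbF orbF.
    by move/eqP.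
  rewrite -(cAp f) => [|c]; last by case: (cAP c).
  rewrite horner_map => /kerg; rewrite -horner_map gy (cAp g) => [|c]; last by case: (cAP c).
  move/eqP; rewrite -[X in _.[X]](rmorph0 (sep_incl S)) horner_map fmorph_eq0.
  by move=> qe; move: q0; rewrite rootE qe.
have sepa : sep_over f a.
  have [p [sp rp]] := sep_algebraic a.
  exists (\poly_(i < size p) cA p`_i); rewrite !evalxE -deriv_map.
  rewrite (cAp f) => [|c]; last by case: (cAP c).
  split; first exact/eqP.
  move: sp; rewrite -(separable_map (sep_incl S)) separable_poly.unlock => sp.
  exact: coprimep_root sp rp.
have [|u fu uP] := sep_specialize (V := 1) sepa; first by rewrite rmorph1 oner_eq0.
have gu : g u != 0 by apply: contraNneq fu => /injg ->.
have [w [wP _]] := uP S g (@sep_closed _ S) kerg gu.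
pose R' := [set x | exists Q : {poly A}, x = (evalx f a Q, evalx g w Q)]%classic.
exists R'; split; last by exists w, 'X; rewrite !evalxX.
- split.
  + split=> [|x y|x y].
    * by apply/in_asbool; exists 1; rewrite !rmorph1.
    * move=> /in_asbool[Q ->] /in_asbool[Q' ->]; apply/in_asbool; exists (Q - Q').
      by rewrite !rmorphB.
    * move=> /in_asbool[Q ->] /in_asbool[Q' ->]; apply/in_asbool; exists (Q * Q').
      by rewrite !rmorphM.
  + by move=> c; exists (cA c)%:P; rewrite !evalxC; case: (cAP c) => -> ->.
  + by move=> b [Q [Q0 ->]]; apply: wP.
move=> x /inA[y yx]; exists y%:P; rewrite !evalxC -yx /f /g /=.
by case: (val y).
Qed.

Lemma partial_hom_total (R0 : set (S * S)) : partial_hom R0 ->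
  exists e : {rmorphism S -> S}, (forall c, e (sep_incl S c) = sep_incl S c) /\
    forall x y, R0 (x, y) -> e x = y.
Proof.
move=> R0P.
pose P (R : set (S * S)) := R = set0 \/ (partial_hom R /\ (R0 `<=` R)%classic).
have [F FP Ftot|R [RP Rmax]] := @Zorn_bigcup _ P.
  have [[X [FX X0]]|nX] := pselect (exists X, F X /\ X <> set0); last first.
    left; apply/seteqP; split=> // x [X FX Xx]; apply: nX; exists X; split=> // X0.
    by move: Xx; rewrite X0.
  right; have FP' Y : F Y -> Y <> set0 -> partial_hom Y /\ (R0 `<=` Y)%classic.
    by move=> /FP[->|].
  have [[_ XK _] R0X] := FP' X FX X0.
  have chain Y Z : F Y -> F Z -> exists W, [/\ F W, (Y `<=` W)%classic & (Z `<=` W)%classic].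
    by move=> FY FZ; case: (Ftot Y Z FY FZ) => h; [exists Z | exists Y]; split=> //; apply: subset_refl.
  have nonempty (Y : set (S * S)) (y : (S * S)%type) : Y y -> Y <> set0 by move=> + Y0; rewrite Y0.
  have FXs x : X x -> (\bigcup_(Y in F) Y)%classic x by move=> Xx; exists X.
  split; last by move=> x /R0X; exact: FXs.
  split=> [|c|b [Y FY Yb]]; last 2 first.
  - exact/FXs/XK.
  - by have [[_ _ h] _] := FP' Y FY (nonempty _ _ Yb); apply: h.
  have two x y : (\bigcup_(Y in F) Y)%classic x -> (\bigcup_(Y in F) Y)%classic y ->
      exists W, [/\ F W, partial_hom W, W x & W y].
    move=> [Y FY Yx] [Z FZ Zy]; have [W [FW YW ZW]] := chain Y Z FY FZ.
    by exists W; split=> //; [apply: (FP' W FW (nonempty _ _ (YW _ Yx))).1 | exact: YW | exact: ZW].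
  split=> [|x y|x y].
  - apply/in_asbool/FXs; have := XK 1; by rewrite rmorph1.
  - move=> /in_asbool ux /in_asbool uy; have [W [FW [[_ WB _] _ _] Wx Wy]] := two x y ux uy.
    apply/in_asbool; exists W => //; apply/in_asbool.
    by apply: WB; apply/in_asbool.
  - move=> /in_asbool ux /in_asbool uy; have [W [FW [[_ _ WM] _ _] Wx Wy]] := two x y ux uy.
    apply/in_asbool; exists W => //; apply/in_asbool.
    by apply: WM; apply/in_asbool.
have {}RP : partial_hom R /\ (R0 `<=` R)%classic.
  case: RP => // Re; exfalso; apply: (Rmax R0); last by right; split.
  rewrite Re; split=> // h; case: R0P => _ R0K _.
  by have := h _ (R0K 0).
case: RP => RP R0R; have [[Rc Rs RM] RK Rf] := RP.
have {}Rs x y : R x -> R y -> R (x - y).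
  by move=> /in_asbool Rx /in_asbool Ry; apply/in_asbool/Rs.
have {}RM x y : R x -> R y -> R (x * y).
  by move=> /in_asbool Rx /in_asbool Ry; apply/in_asbool/RM.
have total a : exists b, R (a, b).
  have [R' [R'P RR' [b R'ab]]] := partial_hom_extend a RP.
  exists b; apply: contrapT => nab; apply: (Rmax R'); last first.
    by right; split=> // x /R0R/RR'.
  by split=> // /(_ _ R'ab).
have [e eR] := choice total.
have eE x y : R (x, y) -> e x = y.
  move=> xy; apply/eqP; rewrite -subr_eq0; apply/eqP/Rf.
  by rewrite -(subrr x); exact: (Rs _ _ (eR x) xy).
have ea : zmod_morphism e by move=> x y; apply: eE; exact: (Rs _ _ (eR x) (eR y)).
have em : monoid_morphism e.
  split=> [|x y]; last by apply: eE; exact: (RM _ _ (eR x) (eR y)).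
  by apply: eE; have := RK 1; rewrite rmorph1.
pose eA := GRing.isZmodMorphism.Build S S e ea.
pose eM := GRing.isMonoidMorphism.Build S S e em.
exists (HB.pack e eA eM : {rmorphism S -> S}); split=> [c|x y /R0R]; last exact: eE.
exact/eE/RK.
Qed.

(** Otherwise the minimal polynomial of [x], which is separable, has a second root [w], and the map
    sending [x] to [w] extends to an automorphism that moves [x]. *)
Lemma galois_fixed (x : S) : (forall s : galois_aut S, s x = x) ->
  exists c, sep_incl S c = x.
Proof.
move=> xfix; apply: contrapT => nx.
have [p0 [sp0 rp0]] := sep_algebraic x.
pose good n := `[< exists p : {poly K},
  [/\ p != 0, root (map_poly (sep_incl S) p) x & size p = n] >].
have gex : exists n, good n.
  by exists (size p0); apply/asboolP; exists p0; rewrite separable_poly_neq0.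
have [n /asboolP[p [p_neq0 rp pn]] nmin] := ex_minnP gex.
have pmin (q : {poly K}) : root (map_poly (sep_incl S) q) x -> p %| q.
  move=> rq; rewrite /dvdp; apply: contraT => qp0.
  have : (n <= size (q %% p)%R)%N.
    apply: nmin; apply/asboolP; exists (q %% p); split=> //.
    have := rq; rewrite {1}(divp_eq q p) !rootE rmorphD rmorphM /= hornerD hornerM.
    by rewrite (eqP rp) mulr0 add0r.
  by rewrite -pn leqNgt ltn_modp p_neq0.
have sp : separable_poly (map_poly (sep_incl S) p).
  by rewrite separable_map; apply: dvdp_separable sp0; exact: pmin.
have [q pE] := factor_theorem _ _ rp.
move: (sp); rewrite pE separable_mul => /and3P[sq _ cq].
have [|w rw] := sep_closed sq.
  rewrite ltnNge; apply/negP => q1; apply: nx.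
  have p2 : (size p <= 2)%N.
    rewrite -(size_map_poly (sep_incl S)) pE size_Mmonic ?monicXsubC //; last first.
      by apply: contraTneq sp => q0; rewrite pE q0 mul0r; apply/negP => /separable_poly_neq0; rewrite eqxx.
    by rewrite size_XsubC addn2.
  have pX : p = p`_1 *: 'X + (p`_0)%:P.
    apply/polyP => -[|[|i]]; rewrite coefD coefZ coefX coefC /= ?mulr0 ?mulr1 ?add0r ?addr0 //.
    by rewrite nth_default // (leq_trans p2).
  have rx : sep_incl S p`_1 * x + sep_incl S p`_0 = 0.
    move: rp; rewrite {1}pX rootE rmorphD /= map_polyZ map_polyX map_polyC /= !hornerE.
    by move/eqP.
  exists (- p`_0 / p`_1).
  have p1 : p`_1 != 0.
    apply: contraNneq p_neq0 => p1; rewrite pX p1 scale0r add0r.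
    by move: rx; rewrite p1 rmorph0 mul0r add0r => /eqP; rewrite fmorph_eq0 => /eqP ->.
  rewrite rmorphM fmorphV rmorphN; apply: (mulIf (_ : sep_incl S p`_1 != 0)).
    by rewrite fmorph_eq0.
  rewrite divfK ?fmorph_eq0 // mulrC; apply/eqP; rewrite eq_sym -addr_eq0; exact/eqP.
have wx : w <> x.
  move=> wx; move: cq; rewrite coprimep_XsubC; rewrite -wx => /negP; exact.
apply: wx.
pose R0 := [set y | exists Q : {poly K},
  y = ((map_poly (sep_incl S) Q).[x], (map_poly (sep_incl S) Q).[w])]%classic.
have [|e [eK eR0]] := @partial_hom_total R0.
  split=> [|c|b [Q [Q0 ->]]].
  - split=> [|y z|y z].
    + by apply/in_asbool; exists 1; rewrite !rmorph1 !hornerC.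
    + move=> /in_asbool[Q ->] /in_asbool[Q' ->]; apply/in_asbool; exists (Q - Q').
      by rewrite !rmorphB /= !hornerD !hornerN.
    + move=> /in_asbool[Q ->] /in_asbool[Q' ->]; apply/in_asbool; exists (Q * Q').
      by rewrite !rmorphM /= !hornerM.
  - by exists c%:P; rewrite !map_polyC !hornerC.
  have /dvdpP[h ->] : p %| Q by apply: pmin; rewrite rootE -Q0.
  by rewrite rmorphM /= pE !hornerM (eqP rw) mul0r mulr0.
have [t tE] := endo_aut eK.
have <- : e x = w by apply: eR0; exists 'X; rewrite !map_polyX !hornerX.
by rewrite -tE.
Qed.

End FixedField.

(** * A faithful representation *)

Section Independence.
Variables (F : fieldType) (V : pzRingType) (s : {rmorphism F -> V}).

Definition lincomb (c : nat -> F) (bs : seq V) := \sum_(i < size bs) s (c i) * bs`_i.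

Definition indep (bs : seq V) :=
  forall c, lincomb c bs = 0 -> forall i, (i < size bs)%N -> c i = 0.

Lemma lincomb_cons c b bs : lincomb c (b :: bs) = s (c 0%N) * b + lincomb (c \o S) bs.
Proof. by rewrite /lincomb big_ord_recl. Qed.

Lemma indep_cons b bs : indep bs -> ~ (exists c, b = lincomb c bs) -> indep (b :: bs).
Proof.
move=> ib nb c; rewrite lincomb_cons => e.
have c0 : c 0%N = 0.
  apply: contra_notP nb => /eqP c0; exists (fun i => - (c 0%N)^-1 * c i.+1).
  have : s (c 0%N)^-1 * (s (c 0%N) * b + lincomb (c \o S) bs) = 0 by rewrite e mulr0.
  rewrite mulrDr mulrA -rmorphM mulVf // rmorph1 mul1r => /eqP.
  rewrite addr_eq0 => /eqP ->; rewrite /lincomb mulr_sumr -sumrN.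
  by apply: eq_bigr => i _; rewrite mulrA -rmorphM -mulNr -rmorphN mulNr.
by move: e; rewrite c0 rmorph0 mul0r add0r => /ib h [|i] //; exact: h.
Qed.

Lemma indep_extend bs (l : seq V) : indep bs -> exists bs',
  [/\ indep (bs' ++ bs), {subset bs' <= l} &
      forall b, b \in l -> exists c, b = lincomb c (bs' ++ bs)].
Proof.
move=> ibs; elim: l => [|x l [bs' [ib sub span]]]; first by exists [::].
have [xs|nxs] := pselect (exists c, x = lincomb c (bs' ++ bs)).
  exists bs'; split=> // [b /sub bl|b]; rewrite inE; first by rewrite bl orbT.
  by move=> /orP[/eqP ->|/span].
exists (x :: bs'); split; first exact: indep_cons.
  by move=> b; rewrite !inE => /orP[->//|/sub ->]; rewrite orbT.
move=> b; rewrite inE => /orP[/eqP ->|/span[c ->]].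
  exists (fun i => (i == 0%N)%:R); rewrite cat_cons lincomb_cons rmorph1 mul1r.
  by rewrite /lincomb big1 ?addr0 // => i _; rewrite /= rmorph0 mul0r.
exists (fun i => if i is j.+1 then c j else 0).
by rewrite cat_cons lincomb_cons rmorph0 mul0r add0r.
Qed.

Lemma indep_nil : indep [::].
Proof. by []. Qed.

Lemma indep_basis (l : seq V) : exists bs, [/\ indep bs, {subset bs <= l} &
  forall b, b \in l -> exists c, b = lincomb c bs].
Proof. by have [bs] := indep_extend l indep_nil; rewrite cats0; exists bs. Qed.

End Independence.

Lemma mcoeff_sum_scale (B : comNzRingType) (N : nat) (I : Type) (r : seq I)
    (b : I -> B) (h : I -> {mpoly B[N]}) m :
  (\sum_(i <- r) b i *: h i)@_m = \sum_(i <- r) b i * (h i)@_m.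
Proof. rewrite raddf_sum; apply: eq_bigr => i _; exact: mcoeffZ. Qed.

(** * Tensor products of algebras and linear independence in them *)

Section TensorProduct.
Variables (F : fieldType) (B : comNzRingType) (sB : {rmorphism F -> B}).
Variables (A : comPzRingType) (sA : {rmorphism F -> A}).
Variables (N : nat) (p : {rmorphism {mpoly F[N]} -> A}).
Hypothesis pC : forall c, p c%:MP = sA c.
Hypothesis pS : forall a, exists h, p h = a.
Variable eps : {rmorphism A -> F}.
Hypothesis epsC : forall c, eps (sA c) = c.

Let mB : {rmorphism {mpoly F[N]} -> {mpoly B[N]}} :=
  mmap (@mpolyC N B \o sB) (fun i => 'X_i).

Lemma mB_coef h m : (mB h)@_m = sB h@_m.
Proof. exact: mcoeff_map_mpoly. Qed.

Definition ker_gen (l : seq (B * {mpoly F[N]})) := all (fun u => p u.2 == 0) l.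
Definition tensor_sum (l : seq (B * {mpoly F[N]})) := \sum_(u <- l) u.1 *: mB u.2.
(** The extension to [B[X]] of the kernel of [p]; the quotient is [B (x)_F A]. Membership is
    witnessed by a list, on which [tensor_indep] can argue by induction. *)
Definition tensor_ideal (h : {mpoly B[N]}) := exists2 l, ker_gen l & h = tensor_sum l.

Lemma tensor_idealD g h : tensor_ideal g -> tensor_ideal h -> tensor_ideal (g + h).
Proof.
move=> [l lk ->] [l' lk' ->]; exists (l ++ l'); first by rewrite /ker_gen all_cat; apply/andP.
by rewrite /tensor_sum big_cat.
Qed.

Lemma tensor_ideal_proper : proper_ideal_prop tensor_ideal.
Proof.
split; [by exists [::]; rewrite // /tensor_sum big_nil | | exact: tensor_idealD |].
  (* The augmentation [eps], extended to [B], kills the ideal but not 1. *)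
  move=> [l lk e]; have := congr1 (mmap (idfun : {rmorphism B -> B}) (fun i => sB (eps (p 'X_i)))) e.
  rewrite rmorph1 /tensor_sum raddf_sum big_seq big1 => [/eqP|u ul]; first by rewrite oner_eq0.
  rewrite -[LHS]/(mmap _ _ _) mmapZ rmorph_mmap (@eq_mmap _ _ _ _ (sB \o idfun) _ (sB \o (fun i => eps (p 'X_i)))) //.
    rewrite -(rmorph_mmap idfun _ sB).
    have -> : mmap idfun (fun i => eps (p 'X_i)) u.2 = eps (p u.2).
      rewrite [RHS](rmorph_mmapE (eps \o p)); apply: eq_mmap => // c /=.
      by rewrite pC epsC.
    by have /allP/(_ u ul)/eqP -> := lk; rewrite !rmorph0 mulr0.
  by move=> c /=; rewrite mmapC.
  by move=> i /=; rewrite mmapX mmap1U.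
move=> a h; elim/mpoly_ring_ind: a h => [c|i|a b IHa IHb|a b IHa IHb] h hI.
- case: hI => l lk ->; exists [seq (c * u.1, u.2) | u <- l].
    by rewrite /ker_gen all_map; apply: sub_all lk.
  rewrite /tensor_sum mulr_sumr big_map; apply: eq_bigr => u _.
  by rewrite mul_mpolyC scalerA.
- case: hI => l lk ->; exists [seq (u.1, u.2 * 'X_i) | u <- l].
    rewrite /ker_gen all_map; apply: sub_all lk => u /= /eqP u0.
    by rewrite rmorphM u0 mul0r.
  rewrite /tensor_sum mulr_sumr big_map; apply: eq_bigr => u _ /=.
  by rewrite rmorphM /= [mB 'X_i]mmapX mmap1U scalerAl mulrC.
- by rewrite mulrDl; apply: tensor_idealD; [apply: IHa | apply: IHb].
- by rewrite -mulrA; apply/IHa/IHb.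
Qed.

(** Induction on the number of kernel terms. If the coefficient [u.1] lies in the span of [bs], the
    term is absorbed into the [g i]; otherwise [u.1] joins the independent family with coefficient
    [- u.2]. *)
Lemma tensor_indep (bs : seq B) (g : nat -> {mpoly F[N]}) : indep sB bs ->
  tensor_ideal (\sum_(i < size bs) bs`_i *: mB (g i)) ->
  forall i, (i < size bs)%N -> p (g i) = 0.
Proof.
move=> ib [l]; elim: l bs g ib => [|u l IHl] bs g ib /=.
  move=> _ e i ilt; suff -> : g i = 0 by rewrite rmorph0.
  apply/mpolyP => m; rewrite mcoeff0.
  apply: (ib (fun i => (g i)@_m)) => //; have := congr1 (mcoeff m) e.
  rewrite /tensor_sum big_nil mcoeff0 mcoeff_sum_scale => e'.
  rewrite -[RHS]e'; apply: eq_bigr => j _.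
  by rewrite mB_coef mulrC.
move=> /andP[/eqP u0 lk] e.
have {}e : \sum_(i < size bs) bs`_i *: mB (g i) - u.1 *: mB u.2 = tensor_sum l.
  by rewrite e /tensor_sum big_cons addrC addKr.
have [[c uE]|nu] := pselect (exists c, u.1 = lincomb sB c bs).
  suff e' : \sum_(j < size bs) bs`_j *: mB (g j - c j *: u.2) = tensor_sum l.
    move=> i ilt; have := IHl bs (fun i => g i - c i *: u.2) ib lk e' i ilt.
    by rewrite rmorphB /= -mul_mpolyC rmorphM u0 mulr0 subr0.
  rewrite -e uE /lincomb scaler_suml -sumrB; apply: eq_bigr => j _.
  rewrite rmorphB scalerBr; congr (_ - _).
  by rewrite [mB (_ *: _)]mmapZ /= mul_mpolyC scalerA mulrC.
move=> i ilt; apply: (IHl (u.1 :: bs) (fun j => if j is k.+1 then g k else - u.2) _ lk _ i.+1) => //.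
  exact: indep_cons.
by rewrite -e /= big_ord_recl /= addrC rmorphN scalerN.
Qed.

Lemma tensor_exists : exists (T : comNzRingType) (iB : {rmorphism B -> T})
    (iA : {rmorphism A -> T}),
  [/\ forall c, iA (sA c) = iB (sB c),
      forall t, exists l : seq (B * A), t = \sum_(u <- l) iB u.1 * iA u.2,
      forall bs : seq B, indep sB bs -> forall al : nat -> A,
        \sum_(i < size bs) iB bs`_i * iA (al i) = 0 ->
        forall i, (i < size bs)%N -> al i = 0 &
      forall (R : comNzRingType) (f : {rmorphism B -> R}) (g : {rmorphism A -> R}),
        (forall c, f (sB c) = g (sA c)) -> exists h : {rmorphism T -> R},
        (forall b, h (iB b) = f b) /\ (forall a, h (iA a) = g a)].
Proof.
have [T [q [qS qK]]] := quotient_exists tensor_ideal_proper.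
have [|iA iAE] := quotient_lift (q := p) (f := q \o mB) pS.
  move=> g g0; apply/qK; exists [:: (1, g)]; first by rewrite /ker_gen /= g0 eqxx.
  by rewrite /tensor_sum big_seq1 scale1r.
pose iB : {rmorphism B -> T} := q \o @mpolyC N B.
have qZ b h : q (b *: h) = iB b * q h by rewrite -mul_mpolyC rmorphM.
exists T, iB, iA; split.
- by move=> c; rewrite -pC iAE /= [mB _]mmapC.
- move=> t; have [h <-] := qS t.
  exists [seq (h@_m, p 'X_[m]) | m <- msupp h].
  rewrite big_map {1}[h]mpolyE raddf_sum; apply: eq_bigr => m _ /=.
  rewrite -[X in X = _]/(q _) qZ iAE /=; congr (_ * q _).
  by rewrite -[RHS]/(map_mpoly sB _) map_mpolyX.
- move=> bs ib al e i ilt; have [g gE] := choice (fun i => pS (al i)).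
  rewrite -gE; apply: (tensor_indep ib _ ilt); apply/qK.
  rewrite raddf_sum -[RHS]e; apply: eq_bigr => j _.
  by rewrite -[LHS]/(q _) qZ -gE iAE.
move=> R f g fg.
have [h0|h hE] := quotient_lift (q := q) (f := mmap f (fun i => g (p 'X_i))) qS.
  move=> /qK[l lk ->]; rewrite /tensor_sum raddf_sum big_seq big1 // => u ul.
  rewrite -[LHS]/(mmap _ _ _) mmapZ rmorph_mmap.
  have -> : mmap (mmap f (fun i => g (p 'X_i)) \o (@mpolyC N B \o sB))
     (mmap f (fun i => g (p 'X_i)) \o (fun i => 'X_i)) u.2 = g (p u.2).
    rewrite [RHS](rmorph_mmapE (g \o p)); apply: eq_mmap => [c|i] /=.
      by rewrite mmapC pC; exact: fg.
    by rewrite mmapX mmap1U.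
  by have /allP/(_ u ul)/eqP -> := lk; rewrite rmorph0 mulr0.
have hB b : h (iB b) = f b by rewrite -[LHS]/(h (q b%:MP)) hE /= mmapC.
exists h; split=> // a; have [k <-] := pS a; rewrite iAE hE /= rmorph_mmap.
rewrite [RHS](rmorph_mmapE (g \o p)); apply: eq_mmap => [c|i] /=.
  by rewrite mmapC pC; exact: fg.
by rewrite mmapX mmap1U.
Qed.

End TensorProduct.

(** The [be i] are expanded on an independent family of [B]; independence on the left turns the
    relation into relations among the [as']. *)
Lemma tensor_indep_right (F : fieldType) (B : pzRingType) (A T : comPzRingType)
    (sB : {rmorphism F -> B}) (sA : {rmorphism F -> A})
    (iB : {rmorphism B -> T}) (iA : {rmorphism A -> T}) :
  (forall c, iA (sA c) = iB (sB c)) ->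
  (forall bs : seq B, indep sB bs -> forall al : nat -> A,
     \sum_(i < size bs) iB bs`_i * iA (al i) = 0 ->
     forall i, (i < size bs)%N -> al i = 0) ->
  forall as' : seq A, indep sA as' -> forall be : nat -> B,
    \sum_(i < size as') iB (be i) * iA as'`_i = 0 ->
    forall i, (i < size as')%N -> be i = 0.
Proof.
move=> iAB ind as' ias be e.
have [bs [ib _ span]] := indep_basis sB [seq be i | i <- iota 0 (size as')].
have [c cE] : exists c : nat -> nat -> F, forall i, (i < size as')%N -> be i = lincomb sB (c i) bs.
  have h i : exists c, (i < size as')%N -> be i = lincomb sB c bs.
    have [lt|] := boolP (i < size as')%N; last by exists (fun=> 0).
    have [|c cE] := span (be i); first by apply: map_f; rewrite mem_iota.
    by exists c.
  by have [c cE] := choice h; exists c.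
have e2 : \sum_(j < size bs) iB bs`_j * iA (lincomb sA (fun i => c i j) as') = 0.
  rewrite -[RHS]e.
  transitivity (\sum_(i < size as') \sum_(j < size bs) iB (sB (c i j) * bs`_j) * iA as'`_i).
    rewrite exchange_big; apply: eq_bigr => j _.
    rewrite raddf_sum mulr_sumr; apply: eq_bigr => i _.
    transitivity (iB bs`_j * (iA (sA (c i j)) * iA as'`_i)).
      by congr (_ * _); apply: rmorphM.
    by rewrite iAB rmorphM mulrCA mulrA.
  apply: eq_bigr => i _; rewrite cE // -mulr_suml; congr (_ * _).
  by rewrite raddf_sum.
move=> i ilt; rewrite cE // /lincomb big1 // => j _.
have := ind bs ib (fun j => lincomb sA (c^~ j) as') e2 j (ltn_ord j).
by move=> /ias/(_ i ilt) ->; rewrite rmorph0 mul0r.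
Qed.

(** * Comultiplication and finite-dimensional subcomodules *)

Section Representation.
Variables (F : fieldType) (G : group_scheme F).
Local Notation A := (coord G).
Local Notation sA := (calg_str A).

Definition pt (R : comNzRingType) (s : {rmorphism F -> R}) := points G (CAlg s).

Lemma pt_ext (R : comNzRingType) (s : {rmorphism F -> R}) (x y : pt s) : x =1 y -> x = y.
Proof. exact: alghom_eq. Qed.

Definition base_gone : points G (CAlg (idfun : {rmorphism F -> F})) := gone.
Definition eps : {rmorphism A -> F} := base_gone.

Lemma epsC c : eps (sA c) = c.
Proof. exact: (alghom_str base_gone c). Qed.

Lemma goneE (R : comNzRingType) (s : {rmorphism F -> R}) a : (gone : pt s) a = s (eps a).
Proof.
pose h : alghom (CAlg (idfun : {rmorphism F -> F})) (CAlg s) := @AlgHom F (CAlg (idfun : {rmorphism F -> F})) (CAlg s) s (fun=> erefl).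
by rewrite -(gone_natural G h).
Qed.

Variables (N : nat) (p : {rmorphism {mpoly F[N]} -> A}).
Hypothesis pC : forall c, p c%:MP = sA c.
Hypothesis pS : forall a, exists h, p h = a.

(** The coordinate ring is only declared a [comPzRingType]. The counit shows that it is nonzero, and
    the isomorphic copy [Q] can be the left factor of a tensor product. *)
Lemma coord_copy : exists (Q : comNzRingType) (phi : {rmorphism A -> Q}) (psi : {rmorphism Q -> A}),
  cancel phi psi /\ cancel psi phi.
Proof.
have [|Q [q [qS qK]]] := @quotient_exists {mpoly F[N]} (fun h => p h = 0).
  split=> [||a b a0 b0|a b b0]; first exact: rmorph0.
  - rewrite rmorph1 => /(congr1 eps); rewrite rmorph1 rmorph0.
    by move/eqP; rewrite oner_eq0.
  - by rewrite rmorphD a0 b0 addr0.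
  - by rewrite rmorphM b0 mulr0.
have [|phi phiE] := quotient_lift (q := p) (f := q) pS; first by move=> a /qK.
have [|psi psiE] := quotient_lift (q := q) (f := p) qS; first by move=> a /qK.
exists Q, phi, psi; split=> a; first by have [h <-] := pS a; rewrite phiE psiE.
by have [h <-] := qS a; rewrite psiE phiE.
Qed.

Variables (Q : comNzRingType) (phi : {rmorphism A -> Q}) (psi : {rmorphism Q -> A}).
Hypotheses (phiK : cancel phi psi) (psiK : cancel psi phi).
Let sQ : {rmorphism F -> Q} := phi \o sA.

Variables (T : comNzRingType) (iB : {rmorphism Q -> T}) (iA : {rmorphism A -> T}).
Hypothesis iAB : forall c, iA (sA c) = iB (sQ c).
Hypothesis Tspan : forall t, exists l : seq (Q * A), t = \sum_(u <- l) iB u.1 * iA u.2.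
Hypothesis Tindep : forall bs : seq Q, indep sQ bs -> forall al : nat -> A,
  \sum_(i < size bs) iB bs`_i * iA (al i) = 0 -> forall i, (i < size bs)%N -> al i = 0.
Hypothesis Tuniv : forall (R : comNzRingType) (f : {rmorphism Q -> R}) (g : {rmorphism A -> R}),
  (forall c, f (sQ c) = g (sA c)) ->
  exists h : {rmorphism T -> R}, (forall b, h (iB b) = f b) /\ (forall a, h (iA a) = g a).
Let sT : {rmorphism F -> T} := iB \o sQ.

(** [x] and [y] are the two universal points over [Q (x) A]; their product [g] is the
    comultiplication of the coordinate ring. *)
Let x : pt sT := @AlgHom F A (CAlg sT) (iB \o phi) (fun=> erefl).
Let y : pt sT := @AlgHom F A (CAlg sT) iA iAB.
Let g : pt sT := gmul x y.

Lemma pt_univ (R : comNzRingType) (s : {rmorphism F -> R}) (x' y' : pt s) :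
  exists h : {rmorphism T -> R}, [/\ forall b, h (iB b) = x' (psi b),
    forall a, h (iA a) = y' a & forall a, h (g a) = (gmul x' y' : pt s) a].
Proof.
pose x'R : {rmorphism A -> R} := x'; pose y'R : {rmorphism A -> R} := y'.
have [c|h [hB hA]] := Tuniv (f := x'R \o psi) (g := y'R).
  by rewrite /= phiK; apply: (etrans (alghom_str x' c)); apply/esym/(alghom_str y' c).
have hs c : h (sT c) = s c.
  by rewrite /sT /= hB /= phiK; exact: (alghom_str x' c).
exists h; split=> // a.
pose hh : alghom (CAlg sT) (CAlg s) := @AlgHom F (CAlg sT) (CAlg s) h hs.
rewrite -[LHS]/(alghom_comp hh g a) /g gmul_natural.
have -> : alghom_comp hh x = x'.
  by apply: alghom_eq => u; rewrite /= hB /= phiK.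
have -> // : alghom_comp hh y = y'.
by apply: alghom_eq => u; rewrite /= hA.
Qed.

Lemma span_choice (V : pzRingType) (s : {rmorphism F -> V}) (l bs : seq V) :
  (forall b, b \in l -> exists c, b = lincomb s c bs) ->
  exists C : V -> nat -> F, forall b, b \in l -> b = lincomb s (C b) bs.
Proof.
move=> span; have h b : exists c, b \in l -> b = lincomb s c bs.
  by have [/span[c cE]|] := boolP (b \in l); [exists c | exists (fun=> 0)].
by have [C CE] := choice h; exists C.
Qed.

Lemma tensor_left_indep t : exists as' : seq Q, indep sQ as' /\
  exists be : nat -> A, t = \sum_(i < size as') iB as'`_i * iA (be i).
Proof.
have [l ->] := Tspan t.
have [as' [ias _ span]] := indep_basis sQ [seq u.1 | u <- l].
have [C CE] := span_choice span; exists as'; split=> //.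
exists (fun i => \sum_(u <- l) sA (C u.1 i) * u.2).
transitivity (\sum_(u <- l) \sum_(i < size as') iB as'`_i * iA (sA (C u.1 i) * u.2)).
  rewrite big_seq [RHS]big_seq; apply: eq_bigr => u ul.
  rewrite {1}(CE u.1); last exact: map_f.
  rewrite raddf_sum mulr_suml; apply: eq_bigr => i _.
  rewrite (rmorphM iA) iAB -[X in X * _ = _]/(iB _) rmorphM /= -mulrA mulrCA.
  by [].
rewrite exchange_big; apply: eq_bigr => i _.
by rewrite raddf_sum mulr_sumr.
Qed.

Lemma tensor_right_expand (l : seq (Q * A)) (e : seq A) :
  (forall u, u \in l -> exists c, u.2 = lincomb sA c e) ->
  exists th : nat -> Q, \sum_(u <- l) iB u.1 * iA u.2 = \sum_(i < size e) iB (th i) * iA e`_i.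
Proof.
move=> span; have [|C CE] := @span_choice A sA [seq u.2 | u <- l] e.
  by move=> _ /mapP[u ul ->]; apply: span.
exists (fun i => \sum_(u <- l) sQ (C u.2 i) * u.1).
transitivity (\sum_(u <- l) \sum_(i < size e) iB (sQ (C u.2 i) * u.1) * iA e`_i).
  rewrite big_seq [RHS]big_seq; apply: eq_bigr => u ul.
  rewrite {1}(CE u.2); last exact: map_f.
  rewrite raddf_sum mulr_sumr; apply: eq_bigr => i _.
  rewrite -[X in _ * X = _]/(iA _) (rmorphM iA) iAB (rmorphM iB) mulrCA mulrA.
  by [].
rewrite exchange_big; apply: eq_bigr => i _.
by rewrite raddf_sum mulr_suml.
Qed.

Variables (T3 : comNzRingType) (jT : {rmorphism T -> T3}) (jA : {rmorphism A -> T3}).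
Hypothesis jAT : forall c, jA (sA c) = jT (sT c).
Hypothesis T3indep : forall as' : seq A, indep sA as' -> forall be : nat -> T,
  \sum_(i < size as') jT (be i) * jA as'`_i = 0 -> forall i, (i < size as')%N -> be i = 0.
Let s3 : {rmorphism F -> T3} := jT \o sT.
Let jTh : alghom (CAlg sT) (CAlg s3) := @AlgHom F (CAlg sT) (CAlg s3) jT (fun=> erefl).
Let X : pt s3 := alghom_comp jTh x.
Let Y : pt s3 := alghom_comp jTh y.
Let Z : pt s3 := @AlgHom F A (CAlg s3) jA jAT.

Lemma T3coef (e : seq A) (be be' : nat -> T) : indep sA e ->
  \sum_(i < size e) jT (be i) * jA e`_i = \sum_(i < size e) jT (be' i) * jA e`_i ->
  forall i, (i < size e)%N -> be i = be' i.
Proof.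
move=> ie E i ilt; apply/eqP; rewrite -subr_eq0; apply/eqP.
apply: (T3indep ie (be := fun i => be i - be' i)) => //.
apply/eqP; move/eqP: E; rewrite -subr_eq0 -sumrB => /eqP E; apply/eqP; rewrite -[RHS]E.
by apply: eq_bigr => j _; rewrite rmorphB mulrBl.
Qed.

(** The right legs of the comultiplication of [a] span a subcomodule. By coassociativity the sum of
    [as'_m (x) g(be_m)] equals that of [g(as'_m) (x) be_m], whose last factors lie in the span of
    [vs]; independence of [as'] separates the [g(be_m)]. *)
Lemma legs_stable a (as' : seq Q) (be : nat -> A) (vs : seq A) :
  indep sQ as' -> g a = \sum_(m < size as') iB as'`_m * iA (be m) -> indep sA vs ->
  (forall m, (m < size as')%N -> exists c, be m = lincomb sA c vs) ->
  forall m, (m < size as')%N ->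
    exists th : nat -> Q, g (be m) = \sum_(i < size vs) iB (th i) * iA vs`_i.
Proof.
move=> ias gaE ivs bevs.
have [L LE] := choice (fun m => Tspan (g (be m))).
pose W := flatten [seq [seq u.2 | u <- L m] | m <- iota 0 (size as')].
have [ws [ie _ wspan]] := indep_extend W ivs.
set e := ws ++ vs in ie wspan.
have thex m : exists th : nat -> Q, (m < size as')%N ->
    g (be m) = \sum_(i < size e) iB (th i) * iA e`_i.
  have [mlt|] := boolP (m < size as')%N; last by exists (fun=> 0).
  have [|th thE] := @tensor_right_expand (L m) e.
    move=> u uL; apply: wspan; apply/flattenP; exists [seq u.2 | u <- L m]; last exact: map_f.
    by apply: map_f; rewrite mem_iota.
  by exists th => _; rewrite LE.
have [th thE] := choice thex.
have cex m : exists c : nat -> F, (m < size as')%N -> be m = lincomb sA c vs.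
  have [/bevs[c cE]|] := boolP (m < size as')%N; last by exists (fun=> 0).
  by exists c.
have [c cE] := choice cex.
pose c' m i := if (i < size ws)%N then 0 else c m (i - size ws)%N.
have c'E m : (m < size as')%N -> be m = lincomb sA (c' m) e.
  move=> mlt; rewrite cE // /lincomb size_cat big_split_ord /= [X in _ = X + _]big1 ?add0r.
    apply: eq_bigr => i _; rewrite /c' ltnNge leq_addr /= addKn.
    by rewrite nth_cat ltnNge leq_addr /= addKn.
  by move=> i _; rewrite /c' ltn_ord rmorph0 mul0r.
have [h2 [h2B h2A h2g]] := pt_univ Y Z.
have [h3 [h3B h3A h3g]] := pt_univ X (gmul Y Z).
have [h1 [h1B h1A h1g]] := pt_univ (gmul X Y) Z.
have key : h3 (g a) = h1 (g a) by rewrite h3g h1g gmulA.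
have XYE b : (gmul X Y : pt s3) b = jT (g b) by rewrite /X /Y -gmul_natural.
(* [L1 i] and [R1 i] are the coefficients of the i-th element of [e] in the two ways of associating;
   those at [ws], outside [vs], vanish in [R1]. *)
pose L1 i := \sum_(m < size as') iB as'`_m * iA (psi (th m i)).
pose R1 i := \sum_(m < size as') g (psi as'`_m) * sT (c' m i).
have L1R1 i : (i < size e)%N -> L1 i = R1 i.
  apply: (T3coef ie); transitivity (h3 (g a)); last transitivity (h1 (g a)) => //.
    rewrite gaE raddf_sum.
    under eq_bigr do rewrite /L1 raddf_sum mulr_suml.
    rewrite exchange_big; apply: eq_bigr => m _ /=.
    rewrite (rmorphM h3) h3B h3A -h2g thE // (rmorph_sum h2) mulr_sumr.
    apply: eq_bigr => i' _; rewrite (rmorphM jT) (rmorphM h2) h2B h2A /= psiK mulrA.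
    by [].
  rewrite gaE raddf_sum.
  under [RHS]eq_bigr do rewrite /R1 raddf_sum mulr_suml.
  rewrite [RHS]exchange_big; apply: eq_bigr => m _ /=.
  rewrite (rmorphM h1) h1B h1A XYE {1}c'E // (rmorph_sum jA) mulr_sumr.
  apply: eq_bigr => i' _; rewrite (rmorphM jT) -mulrA; congr (_ * _).
  by rewrite -jAT -[LHS]/(jA _) rmorphM.
have th0 m i : (m < size as')%N -> (i < size ws)%N -> th m i = 0.
  move=> mlt ilt; rewrite -[th m i]psiK (Tindep ias (al := fun m => psi (th m i))) ?rmorph0 //.
  rewrite -/(L1 i) L1R1 ?size_cat ?ltn_addr // /R1 big1 // => m' _.
  by rewrite /c' ilt rmorph0 mulr0.
move=> m mlt; exists (fun i => th m (size ws + i)%N).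
rewrite thE // size_cat big_split_ord /= big1 ?add0r => [|i _].
  by apply: eq_bigr => i _; rewrite nth_cat ltnNge leq_addr /= addKn.
by rewrite th0 // rmorph0 mul0r.
Qed.

End Representation.

(* b holds the matrix entries of a closed embedding rho : G -> GL_n; they come from
   the comodule generated by algebra generators of the coordinate ring.         *)
Lemma representation_exists (F : fieldType) (G : group_scheme F) : finite_type G ->
  exists (n : nat) (b : 'M[coord G]_n) (pB : {rmorphism {mpoly F[n * n]} -> coord G}),
  [/\ forall c, pB c%:MP = calg_str (coord G) c,
      forall k, pB 'X_k = mxvec b 0 k,
      forall a, exists h, pB h = a,
      forall (R : comNzRingType) (s : {rmorphism F -> R}) (x y : points G (CAlg s)),
        map_mx (gmul x y : pt G s) b = map_mx x b *m map_mx y b &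
      forall (R : comNzRingType) (s : {rmorphism F -> R}),
        map_mx (gone : pt G s) b = 1%:M].
Proof.
case=> N [p [pC pS]].
pose sA := calg_str (coord G).
have [Q [phi [psi [phiK psiK]]]] := coord_copy pS.
pose sQ : {rmorphism F -> Q} := phi \o sA.
have [T [iB [iA [iAB Tspan Tindep Tuniv]]]] := tensor_exists sQ pC pS (@epsC F G).
pose sT : {rmorphism F -> T} := iB \o sQ.
have [T3 [jT [jA [jAT _ T3ind _]]]] := tensor_exists sT pC pS (@epsC F G).
have T3indep := tensor_indep_right jAT T3ind.
pose x : pt G sT := @AlgHom F (coord G) (CAlg sT) (iB \o phi) (fun=> erefl).
pose y : pt G sT := @AlgHom F (coord G) (CAlg sT) iA iAB.
pose g : pt G sT := gmul x y.
have univ (R : comNzRingType) (s : {rmorphism F -> R}) (x' y' : pt G s) :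
  exists h : {rmorphism T -> R}, [/\ forall a, h (x a) = x' a,
    forall a, h (iA a) = y' a & forall a, h (g a) = (gmul x' y' : pt G s) a].
  have [h [h1 h2 h3]] := pt_univ phiK iAB Tuniv x' y'.
  by exists h; split=> // a; rewrite /= h1 phiK.
pose ak (k : 'I_N) := p 'X_k.
have [as' asP] := choice (fun k => tensor_left_indep iAB Tspan (g (ak k))).
have ias k := (asP k).1.
have [be beE] := choice (fun k => (asP k).2).
pose vs0 := flatten [seq [seq be k i | i <- iota 0 (size (as' k))] | k <- enum 'I_N].
have inv0 k m : (m < size (as' k))%N -> be k m \in vs0.
  move=> mlt; apply/flattenP; exists [seq be k i | i <- iota 0 (size (as' k))].
    by apply: map_f; rewrite mem_enum.
  by apply: map_f; rewrite mem_iota.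
have [vs [ivs vsub vspan]] := indep_basis sA vs0.
set n := size vs.
have thex i : exists th : nat -> Q, (i < n)%N ->
    g vs`_i = \sum_(j < n) iB (th j) * iA vs`_j.
  have [ilt|] := boolP (i < n)%N; last by exists (fun=> 0).
  have /vsub/flattenP[_ /mapP[k _ ->] /mapP[m]] := mem_nth 0 ilt.
  rewrite mem_iota => /= mlt ->.
  have [|th thE] := legs_stable phiK psiK Tspan Tindep Tuniv jAT T3indep (ias k) (beE k) ivs _ mlt.
    by move=> m' m'lt; apply/vspan/inv0.
  by exists th.
have [th thE] := choice thex.
pose b : 'M[coord G]_n := \matrix_(i, j) psi (th i j).
have law (R : comNzRingType) (s : {rmorphism F -> R}) (x' y' : pt G s) (i : 'I_n) :
    (gmul x' y' : pt G s) vs`_i = \sum_(j < n) x' (b i j) * y' vs`_j.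
  have [h [hx hy <-]] := univ R s x' y'; rewrite thE // raddf_sum.
  apply: eq_bigr => j _; rewrite -hx mxE /= psiK -hy; exact: rmorphM.
have eps_b i j : eps G (b i j) = (i == j)%:R.
  pose gQ : pt G sQ := gone.
  pose pQ : pt G sQ := @AlgHom F (coord G) (CAlg sQ) phi (fun=> erefl).
  have := law Q sQ gQ pQ i; rewrite gmul1g => /(congr1 psi).
  rewrite -[X in psi X = _]/(phi _) phiK raddf_sum => e.
  have e0 : lincomb sA (fun j => if insub j is Some j' then eps G (b i j') - (i == j')%:R else 0) vs = 0.
    transitivity (\sum_(j < n) sA (eps G (b i j)) * vs`_j - \sum_(j < n) sA (i == j)%:R * vs`_j).
      rewrite -sumrB; apply: eq_bigr => k _; rewrite valK rmorphB mulrBl.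
      by [].
    rewrite [X in _ - X](bigD1 i) //= eqxx rmorph1 mul1r [X in _ - (_ + X)]big1 ?addr0; last first.
      by move=> k ki; rewrite eq_sym (negbTE ki) rmorph0 mul0r.
    apply/eqP; rewrite subr_eq0; apply/eqP; rewrite [RHS]e; apply: eq_bigr => k _.
    have gQE a : gQ a = phi (sA (eps G a)) by exact: goneE.
    by rewrite [RHS](rmorphM psi) gQE /= !phiK.
  have := ivs _ e0 j (ltn_ord j); rewrite valK => /eqP.
  by rewrite subr_eq0 => /eqP.
have one (R : comNzRingType) (s : {rmorphism F -> R}) : map_mx (gone : pt G s) b = 1%:M.
  by apply/matrixP => i j; rewrite [LHS]mxE goneE eps_b rmorph_nat mxE.
have T3c := T3coef T3indep ivs.
have mulu : map_mx g b = map_mx x b *m map_mx y b.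
  pose s3 : {rmorphism F -> T3} := jT \o sT.
  pose jTh : alghom (CAlg sT) (CAlg s3) := @AlgHom F (CAlg sT) (CAlg s3) jT (fun=> erefl).
  pose X : pt G s3 := alghom_comp jTh x.
  pose Y : pt G s3 := alghom_comp jTh y.
  pose Z : pt G s3 := @AlgHom F (coord G) (CAlg s3) jA jAT.
  apply/matrixP => i j; rewrite mxE.
  pose B1 k := if insub k is Some k' then g (b i k') else 0.
  pose B2 k := if insub k is Some k' then (map_mx x b *m map_mx y b) i k' else 0.
  have -> : g (b i j) = B1 j by rewrite /B1 valK.
  have -> : (map_mx x b *m map_mx y b) i j = B2 j by rewrite /B2 valK.
  apply: T3c (ltn_ord j).
  transitivity ((gmul (gmul X Y) Z : pt G s3) vs`_i).
    rewrite law; apply: eq_bigr => k _; rewrite /B1 valK; congr (_ * _).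
    by rewrite /X /Y -gmul_natural.
  rewrite -gmulA law.
  transitivity (\sum_(k < n) \sum_(l < n) jT (x (b i k)) * (jT (y (b k l)) * jA vs`_l)).
    by apply: eq_bigr => k _; rewrite law mulr_sumr.
  rewrite exchange_big; apply: eq_bigr => l _ /=.
  rewrite /B2 valK mxE (rmorph_sum jT) mulr_suml; apply: eq_bigr => k _.
  by rewrite !mxE (rmorphM jT) mulrA.
have mul (R : comNzRingType) (s : {rmorphism F -> R}) (x' y' : pt G s) :
    map_mx (gmul x' y' : pt G s) b = map_mx x' b *m map_mx y' b.
  have [h [hx hy hg]] := univ R s x' y'.
  have /(congr1 (map_mx h)) := mulu; rewrite map_mxM -!map_mx_comp.
  have -> : map_mx (h \o g) b = map_mx (gmul x' y' : pt G s) b by apply: eq_map_mx.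
  by move=> ->; congr (_ *m _); apply: eq_map_mx.
pose pQ : {rmorphism {mpoly F[n * n]} -> Q} := mmap sQ (fun k => phi (mxvec b 0 k)).
pose pB : {rmorphism {mpoly F[n * n]} -> coord G} := psi \o pQ.
have pBC c : pB c%:MP = sA c by rewrite /pB /= /pQ /= mmapC /= phiK.
have pBX k : pB 'X_k = mxvec b 0 k by rewrite /pB /= /pQ /= mmapX mmap1U phiK.
exists n, b, pB; split=> //.
pose Im a := exists h, pB h = a.
have ImC c : Im (sA c) by exists c%:MP.
have ImD a a' : Im a -> Im a' -> Im (a + a') by move=> [h <-] [h' <-]; exists (h + h'); rewrite rmorphD.
have ImM a a' : Im a -> Im a' -> Im (a * a') by move=> [h <-] [h' <-]; exists (h * h'); rewrite rmorphM.
have Im0 : Im 0 by have := ImC 0; rewrite rmorph0.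
have Imb i j : Im (b i j) by exists 'X_(mxvec_index i j); rewrite pBX mxvecE.
pose gQ : pt G sQ := gone.
pose idQ : pt G sQ := @AlgHom F (coord G) (CAlg sQ) phi (fun=> erefl).
(* The counit axiom on the right leg writes [vs_i] as a combination of the [b i j] with coefficients
   in [F]. *)
have Imvs i : (i < n)%N -> Im vs`_i.
  move=> ilt; have := law Q sQ idQ gQ (Ordinal ilt); rewrite gmulg1 /= => /(congr1 psi).
  rewrite phiK => ->; rewrite (rmorph_sum psi); apply: (big_ind Im) => // j _.
  by rewrite (rmorphM psi) phiK; apply: ImM => //; rewrite goneE /= phiK.
have Imspan c : Im (lincomb sA c vs).
  by apply: (big_ind Im) => // j _; apply: ImM => //; exact: Imvs.
(* The counit on the left leg puts each algebra generator in the span of [vs]. *)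
have Imak k : Im (ak k).
  have [h [hx hy hg]] := univ Q sQ gQ idQ.
  have := hg (ak k); rewrite gmul1g /= beE (rmorph_sum h) => /(congr1 psi).
  rewrite phiK => <-; rewrite (rmorph_sum psi); apply: (big_ind Im) => // m _.
  rewrite (rmorphM h) (rmorphM psi); apply: ImM.
    have -> : iB (as' k)`_m = x (psi (as' k)`_m) by rewrite /= psiK.
    by rewrite hx goneE /= phiK.
  by rewrite hy /= phiK; have [c ->] := vspan _ (inv0 k m (ltn_ord m)).
move=> a; have [h <-] := pS a; elim/mpoly_ring_ind: h => [c|i|h h' Ih Ih'|h h' Ih Ih'].
- by rewrite pC; apply: ImC.
- exact: Imak.
- by rewrite rmorphD; apply: ImD.
by rewrite rmorphM; apply: ImM.
Qed.

(** * Equations of cosets *)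

Section DegreeBound.
Variables (K : idomainType) (N : nat).
Implicit Types h : {mpoly K[N]}.

Lemma msize_leP d h : (msize h <= d)%N <-> forall m, (d <= mdeg m)%N -> h@_m = 0.
Proof.
split=> [hd m dm|hm].
  by apply: memN_msupp_eq0; apply: msize_mdeg_ge; exact: leq_trans hd dm.
rewrite msizeE; apply/bigmax_leqP_seq => m ms _; rewrite ltnNge.
by apply: contraTN ms => /hm/eqP; rewrite mcoeff_eq0.
Qed.

Lemma msize_sum_le (I : Type) (r : seq I) (f : I -> {mpoly K[N]}) d :
  (forall i, (msize (f i) <= d)%N) -> (msize (\sum_(i <- r) f i) <= d)%N.
Proof.
move=> fd; apply/msize_leP => m dm; rewrite raddf_sum big1 // => i _.
exact: (msize_leP _ _).1 (fd i) m dm.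
Qed.

Lemma msizeM_pred_le h h' : (msize (h * h') <= (msize h + msize h').-1)%N.
Proof.
have [->|h0] := eqVneq h 0; first by rewrite mul0r msize0.
have [->|h'0] := eqVneq h' 0; first by rewrite mulr0 msize0.
by rewrite msizeM.
Qed.

Lemma msize_mmap1_le (f : 'I_N -> {mpoly K[N]}) m : (forall i, (msize (f i) <= 2)%N) ->
  (msize (mmap1 f m) <= (mdeg m).+1)%N.
Proof.
move=> f2; rewrite /mmap1 mdegE.
apply: (big_rec2 (fun h k => (msize h <= k.+1)%N)); first by rewrite msize1.
have le_mul h h' k k' : (msize h <= k.+1)%N -> (msize h' <= k'.+1)%N ->
    (msize (h * h') <= (k + k').+1)%N.
  move=> hk h'k; apply: leq_trans (msizeM_pred_le _ _) _; rewrite -subn1 leq_subLR add1n.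
  by apply: leq_trans (leq_add hk h'k) _; rewrite addSn addnS.
move=> i k h _ kh; apply: (le_mul) => //.
elim: (m i) => [|e IHe]; first by rewrite expr0 msize1.
by rewrite exprS; apply: (le_mul _ _ 1%N e).
Qed.

End DegreeBound.

(** * Polynomial functions of a matrix and right translation *)

Section MatrixEvaluation.
Variables (n : nat) (K : fieldType).

Definition evm (F R : comNzRingType) (s : {rmorphism F -> R}) (M : 'M[R]_n) :
  {rmorphism {mpoly F[n * n]} -> R} := mmap s (fun k => mxvec M 0 k).

Lemma evm_natural (F R R' : comNzRingType) (s : {rmorphism F -> R}) (g : {rmorphism R -> R'})
    (M : 'M[R]_n) h : g (evm s M h) = evm (g \o s) (map_mx g M) h.
Proof. by rewrite rmorph_mmap; apply: eq_mmap => // k /=; rewrite -map_mxvec mxE. Qed.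

Lemma eq_evm (F R : comNzRingType) (s s' : {rmorphism F -> R}) (M : 'M[R]_n) h :
  s =1 s' -> evm s M h = evm s' M h.
Proof. by move=> ss; apply: eq_mmap. Qed.

Definition Ymx (R : comNzRingType) : 'M[{mpoly R[n * n]}]_n := vec_mx (\row_k 'X_k).

(** Right translation of functions of a matrix, taking h(Y) to h(Y P). *)
Definition subst (P : 'M[K]_n) : {rmorphism {mpoly K[n * n]} -> {mpoly K[n * n]}} :=
  evm (@mpolyC _ K) (Ymx K *m map_mx (@mpolyC _ K) P).

Lemma evm_Ymx (R R' : comNzRingType) (s : {rmorphism R -> R'}) (M : 'M[R']_n) :
  map_mx (evm s M) (Ymx R) = M.
Proof.
rewrite map_vec_mx -[RHS]mxvecK; congr vec_mx.
by apply/rowP => k; rewrite !mxE /evm /= mmapX mmap1U.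
Qed.

Lemma evm_subst (R : comNzRingType) (s : {rmorphism K -> R}) (M : 'M[R]_n) (P : 'M[K]_n) h :
  evm s M (subst P h) = evm s (M *m map_mx s P) h.
Proof.
rewrite /subst evm_natural map_mxM evm_Ymx -map_mx_comp.
have sE : evm s M \o @mpolyC _ K =1 s by move=> c; rewrite /evm /= mmapC.
by rewrite (eq_evm _ _ sE); congr (evm _ (_ *m _) _); apply: eq_map_mx.
Qed.

Lemma evm_id h : evm (@mpolyC _ K) (Ymx K) h = h.
Proof.
by rewrite -[RHS]mmap_id; apply: eq_mmap => // k; rewrite vec_mxK mxE.
Qed.

Lemma subst_comp P Q h : subst P (subst Q h) = subst (P *m Q) h.
Proof.
apply: etrans (evm_subst _ _ _ _) _; rewrite -mulmxA /subst.
suff -> : map_mx (@mpolyC (n * n) K) (P *m Q) = map_mx (@mpolyC _ _) P *m map_mx (@mpolyC _ _) Q.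
  by [].
exact: map_mxM.
Qed.

Lemma subst1 h : subst 1%:M h = h.
Proof. by rewrite /subst map_mx1 mulmx1 evm_id. Qed.

Lemma msize_subst P h : (msize (subst P h) <= msize h)%N.
Proof.
rewrite /subst /evm /= /mmap big_seq; elim/big_ind: _ => [|h1 h2 h1P h2P|m mh].
- by rewrite msize0.
- apply/msize_leP => m dm; rewrite mcoeffD.
  have /msize_leP/(_ m dm) -> := h1P; have /msize_leP/(_ m dm) -> := h2P.
  exact: addr0.
rewrite mul_mpolyC; apply: leq_trans (msizeZ_le _ _) _.
apply: leq_trans (msize_mdeg_lt mh); apply: msize_mmap1_le => k.
case/mxvec_indexP: k => i j; rewrite mxvecE mxE; apply: msize_sum_le => k; rewrite !mxE mulrC mul_mpolyC.
by apply: leq_trans (msizeZ_le _ _) _; rewrite msizeX mdeg1.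
Qed.

Variable d : nat.
Local Notation X := (bmultinom (n * n) d).
Local Notation w := #|{: X}|.

(** Both [bmultinom (n * n) d] and [msize h <= d] refer to degrees strictly less than [d]. *)
Definition coefrow (R : comNzRingType) (h : {mpoly R[n * n]}) : 'rV[R]_w :=
  \row_k h@_(enum_val k : X).
Definition polyrow (R : comNzRingType) (v : 'rV[R]_w) : {mpoly R[n * n]} :=
  \sum_k v 0 k *: 'X_[enum_val k : X].
Definition monvec (R : comNzRingType) (M : 'M[R]_n) : 'cV[R]_w :=
  \col_k mmap1 (fun k => mxvec M 0 k) (enum_val k : X).

Lemma polyrowK (R : comNzRingType) : cancel (@polyrow R) (@coefrow R).
Proof.
move=> v; apply/rowP => k; rewrite mxE /polyrow raddf_sum (bigD1 k) //= big1 ?addr0.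
  by rewrite mcoeffZ mcoeffX eqxx mulr1.
move=> j jk; rewrite mcoeffZ mcoeffX; case: eqP => [e|_]; last by rewrite mulr0.
by case/eqP: jk; apply: enum_val_inj; apply: val_inj.
Qed.

Lemma coefrowK (R : comNzRingType) (h : {mpoly R[n * n]}) :
  (msize h <= d)%N -> polyrow (coefrow h) = h.
Proof.
move=> hd; rewrite [RHS](mpolywE hd) /polyrow [RHS](reindex (@enum_val X {: X})) /=.
  by apply: eq_bigr => k _; rewrite mxE.
by apply: onW_bij; apply: enum_val_bij.
Qed.

Lemma evm_polyrow (F R : comNzRingType) (s : {rmorphism F -> R}) (M : 'M[R]_n) v :
  evm s M (polyrow v) = (map_mx s v *m monvec M) 0 0.
Proof.
rewrite /polyrow rmorph_sum mxE; apply: eq_bigr => k _.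
by rewrite !mxE /evm /= mmapZ mmapX.
Qed.

Lemma coefrow_is_linear (R : comNzRingType) : linear (@coefrow R).
Proof. by move=> a h h'; apply/rowP => k; rewrite !mxE mcoeffD mcoeffZ. Qed.
HB.instance Definition _ (R : comNzRingType) :=
  GRing.isLinear.Build R {mpoly R[n * n]} 'rV[R]_w _ (@coefrow R) (@coefrow_is_linear R).

Lemma msize_polyrow (R : idomainType) (v : 'rV[R]_w) : (msize (polyrow v) <= d)%N.
Proof.
apply: msize_sum_le => k; apply: leq_trans (msizeZ_le _ _) _.
by rewrite msizeX bmdeg.
Qed.

End MatrixEvaluation.

(* A canonical representative of the row space of a row-free matrix, computed in
   a way that commutes with field homomorphisms.                                *)
Section CanonicalForm.
Variables (K : fieldType) (r w : nat).
Implicit Types A : 'M[K]_(r, w).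

Definition canon_mx A : 'M[K]_(r, w) :=
  if [pick J : {ffun 'I_r -> 'I_w} | colsub J A \in unitmx] is Some J
  then invmx (colsub J A) *m A else A.

Lemma canon_mx_mul (u : 'M[K]_r) A : u \in unitmx -> row_free A -> canon_mx (u *m A) = canon_mx A.
Proof.
move=> uU Af; rewrite /canon_mx.
(* [pick] depends only on the predicate, so both matrices are normalized at the same columns. *)
have e : (fun J : {ffun 'I_r -> 'I_w} => colsub J (u *m A) \in unitmx) =1
    (fun J : {ffun 'I_r -> 'I_w} => colsub J A \in unitmx).
  by move=> J; rewrite -mulmx_colsub unitmx_mul uU.
rewrite (eq_pick e); case: pickP => [J JU|nJ].
  have uA : u *m A = (u *m colsub J A) *m (invmx (colsub J A) *m A).
    by rewrite -mulmxA mulKVmx.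
  by rewrite -mulmx_colsub {1}uA mulKmx // unitmx_mul uU.
have At : row_full A^T by rewrite /row_full mxrank_tr.
by have := nJ (fullrankfun At); rewrite -unitmx_tr trmx_mxsub fullrowsub_unit.
Qed.

Lemma canon_mxP A : exists2 u, u \in unitmx & canon_mx A = u *m A.
Proof.
rewrite /canon_mx; case: pickP => [J JU|_]; first by exists (invmx (colsub J A)); rewrite ?unitmx_inv.
by exists 1%:M; rewrite ?unitmx1 ?mul1mx.
Qed.

End CanonicalForm.

Lemma map_canon_mx (K L : fieldType) (e : {rmorphism K -> L}) r w (A : 'M[K]_(r, w)) :
  map_mx e (canon_mx A) = canon_mx (map_mx e A).
Proof.
rewrite /canon_mx.
have E : (fun J : {ffun 'I_r -> 'I_w} => colsub J (map_mx e A) \in unitmx) =1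
    (fun J : {ffun 'I_r -> 'I_w} => colsub J A \in unitmx).
  by move=> J; rewrite -map_mxsub map_unitmx.
by rewrite (eq_pick E); case: pickP => [J JU|//]; rewrite map_mxM map_invmx map_mxsub.
Qed.

Section MapPolynomial.
Variables (n d : nat).
Local Notation w := #|{: bmultinom (n * n) d}|.

Definition mpoly_along (F K : comNzRingType) (s : {rmorphism F -> K}) :
    {rmorphism {mpoly F[n * n]} -> {mpoly K[n * n]}} :=
  mmap (@mpolyC _ K \o s) (fun i => 'X_i).

Lemma mpoly_along_coef (F K : comNzRingType) (s : {rmorphism F -> K}) h m : (mpoly_along s h)@_m = s h@_m.
Proof. exact: mcoeff_map_mpoly. Qed.

Lemma evm_mpoly_along (F K R : comNzRingType) (s : {rmorphism F -> K}) (t : {rmorphism K -> R})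
    (M : 'M[R]_n) h : evm t M (mpoly_along s h) = evm (t \o s) M h.
Proof.
rewrite /evm /mpoly_along /= rmorph_mmap; apply: eq_mmap => [c|k] /=; first by rewrite mmapC.
by rewrite mmapX mmap1U.
Qed.

Lemma mpoly_along_polyrow (F K : comNzRingType) (s : {rmorphism F -> K}) (v : 'rV[F]_w) :
  mpoly_along s (polyrow v) = polyrow (map_mx s v).
Proof.
rewrite /polyrow rmorph_sum; apply: eq_bigr => k _.
by apply/mpolyP => m; rewrite mpoly_along_coef !mcoeffZ rmorphM !mcoeffX rmorph_nat mxE.
Qed.

Lemma mpoly_along_subst (K L : fieldType) (e : {rmorphism K -> L}) (P : 'M[K]_n) h :
  mpoly_along e (subst P h) = subst (map_mx e P) (mpoly_along e h).
Proof.
have mE (k : {mpoly K[n * n]}) : mpoly_along e k = evm (@mpolyC _ L \o e) (Ymx n L) k.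
  by apply: eq_mmap => // j; rewrite vec_mxK mxE.
by rewrite mE evm_subst [RHS]evm_mpoly_along map_mx_comp.
Qed.

Lemma polyrow_sum (R : comNzRingType) r (u : 'rV[R]_r) (B : 'M[R]_(r, w)) :
  polyrow (u *m B) = \sum_i u 0 i *: polyrow (row i B).
Proof.
rewrite /polyrow; under [RHS]eq_bigr do rewrite scaler_sumr.
rewrite [RHS]exchange_big; apply: eq_bigr => k _.
rewrite mxE scaler_suml; apply: eq_bigr => i _.
by rewrite mxE scalerA.
Qed.
End MapPolynomial.
Arguments mpoly_along {n F K} s.

Lemma invmx_mul (K : fieldType) n (A B : 'M[K]_n) : A \in unitmx -> B \in unitmx ->
  invmx (A *m B) = invmx B *m invmx A.
Proof.
move=> AU BU; have ABU : A *m B \in unitmx by rewrite unitmx_mul AU.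
by rewrite -[RHS]mulmx1 -(mulmxV ABU) !mulmxA mulmxKV // mulVmx // mul1mx.
Qed.

Section CosetForm.
Variables (F : fieldType) (G : group_scheme F) (n : nat) (b : 'M[coord G]_n).
Variable pB : {rmorphism {mpoly F[n * n]} -> coord G}.
Hypothesis pBC : forall c, pB c%:MP = calg_str (coord G) c.
Hypothesis pBX : forall k, pB 'X_k = mxvec b 0 k.
Hypothesis pBS : forall a, exists h, pB h = a.
Hypothesis bM : forall (R : comNzRingType) (s : {rmorphism F -> R}) (x y : points G (CAlg s)),
  map_mx (gmul x y : pt G s) b = map_mx x b *m map_mx y b.
Hypothesis b1 : forall (R : comNzRingType) (s : {rmorphism F -> R}),
  map_mx (gone : pt G s) b = 1%:M.

Definition rho (R : comNzRingType) (s : {rmorphism F -> R}) (x : pt G s) : 'M[R]_n := map_mx x b.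

Lemma rhoV (R : comNzRingType) (s : {rmorphism F -> R}) (x : pt G s) :
  rho (ginv x : pt G s) *m rho x = 1%:M.
Proof. by rewrite /rho -bM gmulVg b1. Qed.

Lemma rho_unit (K : fieldType) (s : {rmorphism F -> K}) (x : pt G s) : rho x \in unitmx.
Proof. by case/mulmx1_unit: (rhoV x). Qed.

Lemma rho_inv (K : fieldType) (s : {rmorphism F -> K}) (x : pt G s) :
  rho (ginv x : pt G s) = invmx (rho x).
Proof. by rewrite -[LHS](mulmxK (rho_unit x)) rhoV mul1mx. Qed.

Lemma pt_evm (R : comNzRingType) (s : {rmorphism F -> R}) (x : pt G s) h :
  x (pB h) = evm s (rho x) h.
Proof.
pose xR : {rmorphism coord G -> R} := x.
rewrite -[LHS]/((xR \o pB) h) [LHS]rmorph_mmapE; apply: eq_mmap => [c|k] /=.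
  by rewrite pBC; exact: (alghom_str x c).
by rewrite pBX -map_mxvec mxE.
Qed.

Lemma rho_inj (R : comNzRingType) (s : {rmorphism F -> R}) (x y : pt G s) :
  rho x = rho y -> x = y.
Proof. by move=> e; apply: pt_ext => a; have [h <-] := pBS a; rewrite !pt_evm e. Qed.

Lemma rho_image (R : comNzRingType) (s : {rmorphism F -> R}) (M : 'M[R]_n) :
  (forall h, pB h = 0 -> evm s M h = 0) -> exists x : pt G s, rho x = M.
Proof.
move=> M0; have [x xE] := quotient_lift pBS M0.
have xs c : x (calg_str (coord G) c) = s c by rewrite -pBC xE /evm /= mmapC.
exists (@AlgHom F (coord G) (CAlg s) x xs); rewrite /rho /=.
apply: (can_inj (@mxvecK _ _ _)); rewrite -map_mxvec; apply/rowP => k.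
by rewrite mxE -pBX xE /evm /= mmapX mmap1U.
Qed.

Lemma rho_natural (R R' : comNzRingType) (s : {rmorphism F -> R}) (g : {rmorphism R -> R'})
    (h : alghom (CAlg s) (CAlg (g \o s))) (x : pt G s) : h =1 g ->
  rho (alghom_comp h x : pt G (g \o s)) = map_mx g (rho x).
Proof. by move=> hg; rewrite /rho -map_mx_comp; apply: eq_map_mx => a /=; rewrite hg. Qed.

Section FixedDegree.
Variable d : nat.
Local Notation w := #|{: bmultinom (n * n) d}|.
Variables (r : nat) (B : 'M[F]_(r, w)).
Hypothesis B0 : forall i, pB (polyrow (row i B)) = 0.
Hypothesis Bf : row_free B.
Hypothesis Bmax : forall v, pB (polyrow v) = 0 -> (v <= B)%MS.

(** The equations of the coset rho(G) P in degree below [d]: those of rho(G), evaluated at Y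
    P^-1. *)
Definition cform (K : fieldType) (s : {rmorphism F -> K}) (P : 'M[K]_n) : 'M[K]_(r, w) :=
  \matrix_i coefrow d (subst (invmx P) (mpoly_along s (polyrow (row i B)))).

Lemma cform_natural (K L : fieldType) (s : {rmorphism F -> K}) (e : {rmorphism K -> L}) P :
  map_mx e (cform s P) = cform (e \o s) (map_mx e P).
Proof.
apply/matrixP => i k; rewrite !mxE -mpoly_along_coef mpoly_along_subst map_invmx; congr ((subst _ _)@_ _).
by apply/mpolyP => m; rewrite !mpoly_along_coef.
Qed.

Lemma mul_cform (K : fieldType) (s : {rmorphism F -> K}) (P : 'M[K]_n) (u : 'rV[K]_r) :
  u *m cform s P = coefrow d (subst (invmx P) (polyrow (u *m map_mx s B))).
Proof.
rewrite polyrow_sum mulmx_sum_row (rmorph_sum (subst _)) linear_sum; apply: eq_bigr => i _.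
rewrite -[in RHS]mul_mpolyC rmorphM /= [subst _ _%:MP]mmapC mul_mpolyC linearZ /=.
by rewrite rowK mpoly_along_polyrow map_row.
Qed.

Lemma subst_bound (K : fieldType) (P : 'M[K]_n) (v : 'rV[K]_w) :
  polyrow (coefrow d (subst P (polyrow v))) = subst P (polyrow v).
Proof. by apply: coefrowK; apply: leq_trans (msize_subst _ _) (msize_polyrow _). Qed.

Lemma cform_free (K : fieldType) (s : {rmorphism F -> K}) (P : 'M[K]_n) :
  P \in unitmx -> row_free (cform s P).
Proof.
move=> PU; apply: inj_row_free => u; rewrite mul_cform => u0.
have := subst_bound (invmx P) (u *m map_mx s B); rewrite u0.
have -> : polyrow (0 : 'rV[K]_w) = 0.
  by rewrite /polyrow big1 // => k _; rewrite mxE scale0r.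
move=> e0; have e : polyrow (u *m map_mx s B) = 0.
  move: e0 (mulmxV PU); move: (invmx P) (polyrow _) => Q q e0 PQ.
  apply: etrans (esym (subst1 q)) _.
  rewrite -PQ.
  apply: etrans (esym (subst_comp P Q q)) _.
  apply: etrans (congr1 (subst P) (esym e0)) _.
  exact: rmorph0.
have : u *m map_mx s B = 0.
  rewrite -[LHS]polyrowK e; apply/rowP => k; by rewrite !mxE mcoeff0.
have Bsf : row_free (map_mx s B) by rewrite row_free_map.
by move=> e'; apply: (row_free_inj Bsf); rewrite e' mul0mx.
Qed.

(** A translated equation [q] still vanishes on G, but has coefficients in [K]. Expanding them on a
    family independent over [F] and evaluating at the universal point over [K (x)_F A] shows that
    each component is an equation over [F], hence in the span of [B]. *)
Lemma translate_sub (K : fieldType) (s : {rmorphism F -> K}) (c : pt G s) i :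
  (coefrow d (subst (rho c) (mpoly_along s (polyrow (row i B)))) <= map_mx s B)%MS.
Proof.
set q := subst _ _.
have qd : (msize q <= d)%N.
  by apply: leq_trans (msize_subst _ _) _; rewrite mpoly_along_polyrow msize_polyrow.
have [T [iK [iA [iAK _ Tindep _]]]] := tensor_exists s pBC pBS (@epsC F G).
have [ks [iks _ span]] := indep_basis s [seq coefrow d q 0 k | k <- enum 'I_w].
have [C CE] := span_choice span.
pose v j : 'rV[F]_w := \row_k C (coefrow d q 0 k) j.
have qE : coefrow d q = \sum_(j < size ks) ks`_j *: map_mx s (v j).
  apply/rowP => k; rewrite [LHS]CE; last by apply: map_f; rewrite mem_enum.
  by rewrite summxE; apply: eq_bigr => j _; rewrite !mxE mulrC.
pose s' : {rmorphism F -> T} := iK \o s.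
pose y : pt G s' := @AlgHom F (coord G) (CAlg s') iA iAK.
pose iKh : alghom (CAlg s) (CAlg s') := @AlgHom F (CAlg s) (CAlg s') iK (fun=> erefl).
pose cT : pt G s' := alghom_comp iKh c.
have yc : evm iK (rho y) q = 0.
  rewrite /q evm_subst evm_mpoly_along.
  have -> : map_mx iK (rho c) = rho cT by rewrite (rho_natural (h := iKh)).
  by rewrite /rho -bM -pt_evm B0 rmorph0.
rewrite qE; apply: summx_sub => j _; apply: scalemx_sub; rewrite map_submx; apply: Bmax.
apply: (Tindep ks iks (fun j => pB (polyrow (v j)))) => //.
rewrite -[RHS]yc -(coefrowK qd) evm_polyrow qE map_mx_sum mulmx_suml summxE.
apply: eq_bigr => k _; rewrite -[iA _]/(y _) pt_evm evm_polyrow /=.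
by rewrite map_mxZ -scalemxAl [in RHS]mxE map_mx_comp.
Qed.

(** Translation by the inverse of [c] maps the space of equations to itself; the matrix [U] of this
    map is invertible because both forms have full rank. *)
Lemma cform_coset (K : fieldType) (s : {rmorphism F -> K}) (c : pt G s) (P : 'M[K]_n) :
  P \in unitmx -> exists2 u, u \in unitmx & cform s (rho c *m P) = u *m cform s P.
Proof.
move=> PU; pose c' : pt G s := ginv c.
pose Tr := \matrix_i coefrow d (subst (rho c') (mpoly_along s (polyrow (row i B)))).
have /submxP[U UE] : (Tr <= map_mx s B)%MS.
  by apply/row_subP => i; rewrite rowK; exact: translate_sub.
have fE : cform s (rho c *m P) = U *m cform s P.
  apply/row_matrixP => i.
  pose q := mpoly_along s (polyrow (row i B)).
  have rU : row i U *m map_mx s B = coefrow d (subst (rho c') q).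
    by rewrite -row_mul -UE; apply: rowK.
  have qd : polyrow (coefrow d (subst (rho c') q)) = subst (rho c') q.
    by apply: coefrowK; apply: leq_trans (msize_subst _ _) _; rewrite /q mpoly_along_polyrow msize_polyrow.
  apply: etrans (rowK _ _) _; rewrite row_mul mul_cform rU qd.
  have -> : invmx (rho c *m P) = invmx P *m rho c'.
    by rewrite rho_inv invmx_mul ?rho_unit.
  exact: (congr1 (@coefrow n d K) (esym (subst_comp (invmx P) (rho c') q))).
exists U => //; rewrite -row_free_unit -row_leq_rank.
have := cform_free s (P := rho c *m P); rewrite unitmx_mul rho_unit PU => /(_ isT).
by rewrite fE -row_leq_rank => /leq_trans; apply; exact: mxrankM_maxl.
Qed.

Lemma cform_zero (K : fieldType) (s : {rmorphism F -> K}) (P : 'M[K]_n) (R : comNzRingType)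
    (t : {rmorphism K -> R}) (M : 'M[R]_n) : P \in unitmx ->
  map_mx t (cform s P) *m monvec d M = 0 <->
  forall i, evm (t \o s) (M *m map_mx t (invmx P)) (polyrow (row i B)) = 0.
Proof.
move=> PU; have e i : (map_mx t (cform s P) *m monvec d M) i 0 =
    evm (t \o s) (M *m map_mx t (invmx P)) (polyrow (row i B)).
  rewrite -evm_mpoly_along -evm_subst -(@coefrowK n d K (subst _ _)).
    by rewrite evm_polyrow !mxE; apply: eq_bigr => k _; rewrite !mxE.
  by apply: leq_trans (msize_subst _ _) _; rewrite mpoly_along_polyrow msize_polyrow.
split=> [h i|h]; first by rewrite -e h mxE.
by apply/colP => i; rewrite e h mxE.
Qed.

End FixedDegree.

Lemma ideal_basis_exists d : exists (r : nat) (B : 'M[F]_(r, #|{: bmultinom (n * n) d}|)),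
  [/\ forall i, pB (polyrow (row i B)) = 0, row_free B &
      forall v, pB (polyrow v) = 0 -> (v <= B)%MS].
Proof. exact: (row_family_basis (fun v => pB (polyrow v) = 0)). Qed.

(** Keeping the forms of all degrees dispenses with a finite set of generators for the ideal of
    rho(G). *)
Lemma coset_forms : exists (r : nat -> nat)
    (Cf : forall d (K : fieldType), {rmorphism F -> K} -> 'M[K]_n ->
       'M[K]_(r d, #|{: bmultinom (n * n) d}|)),
  [/\ forall d (K L : fieldType) (s : {rmorphism F -> K}) (e : {rmorphism K -> L}) P,
        map_mx e (Cf d K s P) = Cf d L (e \o s) (map_mx e P),
      forall d (K : fieldType) (s : {rmorphism F -> K}) (c : pt G s) P, P \in unitmx ->
        Cf d K s (rho c *m P) = Cf d K s P &
      forall (K : fieldType) (s : {rmorphism F -> K}) P (R : comNzRingType)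
        (t : {rmorphism K -> R}) (M : 'M[R]_n), P \in unitmx ->
        (forall d, map_mx t (Cf d K s P) *m monvec d M = 0) <->
        exists x : pt G (t \o s), M = rho x *m map_mx t P].
Proof.
pose r d := projT1 (cid (ideal_basis_exists d)).
pose B d : 'M[F]_(r d, _) := projT1 (cid (projT2 (cid (ideal_basis_exists d)))).
have BP d : [/\ forall i, pB (polyrow (row i (B d))) = 0, row_free (B d) &
      forall v, pB (polyrow v) = 0 -> (v <= B d)%MS].
  exact: (projT2 (cid (projT2 (cid (ideal_basis_exists d))))).
exists r, (fun d K s P => canon_mx (cform (B d) s P)); split.
- by move=> d K L s e P; rewrite map_canon_mx cform_natural.
- move=> d K s c P PU; have [B0 Bf Bmax] := BP d.
  have [u uU ->] := cform_coset B0 Bf Bmax c PU.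
  by rewrite canon_mx_mul //; exact: cform_free.
move=> K s P R t M PU.
have zero d : map_mx t (canon_mx (cform (B d) s P)) *m monvec d M = 0 <->
    forall i, evm (t \o s) (M *m map_mx t (invmx P)) (polyrow (row i (B d))) = 0.
  have [u uU ->] := canon_mxP (cform (B d) s P).
  rewrite -cform_zero // map_mxM -mulmxA; split=> [e|->]; last by rewrite mulmx0.
  rewrite -[LHS]mul1mx -(map_mx1 t) -(mulVmx uU) map_mxM -mulmxA e mulmx0.
  by [].
split=> [all0|[x xE] d]; last first.
  apply: (zero d).2 => i; have [B0 _ _] := BP d.
  by rewrite xE -mulmxA -map_mxM mulmxV // map_mx1 mulmx1 -pt_evm B0 rmorph0.
have [h h0|x xE] := @rho_image R (t \o s) (M *m map_mx t (invmx P)).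
  have [_ _ Bmax] := BP (msize h).
  have /Bmax/submxP[D DE] : pB (polyrow (coefrow (msize h) h)) = 0 by rewrite coefrowK.
  rewrite -(coefrowK (leqnn (msize h))) DE polyrow_sum rmorph_sum big1 // => i _.
  by rewrite -mul_mpolyC rmorphM /= (zero (msize h)).1 ?mulr0.
by exists x; rewrite xE -mulmxA -map_mxM mulVmx // map_mx1 mulmx1.
Qed.

End CosetForm.

(** * Cohomology classes as matrices *)

Lemma galois_fixed_mx (K : fieldType) (S : separable_closure K) m n (M : 'M[S]_(m, n)) :
  (forall s : galois_aut S, map_mx s M = M) -> exists M0, map_mx (sep_incl S) M0 = M.
Proof.
move=> fixM.
have ex i j : exists c, sep_incl S c = M i j.
  by apply: galois_fixed => s; rewrite -[in RHS](fixM s) mxE.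
have [c cE] := choice (fun ij : 'I_m * 'I_n => ex ij.1 ij.2).
by exists (\matrix_(i, j) c (i, j)); apply/matrixP => i j; rewrite !mxE cE.
Qed.

Section MatrixCohomology.
Variables (F : fieldType) (G : group_scheme F) (n : nat) (b : 'M[coord G]_n).
Variable pB : {rmorphism {mpoly F[n * n]} -> coord G}.
Hypothesis pBC : forall c, pB c%:MP = calg_str (coord G) c.
Hypothesis pBX : forall k, pB 'X_k = mxvec b 0 k.
Hypothesis pBS : forall a, exists h, pB h = a.
Hypothesis bM : forall (R : comNzRingType) (s : {rmorphism F -> R}) (x y : points G (CAlg s)),
  map_mx (gmul x y : pt G s) b = map_mx x b *m map_mx y b.
Hypothesis b1 : forall (R : comNzRingType) (s : {rmorphism F -> R}),
  map_mx (gone : pt G s) b = 1%:M.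

Let rhoM (R : comNzRingType) (s : {rmorphism F -> R}) (x y : pt G s) :
  rho b (gmul x y : pt G s) = rho b x *m rho b y.
Proof. exact: bM. Qed.

Let rhoU (K : fieldType) (s : {rmorphism F -> K}) (x : pt G s) : rho b x \in unitmx.
Proof. exact: (rho_unit bM b1). Qed.

Section OneField.
Variables (K : fieldType) (phi : {rmorphism F -> K}) (S : separable_closure K).
Local Notation psi := (sep_incl S \o phi).

Lemma rho_gal_act (s : galois_aut S) (x : pt G psi) :
  rho b (gal_act s x : pt G psi) = map_mx s (rho b x).
Proof. by rewrite /rho -map_mx_comp. Qed.

(* The class of c in H^1(K, G) corresponds to the double coset of p in
   rho(G(K^sep)) \ GL_n(K^sep) / GL_n(K).                                       *)
Definition trivializes (c : cocycle G phi S) (p : 'M[S]_n) :=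
  p \in unitmx /\ forall s, rho b (c s : pt G psi) *m map_mx s p = p.

Definition admissible (p : 'M[S]_n) :=
  p \in unitmx /\ forall s : galois_aut S, exists c : pt G psi, rho b c *m map_mx s p = p.

Lemma cocycle_trivializes (c : cocycle G phi S) : exists p, trivializes c p.
Proof.
have [||s|p pU pE] := @hilbert90 K S n (fun s => rho b (c s : pt G psi)).
- by move=> s; exact: rhoU.
- by move=> s t; rewrite coc_mul rhoM rho_gal_act.
- by have [l lP] := coc_cont c s; exists l => t /lP ->.
by exists p.
Qed.

(** Since rho is injective and [p] invertible, [c s] is determined by [p] and [map_mx s p]. The
    cocycle law follows, and so does continuity, because [c s] depends only on the action of [s] on
    the entries of [p]. *)
Lemma admissible_cocycle (p : 'M[S]_n) : admissible p ->
  exists c : cocycle G phi S, trivializes c p.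
Proof.
move=> [pU /choice[c cE]].
have spU (s : galois_aut S) : map_mx s p \in unitmx by rewrite map_unitmx.
have cM s t : c (gal_mul s t) = gmul (c s) (gal_act s (c t)).
  apply: (rho_inj pBC pBX pBS); rewrite (rhoM (c s)) rho_gal_act.
  apply: (can_inj (mulmxK (spU (gal_mul s t)))).
  rewrite cE -mulmxA /= map_mx_comp -map_mxM.
  by rewrite -[X in _ = rho b (c s) *m X]/(map_mx s (rho b (c t) *m map_mx t p)) !cE.
have cC : krull_continuous c.
  move=> s; exists [seq p ij.1 ij.2 | ij <- enum {: 'I_n * 'I_n}] => t tP.
  apply: (rho_inj pBC pBX pBS); apply: (can_inj (mulmxK (spU t))).
  rewrite cE -[LHS](cE s); congr (_ *m _); apply/matrixP => i j; rewrite !mxE.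
  by rewrite tP //; apply/mapP; exists (i, j); rewrite ?mem_enum.
by exists (@Cocycle F G K phi S c cM cC).
Qed.

(** If [a] makes the cocycles cohomologous, then [p^-1 rho(a) q] is Galois invariant, hence defined
    over [K]. *)
Lemma cohomologous_trivializes (c d : cocycle G phi S) p q :
  trivializes c p -> trivializes d q ->
  cohomologous c d <-> exists (a : pt G psi) (u : 'M[K]_n),
    u \in unitmx /\ q = rho b a *m p *m map_mx (sep_incl S) u.
Proof.
move=> [pU pE] [qU qE]; split=> [[a aE]|[a [u [uU quE]]]].
- have [s|u uE] := @galois_fixed_mx K S n n (invmx p *m rho b (a : pt G psi) *m q).
    have := qE s; rewrite aE (rhoM (ginv a : pt G psi)) (rhoM (c s)) rho_gal_act.
    rewrite (rho_inv bM b1) => qsE.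
    rewrite !map_mxM map_invmx -[RHS]mulmxA -[in RHS]qsE !mulmxA.
    rewrite mulmxK; last exact: rhoU.
    congr (_ *m _ *m _).
    have spU : map_mx s p \in unitmx by rewrite map_unitmx.
    apply: (can_inj (mulmxK spU)); rewrite mulVmx // -mulmxA.
    by rewrite [X in invmx p *m X]pE mulVmx.
  exists (ginv a), u; split.
    by rewrite -(map_unitmx (sep_incl S)) uE !unitmx_mul unitmx_inv pU qU rhoU.
  by rewrite uE (rho_inv bM b1) !mulmxA mulmxK // mulVmx ?rhoU // mul1mx.
exists (ginv a) => s; rewrite ginvK.
apply: (rho_inj pBC pBX pBS); rewrite (rhoM a) (rhoM (c s)).
have aU : rho b (gal_act s a : pt G psi) \in unitmx by exact: rhoU.
rewrite gal_actV (rho_inv bM b1) mulmxA; apply: (can_inj (mulmxK aU)).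
rewrite mulmxKV //.
have sqU : map_mx s (p *m map_mx (sep_incl S) u) \in unitmx.
  by rewrite map_unitmx unitmx_mul map_unitmx pU.
apply: (can_inj (mulmxK sqU)); rewrite rho_gal_act -mulmxA -map_mxM.
rewrite mulmxA -quE qE map_mxM.
have -> : map_mx s (map_mx (sep_incl S) u) = map_mx (sep_incl S) u.
  by rewrite -map_mx_comp; apply: eq_map_mx => z /=; rewrite gal_fix.
by rewrite !mulmxA -(mulmxA (rho b a)) pE.
Qed.

Definition H1_mx (x : H1 G phi S) (p : 'M[S]_n) :=
  exists2 c, H1_class c = x & trivializes c p.

Lemma H1_mx_total x : exists p, H1_mx x p.
Proof.
have [p pP] := cocycle_trivializes (H1_repr x).
by exists p, (H1_repr x) => //; exact: H1_reprK.
Qed.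

Lemma H1_mx_exists p : admissible p -> exists x, H1_mx x p.
Proof. by move=> /admissible_cocycle[c cp]; exists (H1_class c), c. Qed.

Lemma H1_mx_admissible x p : H1_mx x p -> admissible p.
Proof. by move=> [c _ [pU pE]]; split=> // s; exists (c s). Qed.

Lemma H1_mx_eq x y p q : H1_mx x p -> H1_mx y q ->
  x = y <-> exists (a : pt G psi) (u : 'M[K]_n),
    u \in unitmx /\ q = rho b a *m p *m map_mx (sep_incl S) u.
Proof.
by move=> [c <- cp] [d <- dq]; rewrite -(cohomologous_trivializes cp dq); exact: H1_eqP.
Qed.

Lemma H1_mx_point : H1_mx (H1_point G phi S) 1%:M.
Proof.
exists (trivial_cocycle G phi S) => //; split=> [|s]; first exact: unitmx1.
by rewrite map_mx1 mulmx1; exact: b1.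
Qed.

End OneField.

Lemma H1_mx_map (K L : fieldType) (phi : {rmorphism F -> K}) (psi : {rmorphism F -> L})
    (j : {rmorphism K -> L}) (jphi : forall c, j (phi c) = psi c)
    (S : separable_closure K) (T : separable_closure L) (e : sep_embedding j S T)
    (x : H1 G phi S) (p : 'M[S]_n) :
  H1_mx x p -> H1_mx (H1_map jphi e x) (map_mx e p).
Proof.
move=> [c <- [pU pE]]; exists (cocycle_map jphi e c); first by rewrite H1_mapE.
split=> [|s]; first by rewrite map_unitmx.
rewrite -[in RHS](pE (gal_res e s)) map_mxM -!map_mx_comp.
congr (_ *m _).
by apply: eq_map_mx => z /=; rewrite gal_resE.
Qed.

End MatrixCohomology.

(** * Patching and descent *)

Lemma surjective_lfun_bij (K : fieldType) (V W : vectType K) (f : 'Hom(V, W)) :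
  \dim {: V} = \dim {: W} -> (forall w, exists v, f v = w) -> bijective f.
Proof.
move=> dVW fS; have fT : limg f = fullv.
  by apply/vspaceP => w; have [v <-] := fS w; rewrite memvf memv_img ?memvf.
have fK : lker f == 0%VS.
  have := limg_ker_dim f fullv; rewrite fT dVW capfv.
  by rewrite -dimv_eq0 => /eqP; rewrite -{2}[\dim {: W}]add0n eqn_add2r.
exists (f^-1)%VF; first exact: lker0_lfunK.
by move=> w; apply: limg_lfunVK; rewrite fT memvf.
Qed.

Section SystemLimit.
Variables (F : fieldType) (S : factorization_system F) (o : edge_ordering S).
Local Notation l := (left_end o).
Local Notation r := (right_end o).
Local Notation incl_l k := (incl (left_in o k)).
Local Notation incl_r k := (incl (right_in o k)).

(** Without vertices there would be no edges, and the limit would be the zero ring. *)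
Lemma vert_inhabited : inhabited (vert S).
Proof.
apply: contrapT => nv.
have ne : edge S -> False.
  by move=> k; have := card_ends k; rewrite (@eq_card0 _ (ends S k)) // => i; case: nv.
have [c [_ cE]] := @fs_limit F S (fun i => 0) (fun k => 0) (fun i => False_ind _ (nv (inhabits i))).
have c0 : c = 0 by apply: cE; split=> [i|k]; [case: nv | case: ne].
have c1 : c = 1 by apply: cE; split=> [i|k]; [case: nv | case: ne].
by have := oner_neq0 F; rewrite -c1 c0 eqxx.
Qed.

Lemma ends_cases k i : i \in ends S k -> i = l k \/ i = r k.
Proof.
have -> : ends S k = [set l k; r k].
  apply/esym/eqP; rewrite eqEcard card_ends cards2 left_neq_right andbT.
  by apply/fintype.subsetP => j /set2P[] ->; [exact: left_in | exact: right_in].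
by move=> /set2P.
Qed.

Lemma limit_elt (a : forall i, fld_v S i) :
  (forall k, incl_l k (a (l k)) = incl_r k (a (r k))) ->
  exists c, forall i, cone_v S i c = a i.
Proof.
move=> aP; have [|c [[cv _] _]] := @fs_limit F S a (fun k => incl_l k (a (l k))); last by exists c.
move=> i k ik; have [e|e] := ends_cases ik; subst i.
- by rewrite (bool_irrelevance ik (left_in o k)).
- by rewrite (bool_irrelevance ik (right_in o k)) aP.
Qed.

Lemma limit_mx m n (M : forall i, 'M[fld_v S i]_(m, n)) :
  (forall k, map_mx (incl_l k) (M (l k)) = map_mx (incl_r k) (M (r k))) ->
  exists M0, forall i, map_mx (cone_v S i) M0 = M i.
Proof.
move=> MP.
have ex (x : 'I_m * 'I_n) : exists c, forall i, cone_v S i c = M i x.1 x.2.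
  by apply: limit_elt => k; have /matrixP/(_ x.1 x.2) := MP k; rewrite !mxE.
have [c cE] := choice ex.
by exists (\matrix_(x, y) c (x, y)) => i; apply/matrixP => x y; rewrite !mxE cE.
Qed.

Section PatchMatrices.
Variables (n : nat) (u : forall k, 'M[fld_e S k]_n).
Hypothesis uU : forall k, u k \in unitmx.

(** Free modules are glued by the standard isomorphism at the left end and by [u k] at the right
    end. *)
Definition glue_mx k (i : vert S) : 'M[fld_e S k]_n := if i == r k then u k else 1%:M.

Lemma glue_mx_unit k i : glue_mx k i \in unitmx.
Proof. by rewrite /glue_mx; case: ifP => // _; rewrite unitmx1. Qed.

Definition glue_fun i k (ik : i \in ends S k) (v : 'rV[fld_v S i]_n) : 'rV[fld_e S k]_n :=
  map_mx (incl ik) v *m glue_mx k i.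

Lemma glue_fun_semilinear i k (ik : i \in ends S k) :
  semilinear_along (incl ik) (V := 'rV_n) (W := 'rV_n) (glue_fun ik).
Proof. by move=> a v w; rewrite /glue_fun map_mxD map_mxZ mulmxDl scalemxAl. Qed.

Definition glue_lfun i k (ik : i \in ends S k) :=
  ext_lift (incl ik) (V := 'rV_n) (W := 'rV_n) (glue_fun ik).

Lemma glue_lfun_bij i k (ik : i \in ends S k) : bijective (glue_lfun ik).
Proof.
apply: surjective_lfun_bij => [|w]; first by rewrite !dimvf /dim /= !mul1n dimvf /dim /= mul1n.
pose x := w *m invmx (glue_mx k i).
exists (\sum_j x 0 j *: ext_elt (incl ik) (V := 'rV_n) (delta_mx 0 j)).
rewrite linear_sum -[RHS](mulmxKV (glue_mx_unit k i)) -/x mulmx_sum_row.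
apply: eq_bigr => j _; rewrite linearZ /= ext_liftE; last exact: glue_fun_semilinear.
by rewrite /glue_fun map_delta_mx -rowE.
Qed.

Definition glue_problem : pp_problem S :=
  @PPProblem F S (fun i => 'rV_n) (fun k => 'rV_n) glue_lfun glue_lfun_bij.

(** Essential surjectivity: the glued problem is isomorphic to a base change, and [A], [A'] are the
    matrices of the isomorphism and its inverse at the vertices. *)
Lemma glue_problem_trivial : is_equivalence (base_change S) ->
  exists (m : nat) (A : forall i, 'M[fld_v S i]_(m, n)) (A' : forall i, 'M[fld_v S i]_(n, m)),
    [/\ forall i, A i *m A' i = 1%:M, forall i, A' i *m A i = 1%:M &
        forall k, map_mx (incl_r k) (A (r k)) *m u k = map_mx (incl_l k) (A (l k))].
Proof.
move=> [K [_ [e]]]; pose V : vectType F := K glue_problem.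
pose f : pp_hom (base_change_obj S V) glue_problem := nat_to e glue_problem.
pose g : pp_hom glue_problem (base_change_obj S V) := nat_from e glue_problem.
have gf : pp_comp g f = pp_id _ := nat_toK e glue_problem.
have fg : pp_comp f g = pp_id _ := nat_fromK e glue_problem.
pose A i : 'M[fld_v S i]_(\dim {: V}, n) := lin1_mx (pp_hom_v f i : 'rV_(\dim {: V}) -> 'rV_n).
pose A' i : 'M[fld_v S i]_(n, \dim {: V}) := lin1_mx (pp_hom_v g i : 'rV_n -> 'rV_(\dim {: V})).
have AE i (x : 'rV_(\dim {: V})) : x *m A i = pp_hom_v f i x by rewrite mul_rV_lin1.
have A'E i (x : 'rV_n) : x *m A' i = pp_hom_v g i x by rewrite mul_rV_lin1.
exists (\dim {: V}), A, A'; split=> [i|i|k].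
- apply/row_matrixP => j; rewrite row_mul rowE -!mulmxA mulmxA AE A'E rowE mulmx1.
  have := congr1 (fun h => pp_hom_v h i) gf => /= /lfunP/(_ (delta_mx 0 j)).
  by rewrite comp_lfunE id_lfunE.
- apply/row_matrixP => j; rewrite row_mul rowE -!mulmxA mulmxA A'E AE rowE mulmx1.
  have := congr1 (fun h => pp_hom_v h i) fg => /= /lfunP/(_ (delta_mx 0 j)).
  by rewrite comp_lfunE id_lfunE.
pose B : 'M[fld_e S k]_(\dim {: V}, n) := lin1_mx (pp_hom_e f k : 'rV_(\dim {: V}) -> 'rV_n).
have glueE i (ik : i \in ends S k) : map_mx (incl ik) (A i) *m glue_mx k i = B.
  apply/row_matrixP => j.
  have := pp_hom_glue f ik => /lfunP/(_ (ext_elt (incl ik) (V := 'rV_(\dim {: V})) (delta_mx 0 j))).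
  rewrite !comp_lfunE ext_mapE /= ext_liftE; last exact: glue_fun_semilinear.
  rewrite (ext_extE (phi := cone_v S i) (cone_e S k) (incl ik)) map_delta_mx.
  rewrite /glue_fun -AE map_mxM map_delta_mx => e1.
  by rewrite rowE mulmxA e1 rowE mul_rV_lin1.
rewrite -[LHS]/(map_mx (incl_r k) (A (r k)) *m u k).
have := glueE _ (right_in o k); rewrite /glue_mx eqxx => ->.
by rewrite -(glueE _ (left_in o k)) /glue_mx (negbTE (left_neq_right o k)) mulmx1.
Qed.

Lemma patch_GL : is_equivalence (base_change S) ->
  exists p : forall i, 'M[fld_v S i]_n, (forall i, p i \in unitmx) /\
    forall k, u k *m map_mx (incl_l k) (p (l k)) = map_mx (incl_r k) (p (r k)).
Proof.
move=> /glue_problem_trivial[m [A [A' [AA' A'A AP]]]]; have [i0] := vert_inhabited.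
have mn : m = n.
  by apply/eqP; rewrite eqn_leq (mulmx1_min (AA' i0)) (mulmx1_min (A'A i0)).
subst m; exists A'; split=> [i|k]; first by case/mulmx1_unit: (AA' i).
rewrite -[LHS]mul1mx -(map_mx1 (incl_r k)) -(A'A (r k)) map_mxM -!mulmxA.
by rewrite (mulmxA _ (u k)) AP -map_mxM AA' map_mx1 mulmx1.
Qed.

End PatchMatrices.
End SystemLimit.

(** * The torsor over F and its point over the separable closure *)

Section Descent.
Variables (F : fieldType) (G : group_scheme F) (n : nat) (b : 'M[coord G]_n).
Variable pB : {rmorphism {mpoly F[n * n]} -> coord G}.
Hypothesis pBC : forall c, pB c%:MP = calg_str (coord G) c.
Hypothesis pBX : forall k, pB 'X_k = mxvec b 0 k.
Hypothesis pBS : forall a, exists h, pB h = a.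
Hypothesis bM : forall (R : comNzRingType) (s : {rmorphism F -> R}) (x y : points G (CAlg s)),
  map_mx (gmul x y : pt G s) b = map_mx x b *m map_mx y b.
Hypothesis b1 : forall (R : comNzRingType) (s : {rmorphism F -> R}),
  map_mx (gone : pt G s) b = 1%:M.

(** The equations of rho(G) have coefficients in [F], so they can be tested after an embedding of
    fields. *)
Lemma rho_descent (K L : fieldType) (s : {rmorphism F -> K}) (s' : {rmorphism F -> L})
    (e : {rmorphism K -> L}) (M : 'M[K]_n) (x : pt G s') :
  (forall c, e (s c) = s' c) -> rho b x = map_mx e M -> exists y : pt G s, rho b y = M.
Proof.
move=> es xM; apply: (rho_image pBC pBX pBS) => h h0; apply: (fmorph_inj e).
have es' : e \o s = s' :> {rmorphism F -> L} by apply: rmorphism_eq.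
by rewrite evm_natural es' -xM -(pt_evm pBC pBX) h0 !rmorph0.
Qed.

Variables (S : factorization_system F) (o : edge_ordering S) (C : closure_system S).
Hypothesis smG : formally_smooth G.
Local Notation l := (left_end o).
Local Notation r := (right_end o).
Local Notation psi i := (sep_incl (sep_v C i) \o cone_v S i).
Local Notation psi_e k := (sep_incl (sep_e C k) \o cone_e S k).
Local Notation psi0 := (sep_incl (sep_base C) \o idfun).
Local Notation emb_l k := (emb_incl C (left_in o k)).
Local Notation emb_r k := (emb_incl C (right_in o k)).

Variable p : forall i, 'M[sep_v C i]_n.
Hypothesis p_adm : forall i, admissible b (cone_v S i) (p i).
Hypothesis p_agree : forall k, exists c : pt G (psi_e k),
  map_mx (emb_l k) (p (l k)) = rho b c *m map_mx (emb_r k) (p (r k)).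

Lemma coset_equations : exists I : {mpoly F[n * n]} -> Prop,
  forall i (R : comNzRingType) (t : {rmorphism sep_v C i -> R}) (s : {rmorphism F -> R}) (M : 'M[R]_n),
  (forall c, t (psi i c) = s c) ->
  (forall h, I h -> evm s M h = 0) <-> exists x : pt G s, M = rho b x *m map_mx t (p i).
Proof.
have [w [Cf [Cnat Cinv Czero]]] := coset_forms pBC pBX pBS bM b1.
have fixC d i (s : galois_aut (sep_v C i)) :
    map_mx s (Cf d _ (psi i) (p i)) = Cf d _ (psi i) (p i).
  have [pU /(_ s)[c cE]] := p_adm i.
  have spsi : s \o psi i = psi i :> {rmorphism F -> _} by apply: rmorphism_eq => z /=; rewrite gal_fix.
  by rewrite Cnat spsi -[in RHS]cE [RHS]Cinv // map_unitmx.
have formE d : exists A0, forall i, map_mx (psi i) A0 = Cf d _ (psi i) (p i).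
  pose M i := projT1 (cid (galois_fixed_mx (fixC d i))).
  have ME i : map_mx (sep_incl (sep_v C i)) (M i) = Cf d _ (psi i) (p i).
    exact: (projT2 (cid (galois_fixed_mx (fixC d i)))).
  have [|A0 A0E] := @limit_mx F S o _ _ M; last by exists A0 => i; rewrite map_mx_comp A0E ME.
  move=> k.
  have embE i (ik : i \in ends S k) :
      map_mx (sep_incl (sep_e C k)) (map_mx (incl ik) (M i)) =
      Cf d _ (psi_e k) (map_mx (emb_incl C ik) (p i)).
    have epsi : emb_incl C ik \o psi i = psi_e k :> {rmorphism F -> _}.
      by apply: rmorphism_eq => z /=; rewrite emb_str cone_incl.
    rewrite -epsi -Cnat -ME -!map_mx_comp; apply: eq_map_mx => z /=.
    by rewrite emb_str.
  apply: (map_mx_inj (f := sep_incl (sep_e C k))); rewrite !embE.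
  (* Over [F_k^sep] both sides are forms of one and the same coset. *)
  have [c ->] := p_agree k; apply: Cinv.
  by rewrite map_unitmx; case: (p_adm (r k)).
pose A0 d := projT1 (cid (formE d)).
have A0E d i : map_mx (psi i) (A0 d) = Cf d _ (psi i) (p i).
  exact: (projT2 (cid (formE d)) i).
exists (fun h => exists d j, h = polyrow (row j (A0 d))) => i R t s M ts.
have {}ts : t \o psi i = s :> {rmorphism F -> R} by apply: rmorphism_eq => z; exact: ts.
rewrite -ts -Czero; last by case: (p_adm i).
have e d : map_mx t (Cf d _ (psi i) (p i)) = map_mx (t \o psi i) (A0 d).
  by rewrite map_mx_comp A0E.
split=> [M0 d|M0 h [d [j ->]]]; last first.
  by rewrite evm_polyrow map_row -row_mul -e M0 !mxE.
apply/colP => j; rewrite e [RHS]mxE -(M0 (polyrow (row j (A0 d)))); last by exists d, j.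
by rewrite evm_polyrow map_row -row_mul [RHS]mxE.
Qed.

(** The coset is a translate of G by [p i], so lifting the group element lifts the matrix. *)
Lemma coset_equations_smooth I i :
  (forall (R : comNzRingType) (t : {rmorphism sep_v C i -> R}) (s : {rmorphism F -> R}) (M : 'M[R]_n),
    (forall c, t (psi i c) = s c) ->
    (forall h, I h -> evm s M h = 0) <-> exists x : pt G s, M = rho b x *m map_mx t (p i)) ->
  smooth_zeros (psi i) I.
Proof.
move=> IP R T sR g gS g0 y y0.
have evmE (Q : comNzRingType) (s : {rmorphism F -> Q}) (z : 'I_(n * n) -> Q) h :
    evm s (vec_mx (\row_k z k)) h = mmap s z h.
  by apply: eq_mmap => // k; rewrite vec_mxK mxE.
pose s : {rmorphism F -> T} := g \o (sR \o psi i).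
have [||x xE] := (IP T (g \o sR) s (vec_mx (\row_k y k)) _).1.
- by [].
- by move=> h Ih; rewrite evmE; exact: y0.
pose hg : alghom (CAlg (sR \o psi i)) (CAlg s) :=
  @AlgHom F (CAlg (sR \o psi i)) (CAlg s) g (fun=> erefl).
have [x' x'E] := smG (h := hg) gS g0 x.
pose X := rho b (x' : pt G (sR \o psi i)) *m map_mx sR (p i).
exists (fun k => mxvec X 0 k); split=> [h Ih|k].
  rewrite -evmE; have -> : \row_k mxvec X 0 k = mxvec X by apply/rowP => k; rewrite mxE.
  by rewrite mxvecK; apply: (IP R sR (sR \o psi i) X (fun=> erefl)).2 h Ih; exists x'.
rewrite /= -[X in X = _]/((fun a : 'rV_(n * n) => g (a 0 k)) (mxvec X)).
have -> : y k = mxvec (vec_mx (\row_k y k)) 0 k by rewrite vec_mxK mxE.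
have -> : g (mxvec X 0 k) = mxvec (map_mx g X) 0 k by rewrite -map_mxvec mxE.
congr (mxvec _ 0 k); rewrite xE map_mxM -x'E.
by rewrite (rho_natural b (g := g) (h := hg)) // -map_mx_comp.
Qed.

Lemma coset_point : exists q : 'M[sep_base C]_n,
  admissible b (idfun : {rmorphism F -> F}) q /\
  forall i, exists x : pt G (psi i), map_mx (emb_cone C i) q = rho b x *m p i.
Proof.
have [I IP] := coset_equations; have [i0] := vert_inhabited S.
have [h Ih|z zE] := smooth_zeros_sep_point (coset_equations_smooth (IP i0))
    (x0 := fun k => mxvec (p i0) 0 k) _ (sep_base C).
  apply: (IP i0 _ idfun (psi i0) (p i0) (fun=> erefl)).2 h Ih.
  by exists gone; rewrite /rho b1 mul1mx map_mx_id.
pose q : 'M_n := vec_mx (\row_k z k).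
have qI h : I h -> evm psi0 q h = 0.
  move=> Ih; rewrite -[RHS](zE h Ih); apply: eq_mmap => // k.
  by rewrite vec_mxK mxE.
have epsi i c : emb_cone C i (psi0 c) = psi i c by rewrite /= emb_str.
have coset i (q' : 'M_n) : (forall h, I h -> evm psi0 q' h = 0) ->
    exists x : pt G (psi i), map_mx (emb_cone C i) q' = rho b x *m p i.
  move=> q'I.
  have [h Ih|x xE] := (IP i _ idfun (psi i) (map_mx (emb_cone C i) q') (fun=> erefl)).1.
    have <- : emb_cone C i \o psi0 = psi i :> {rmorphism F -> _}.
      by apply: rmorphism_eq => c; exact: epsi.
    by rewrite -evm_natural q'I // rmorph0.
  by exists x; rewrite xE map_mx_id.
exists q; split; last by move=> i; exact: coset.
have unit_of q' : (forall h, I h -> evm psi0 q' h = 0) -> q' \in unitmx.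
  move=> q'I; rewrite -(map_unitmx (emb_cone C i0)); have [x ->] := coset i0 q' q'I.
  by rewrite unitmx_mul (rho_unit bM b1); case: (p_adm i0).
split=> [|s]; first exact: unit_of.
have sqI h : I h -> evm psi0 (map_mx s q) h = 0.
  move=> Ih; have <- : s \o psi0 = psi0 :> {rmorphism F -> _}.
    by apply: rmorphism_eq => c /=; rewrite gal_fix.
  by rewrite -evm_natural qI // rmorph0.
(* [q] and its conjugate lie in one coset over [F_i0^sep]; their quotient is in rho(G) there, and
   descends to [F^sep]. *)
have [x xE] := coset i0 q qI; have [x' x'E] := coset i0 _ sqI.
have sqU := unit_of _ sqI.
have [|y yE] := @rho_descent _ _ psi0 (psi i0) (emb_cone C i0) (q *m invmx (map_mx s q))
    (gmul x (ginv x')) (epsi i0).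
  rewrite map_mxM map_invmx xE x'E invmx_mul ?(rho_unit bM b1) //; last by case: (p_adm i0).
  rewrite [LHS]bM -(rho_inv bM b1) mulmxA mulmxK //.
  by case: (p_adm i0).
by exists y; rewrite yE mulmxKV.
Qed.
End Descent.

(** * The connecting map and exactness *)

Section ExactSequence.
Variables (F : fieldType) (G : group_scheme F) (n : nat) (b : 'M[coord G]_n).
Variable pB : {rmorphism {mpoly F[n * n]} -> coord G}.
Hypothesis pBC : forall c, pB c%:MP = calg_str (coord G) c.
Hypothesis pBX : forall k, pB 'X_k = mxvec b 0 k.
Hypothesis pBS : forall a, exists h, pB h = a.
Hypothesis bM : forall (R : comNzRingType) (s : {rmorphism F -> R}) (x y : points G (CAlg s)),
  map_mx (gmul x y : pt G s) b = map_mx x b *m map_mx y b.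
Hypothesis b1 : forall (R : comNzRingType) (s : {rmorphism F -> R}),
  map_mx (gone : pt G s) b = 1%:M.

Let rhoM (R : comNzRingType) (s : {rmorphism F -> R}) (x y : pt G s) :
  rho b (gmul x y : pt G s) = rho b x *m rho b y.
Proof. exact: bM. Qed.

Let rho1 (R : comNzRingType) (s : {rmorphism F -> R}) : rho b (gone : pt G s) = 1%:M.
Proof. exact: b1. Qed.

Let rhoU (K : fieldType) (s : {rmorphism F -> K}) (x : pt G s) : rho b x \in unitmx.
Proof. exact: (rho_unit bM b1). Qed.

Let rhoI (K : fieldType) (s : {rmorphism F -> K}) (x : pt G s) :
  rho b (ginv x : pt G s) = invmx (rho b x).
Proof. exact: (rho_inv bM b1). Qed.

Let rho_eq (R : comNzRingType) (s : {rmorphism F -> R}) (x y : pt G s) :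
  rho b x = rho b y -> x = y.
Proof. exact: (rho_inj pBC pBX pBS). Qed.

Lemma rho_push (R R' : comNzRingType) (s : {rmorphism F -> R}) (s' : {rmorphism F -> R'})
    (e : {rmorphism R -> R'}) (x : pt G s) :
  (forall c, e (s c) = s' c) -> exists y : pt G s', rho b y = map_mx e (rho b x).
Proof.
move=> es; exists (alghom_comp (@AlgHom F (CAlg s) (CAlg s') e es) x).
by rewrite /rho -map_mx_comp.
Qed.

Lemma rho_points_map (K L : fieldType) (s : {rmorphism F -> K}) (s' : {rmorphism F -> L})
    (e : {rmorphism K -> L}) (es : forall c, e (s c) = s' c) (x : pt G s) :
  rho b (points_map es x : pt G s') = map_mx e (rho b x).
Proof. by rewrite /rho -map_mx_comp. Qed.

Lemma coset_descent (K : fieldType) (phi : {rmorphism F -> K}) (L : fieldType)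
    (e : {rmorphism K -> L}) (M q : 'M[K]_n) (s' : {rmorphism F -> L}) (x : pt G s') :
  (forall c, e (phi c) = s' c) -> q \in unitmx -> map_mx e M = rho b x *m map_mx e q ->
  exists y : pt G phi, M = rho b y *m q.
Proof.
move=> es qU ME; have [|y yE] := rho_descent pBC pBX pBS (M := M *m invmx q) (x := x) es.
  by rewrite map_mxM ME map_invmx mulmxK // map_unitmx.
by exists y; rewrite yE mulmxKV.
Qed.

Variables (S : factorization_system F) (o : edge_ordering S) (C : closure_system S).
Hypothesis smG : formally_smooth G.
Hypothesis beta_equiv : is_equivalence (base_change S).
Local Notation l := (left_end o).
Local Notation r := (right_end o).
Local Notation incl_l k := (incl (left_in o k)).
Local Notation incl_r k := (incl (right_in o k)).
Local Notation sincl i := (sep_incl (sep_v C i)).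
Local Notation sincl_e k := (sep_incl (sep_e C k)).
Local Notation psi i := (sep_incl (sep_v C i) \o cone_v S i).
Local Notation psi_e k := (sep_incl (sep_e C k) \o cone_e S k).
Local Notation psi0 := (sep_incl (sep_base C) \o idfun).
Local Notation emb_l k := (emb_incl C (left_in o k)).
Local Notation emb_r k := (emb_incl C (right_in o k)).

Lemma map_emb_incl i k (ik : i \in ends S k) (M : 'M_n) :
  map_mx (emb_incl C ik) (map_mx (sincl i) M) = map_mx (sincl_e k) (map_mx (incl ik) M).
Proof. by rewrite -!map_mx_comp; apply: eq_map_mx => z /=; rewrite emb_str. Qed.

(** The two composite embeddings differ by an automorphism [t] of [F^sep], and admissibility says
    that [t] moves [q] within its coset. *)
Lemma emb_independent (q : 'M[sep_base C]_n) k : admissible b (idfun : {rmorphism F -> F}) q ->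
  exists c : pt G (psi_e k), map_mx (emb_l k) (map_mx (emb_cone C (l k)) q) =
    rho b c *m map_mx (emb_r k) (map_mx (emb_cone C (r k)) q).
Proof.
move=> [_ qP].
have [z|t tE] := @emb_differ _ (sep_base C) _ (emb_l k \o emb_cone C (l k)) (emb_r k \o emb_cone C (r k)).
  by rewrite /= !emb_str !cone_incl.
have [c cE] := qP t; rewrite -!map_mx_comp.
have [|y yE] := rho_push (e := emb_l k \o emb_cone C (l k)) (s' := psi_e k) c.
  by move=> z; rewrite /= !emb_str !cone_incl.
exists y; rewrite yE -{1}cE [LHS]map_mxM; congr (_ *m _).
by rewrite -map_mx_comp; apply: eq_map_mx => z; rewrite tE.
Qed.

(* The graph of the connecting map.                                             *)
Definition connecting (g : G_e S G) (x : H1_base G C) :=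
  exists (p : 'M[sep_base C]_n) (q : forall i, 'M[fld_v S i]_n),
  [/\ H1_mx b x p, forall i, q i \in unitmx,
      forall k, rho b (g k : pt G (cone_e S k)) *m map_mx (incl_l k) (q (l k)) =
        map_mx (incl_r k) (q (r k)) &
      forall i, exists c : pt G (psi i),
        map_mx (emb_cone C i) p = rho b c *m map_mx (sincl i) (q i)].

Lemma connecting_total g : exists x, connecting g x.
Proof.
have [q [qU qE]] := patch_GL o (fun k => rhoU (g k : pt G (cone_e S k))) beta_equiv.
have [i|k|p [p_adm pE]] := @coset_point _ _ _ _ _ pBC pBX pBS bM b1 _ o C smG
    (fun i => map_mx (sincl i) (q i)).
- split=> [|s]; first by rewrite map_unitmx qU.
  exists gone; rewrite rho1 mul1mx -map_mx_comp.
  by apply: eq_map_mx => z /=; rewrite gal_fix.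
- have [|y yE] := rho_push (e := sincl_e k) (s' := psi_e k) (ginv (g k) : pt G (cone_e S k)).
    by [].
  by exists y; rewrite !map_emb_incl yE -map_mxM -qE rhoI mulmxA mulVmx ?rhoU // mul1mx.
have [x xp] := H1_mx_exists pBC pBX pBS bM p_adm.
by exists x, p, q.
Qed.

(** Taken with equal families and trivial [h], this also shows that [x] is determined by [g]. *)
Lemma connecting_eq g g' x x' : connecting g x -> connecting g' x' ->
  x = x' <-> exists h : G_v S G, forall k,
    g k = gmul (ginv (G_right o G h k)) (gmul (g' k) (G_left o G h k)).
Proof.
move=> [p [q [xp qU qE pq]]] [p' [q' [xp' qU' qE' pq']]].
have [i0] := vert_inhabited S.
have map_qU i k (ik : i \in ends S k) : map_mx (incl ik) (q i) \in unitmx by rewrite map_unitmx qU.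
rewrite (H1_mx_eq pBC pBX pBS bM b1 xp xp'); split=> [[a [u [uU p'E]]]|[h hE]].
(* Over [F_i^sep] the two matrices lie in one coset because [p'] and [p u] do; both have entries in
   [F_i], so the group element descends. *)
- have ex i : exists y : pt G (cone_v S i), q' i = rho b y *m (q i *m map_mx (cone_v S i) u).
    have quU : q i *m map_mx (cone_v S i) u \in unitmx by rewrite unitmx_mul qU map_unitmx.
    have [c cE] := pq i; have [c' c'E] := pq' i.
    have [|y yE] := rho_push (e := emb_cone C i) (s' := psi i) a.
      by move=> z; rewrite /= emb_str.
    apply: (coset_descent (e := sincl i) (x := (gmul (ginv c') (gmul y c) : pt G (psi i)))) => //.
    rewrite (rhoM (ginv c')) (rhoM y) rhoI -[LHS](mulKmx (rhoU c')) -c'E p'E yE.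
    rewrite !map_mxM cE !mulmxA; congr (_ *m _).
    by rewrite -!map_mx_comp; apply: eq_map_mx => z /=; rewrite emb_str.
  pose h i := projT1 (cid (ex i)).
  have hE i : q' i = rho b (h i : pt G (cone_v S i)) *m (q i *m map_mx (cone_v S i) u).
    exact: (projT2 (cid (ex i))).
  exists h => k; apply: rho_eq; rewrite (rhoM (ginv (G_right o G h k))) (rhoM (g' k)) rhoI.
  rewrite !rho_points_map.
  have luU : map_mx (cone_e S k) u \in unitmx by rewrite map_unitmx.
  have coneE i (ik : i \in ends S k) :
      map_mx (incl ik) (map_mx (cone_v S i) u) = map_mx (cone_e S k) u.
    by rewrite -map_mx_comp; apply: eq_map_mx => z; rewrite /= cone_incl.
  have hU i (ik : i \in ends S k) :
      map_mx (incl ik) (rho b (h i : pt G (cone_v S i))) \in unitmx by rewrite map_unitmx rhoU.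
  have := qE' k; rewrite !hE !map_mxM !coneE !mulmxA => /(can_inj (mulmxK luU)).
  rewrite -(qE k) mulmxA => /(can_inj (mulmxK (map_qU _ _ (left_in o k)))) e.
  by rewrite -mulmxA e mulKmx // hU.
have hE' k : rho b (g' k : pt G (cone_e S k)) *m map_mx (incl_l k) (rho b (h (l k) : pt G (cone_v S _)) *m q (l k)) =
    map_mx (incl_r k) (rho b (h (r k) : pt G (cone_v S _)) *m q (r k)).
  rewrite !map_mxM -(qE k) hE (rhoM (ginv (G_right o G h k))) (rhoM (g' k)) rhoI.
  rewrite !rho_points_map !mulmxA mulmxV ?mul1mx //.
  by rewrite map_unitmx rhoU.
pose q2 i := rho b (h i : pt G (cone_v S i)) *m q i.
have q2U i : q2 i \in unitmx by rewrite unitmx_mul rhoU qU.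
(* Both families [q2] and [q'] solve the patching problem of [g'], so their quotients agree over the
   edges and come from [F]. *)
have [|u uE] := @limit_mx F S o n n (fun i => invmx (q2 i) *m q' i).
  move=> k; have e2 : map_mx (incl_l k) (q2 (l k)) =
      invmx (rho b (g' k : pt G (cone_e S k))) *m map_mx (incl_r k) (q2 (r k)).
    by rewrite -hE' mulKmx // rhoU.
  have e' : map_mx (incl_l k) (q' (l k)) =
      invmx (rho b (g' k : pt G (cone_e S k))) *m map_mx (incl_r k) (q' (r k)).
    by rewrite -qE' mulKmx // rhoU.
  rewrite !map_mxM !map_invmx e2 e' invmx_mul ?unitmx_inv ?map_unitmx ?rhoU ?q2U //.
  by rewrite invmxK !mulmxA mulmxK // rhoU.
have q'E i : q' i = q2 i *m map_mx (cone_v S i) u by rewrite uE mulKVmx ?q2U.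
have uU : u \in unitmx by rewrite -(map_unitmx (cone_v S i0)) uE unitmx_mul unitmx_inv q2U qU'.
have [c cE] := pq i0; have [c' c'E] := pq' i0.
have [|y yE] := rho_push (e := sincl i0) (s' := psi i0) (h i0 : pt G (cone_v S i0)).
  by [].
have [pU _] := H1_mx_admissible xp.
have [|||a aE] := @coset_descent _ psi0 _ (emb_cone C i0) p' (p *m map_mx (sep_incl (sep_base C)) u)
    (psi i0) (gmul c' (gmul y (ginv c))).
- by move=> z; rewrite /= emb_str.
- by rewrite unitmx_mul pU map_unitmx.
- rewrite (rhoM c') (rhoM y) rhoI c'E q'E !map_mxM cE yE !mulmxA mulmxKV ?rhoU //.
  congr (_ *m _).
  by rewrite -!map_mx_comp; apply: eq_map_mx => z /=; rewrite emb_str.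
by exists a, u; rewrite -mulmxA.
Qed.

Lemma connecting_point : connecting (G_e1 S G) (H1_base_point G C).
Proof.
exists 1%:M, (fun i => 1%:M); split=> [|i|k|i].
- exact: (H1_mx_point b1).
- exact: unitmx1.
- by rewrite !map_mx1 mulmx1 rho1.
- by exists gone; rewrite rho1 !map_mx1 mulmx1.
Qed.

Lemma G_diag_exact : exact (fun _ : unit => gone : G_base G) (G_diag S G) (G_v1 S G).
Proof.
move=> g; split=> [g1|[_ <-]]; last first.
  by apply: functional_extensionality_dep => i; exact: gone_natural.
have [i0] := vert_inhabited S; exists tt; apply: rho_eq; rewrite rho1.
have := congr1 (fun h : G_v S G => rho b (h i0 : pt G (cone_v S i0))) g1.
rewrite /G_diag /G_v1 rho_points_map rho1 -(map_mx1 (cone_v S i0)).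
by move/map_mx_inj.
Qed.

Lemma G_quot_exact : exact (G_diag S G) (G_quot o G) (G_e1 S G).
Proof.
move=> g; split=> [g1|[a <-]]; last first.
  apply: functional_extensionality_dep => k; apply: (@gmulgI _ _ _ (G_right o G (G_diag S G a) k)).
  rewrite /G_quot gmulA gmulgV gmul1g gmulg1; apply: rho_eq.
  rewrite !rho_points_map -!map_mx_comp; apply: eq_map_mx => z /=.
  by rewrite !cone_incl.
have [i0] := vert_inhabited S.
have [k|A AE] := @limit_mx F S o n n (fun i => rho b (g i : pt G (cone_v S i))).
  have /(congr1 (gmul (G_right o G g k))) := congr1 (fun h : G_e S G => h k) g1.
  rewrite /G_quot /G_e1 gmulA gmulgV gmul1g gmulg1.
  move/(congr1 (fun x => rho b (x : pt G (cone_e S k)))).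
  by rewrite !rho_points_map.
have [a aE] := rho_descent pBC pBX pBS (s := idfun) (fun=> erefl) (esym (AE i0)).
exists a; apply: functional_extensionality_dep => i; apply: rho_eq.
by rewrite rho_points_map aE AE.
Qed.

Lemma connecting_kernel x :
  H1_res G C x = H1_v_point G C <-> exists g, connecting g x.
Proof.
split=> [x1|[g [p [q [xp qU _ pq]]]]]; last first.
  apply: functional_extensionality_dep => i; apply/esym.
  have [c cE] := pq i.
  apply/(H1_mx_eq pBC pBX pBS bM b1 (H1_mx_point b1 _ _) (H1_mx_map _ (emb_cone C i) xp)).
  by exists c, (q i); rewrite mulmx1.
have [p xp] := H1_mx_total bM b1 x.
have ex i : exists u, u \in unitmx /\ exists c : pt G (psi i),
    map_mx (emb_cone C i) p = rho b c *m map_mx (sincl i) u.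
  have /esym := congr1 (fun h : H1_v G C => h i) x1.
  move/(H1_mx_eq pBC pBX pBS bM b1 (H1_mx_point b1 _ _) (H1_mx_map _ (emb_cone C i) xp)).
  by move=> [c [u [uU uE]]]; exists u; split=> //; exists c; rewrite uE mulmx1.
pose q i := projT1 (cid (ex i)).
have qU i : q i \in unitmx by case: (projT2 (cid (ex i))).
have qE i : exists c : pt G (psi i), map_mx (emb_cone C i) p = rho b c *m map_mx (sincl i) (q i).
  by case: (projT2 (cid (ex i))).
(* Both sides lie over [F_k^sep] in the coset of the image of [p]; the group element relating them
   descends to [F_k]. *)
have gex k : exists g : pt G (cone_e S k),
    map_mx (incl_r k) (q (r k)) = rho b g *m map_mx (incl_l k) (q (l k)).
  have [c cE] := emb_independent k (H1_mx_admissible xp).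
  have [cl clE] := qE (l k); have [cr crE] := qE (r k).
  have pushE i (ik : i \in ends S k) (d : pt G (psi i)) : exists y : pt G (psi_e k),
      rho b y = map_mx (emb_incl C ik) (rho b d).
    by apply: rho_push => z; rewrite /= emb_str cone_incl.
  have [yl ylE] := pushE _ (left_in o k) cl; have [yr yrE] := pushE _ (right_in o k) cr.
  apply: (coset_descent (e := sincl_e k)
    (x := (gmul (ginv yr) (gmul (ginv c) yl) : pt G (psi_e k)))) => //.
    by rewrite map_unitmx qU.
  rewrite (rhoM (ginv yr)) (rhoM (ginv c)) !rhoI ylE -!map_emb_incl -!mulmxA -map_mxM.
  rewrite -clE cE mulKmx ?rhoU // crE map_mxM -yrE mulKmx ?rhoU //.
pose g k := projT1 (cid (gex k)).
exists g, p, q; split=> // k.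
by rewrite -(projT2 (cid (gex k))).
Qed.

Lemma H1_pair_exact : exact_pair (H1_res G C) (H1_left o G C) (H1_right o G C).
Proof.
move=> y; split=> [ylr|[x <-]]; last first.
  apply: functional_extensionality_dep => k; apply/esym.
  have [p xp] := H1_mx_total bM b1 x.
  have mxE i (ik : i \in ends S k) := H1_mx_map (cone_incl ik) (emb_incl C ik)
    (H1_mx_map (phi := idfun) (psi := cone_v S i) (fun=> erefl) (emb_cone C i) xp).
  apply/(H1_mx_eq pBC pBX pBS bM b1 (mxE _ (right_in o k)) (mxE _ (left_in o k))).
  have [c cE] := emb_independent k (H1_mx_admissible xp).
  by exists c, 1%:M; rewrite unitmx1 map_mx1 mulmx1.
pose p i := projT1 (cid (H1_mx_total bM b1 (y i))).
have yp i : H1_mx b (y i) (p i) := projT2 (cid (H1_mx_total bM b1 (y i))).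
have mxE i k (ik : i \in ends S k) := H1_mx_map (cone_incl ik) (emb_incl C ik) (yp i).
have uex k : exists u, u \in unitmx /\ exists a : pt G (psi_e k),
    map_mx (emb_r k) (p (r k)) = rho b a *m map_mx (emb_l k) (p (l k)) *m map_mx (sincl_e k) u.
  have := congr1 (fun h : H1_e G C => h k) ylr.
  move/(H1_mx_eq pBC pBX pBS bM b1 (mxE _ _ (left_in o k)) (mxE _ _ (right_in o k))).
  by move=> [a [u [uU uE]]]; exists u; split=> //; exists a.
pose u k := projT1 (cid (uex k)).
have uU k : u k \in unitmx by case: (projT2 (cid (uex k))).
have uE k : exists a : pt G (psi_e k), map_mx (emb_r k) (p (r k)) =
    rho b a *m map_mx (emb_l k) (p (l k)) *m map_mx (sincl_e k) (u k).
  by case: (projT2 (cid (uex k))).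
(* The cosets of the [p i] match over the edges only up to right multiplication by [u k]. Patching
   produces [h i] that absorb this discrepancy without changing the classes. *)
have [k|h [hU hE]] := @patch_GL F S o n (fun k => invmx (u k)) _ beta_equiv.
  by rewrite unitmx_inv uU.
pose p' i := p i *m map_mx (sincl i) (h i).
have p'U i : p' i \in unitmx.
  by rewrite unitmx_mul map_unitmx hU; case: (H1_mx_admissible (yp i)) => ->.
have [i|k|q [q_adm qE]] := @coset_point _ _ _ _ _ pBC pBX pBS bM b1 _ o C smG p'.
- split=> [|s]; first exact: (p'U i).
  have [_ /(_ s)[c cE]] := H1_mx_admissible (yp i).
  exists c; rewrite /p' map_mxM mulmxA cE; congr (_ *m _).
  by rewrite -map_mx_comp; apply: eq_map_mx => z /=; rewrite gal_fix.
- have [a aE] := uE k; exists (ginv a).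
  rewrite /p' !map_mxM !map_emb_incl aE rhoI -hE !map_mxM map_invmx !mulmxA.
  by rewrite mulVmx ?rhoU // mul1mx mulmxK // map_unitmx uU.
have [x xq] := H1_mx_exists pBC pBX pBS bM q_adm.
exists x; apply: functional_extensionality_dep => i; apply/esym.
apply/(H1_mx_eq pBC pBX pBS bM b1 (yp i) (H1_mx_map _ (emb_cone C i) xq)).
have [c cE] := qE i.
by exists c, (h i); rewrite cE mulmxA.
Qed.

End ExactSequence.

Theorem theorem2p4 (F : fieldType) (S : factorization_system F)
    (beta_equiv : is_equivalence (base_change S))
    (o : edge_ordering S)
    (G : linear_algebraic_group F)
    (C : closure_system S) :
  exists delta : G_e S G -> H1_base G C,
    delta (G_e1 S G) = H1_base_point G C /\
    exact (fun _ : unit => gone : G_base G) (G_diag S G) (G_v1 S G) /\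
    exact (G_diag S G) (G_quot o G) (G_e1 S G) /\
    exact (G_quot o G) delta (H1_base_point G C) /\
    exact delta (H1_res G C) (H1_v_point G C) /\
    exact_pair (H1_res G C) (H1_left o G C) (H1_right o G C) /\
    forall g g' : G_e S G,
      delta g = delta g' <->
      exists h : G_v S G, forall k : edge S,
        g k = gmul (ginv (G_right o G h k)) (gmul (g' k) (G_left o G h k)).
Proof.
have [n [b [pB [pBC pBX pBS bM b1]]]] := representation_exists (lag_finite_type G).
have [delta deltaP] := choice (connecting_total pBC pBX pBS bM b1 o C (@lag_smooth _ G) beta_equiv).
(* Single-valuedness of the chosen map, by the description of the fibres with [h] trivial. *)
have deltaE g x : connecting b o g x -> delta g = x.
  move=> gx; apply/(connecting_eq pBC pBX pBS bM b1 (deltaP g) gx).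
  exists (G_v1 S G) => k.
  rewrite [G_left _ _ _ _]gone_natural [G_right _ _ _ _]gone_natural gmulg1.
  by rewrite -[LHS](gmulKg gone) gmul1g.
have deltaPt := deltaE _ _ (connecting_point b1 o C).
exists delta; split; first exact: deltaPt.
split; first exact: (G_diag_exact pBC pBX pBS b1).
split; first exact: (G_quot_exact pBC pBX pBS).
have eq g g' := connecting_eq pBC pBX pBS bM b1 (deltaP g) (deltaP g').
split.
  move=> g; rewrite -deltaPt eq; split=> -[h hE]; exists h.
    by apply: functional_extensionality_dep => k; rewrite hE gmul1g.
  by move=> k; rewrite gmul1g -hE.
split; last by split=> //; exact: (H1_pair_exact pBC pBX pBS bM b1 o (@lag_smooth _ G) beta_equiv).
move=> x; rewrite (connecting_kernel pBC pBX pBS bM b1 o).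
split=> [[g gx]|[g <-]]; first by exists g; exact: deltaE.
by exists g; exact: deltaP.
Qed.
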